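(* Let $G$ be a trivalent plane graph on $S^2$ with branched double cover $p\colon\Lambda_G\to S^2$ as described in the context, and let $q\in\Lambda_G$ be a point lying in $p^{-1}(f)$ for some open face $f$. If $\gamma_1,\gamma_2$ are generic loops in $\Lambda_G$ based at $q$ with $[\gamma_1]=[\gamma_2]\in\pi_1(\Lambda_G,q)$, then their geometric elements in $\Pi$ coincide. Consequently, assigning to each class in $\pi_1(\Lambda_G,q)$ the geometric element of any generic representative gives a well-defined group homomorphism $\Psi_q\colon\pi_1(\Lambda_G,q)\to\Pi$.
   Context: A trivalent plane graph $G$ is a graph with every vertex of degree $3$ together with an embedding into $S^2$ (up to isotopy); $V,E,F$ denote its vertices, edges and faces. Let $p\colon\Lambda_G\to S^2$ be a double cover branched exactly over $V$ such that for each open face $f$ the two components of $p^{-1}(f)$ are labelled $+$ and $-$, with the property that any path in $\Lambda_G$ whose projection crosses exactly one edge transversely passes from a $+$ region to a $-$ region or vice versa. For $v\in V$ write $\tilde v=p^{-1}(v)$. Let $\widetilde E$ be the set of pairs $(e,\mathfrak o)$ of an edge and an orientation of it, $\overline{\mathfrak o}$ the opposite orientation, and let $F(\widetilde E)$ be the free group on generators $\lambda_{e,\mathfrak o}$, $(e,\mathfrak o)\in\widetilde E$. For a vertex $v$ with incident edges $e_1,e_2,e_3$ in counterclockwise cyclic order and $\mathfrak o_i$ the orientation of $e_i$ pointing towards $v$, set $w_v=\lambda_{e_1,\mathfrak o_1}\lambda_{e_2,\overline{\mathfrak o}_2}^{-1}\lambda_{e_3,\mathfrak o_3}\lambda_{e_1,\overline{\mathfrak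 o}_1}^{-1}\lambda_{e_2,\mathfrak o_2}\lambda_{e_3,\overline{\mathfrak o}_3}^{-1}$ (its conjugacy class does not depend on the starting edge), and let $\Pi=F(\widetilde E)/N$, where $N$ is the normal subgroup generated by all $w_v$, $v\in V$. Generator convention: a transverse crossing of an edge $e$ in direction $d$ going from a $+$ region to a $-$ region is assigned $\lambda_{e,\mathfrak o}$, where $\mathfrak o$ is the orientation of $e$ such that ($d$, $\mathfrak o$) is a positively oriented frame of $S^2$; a crossing from $-$ to $+$ in direction $d$ is assigned $\lambda_{e,\mathfrak o}^{-1}$ where ($-d$, $\mathfrak o$) is positively oriented. A loop in $\Lambda_G$ is generic if it avoids $p^{-1}(V)$ and its projection crosses edges only transversely at interior times and does not start/end on an edge. The geometric element of a generic loop $\gamma$ is the image in $\Pi$ of the word obtained by reading, in order, the generators assigned to the successive edge crossings of $p\circ\gamma$, where the $\pm$ label at each time is the label of the sheet containing $\gamma(t)$. *)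

(* Defs.v *)
From HB Require Import structures.
From mathcomp Require Import all_boot all_order all_algebra.
From mathcomp Require Import generic_quotient.
From mathcomp Require Import ring lra.
From mathcomp Require Import all_classical all_reals all_analysis.
Import numFieldNormedType.Exports.

Set Implicit Arguments.
Unset Strict Implicit.
Unset Printing Implicit Defensive.

Import Order.TTheory GRing.Theory Num.Theory.

Local Open Scope classical_set_scope.
Local Open Scope ring_scope.
Local Open Scope quotient_scope.

(* In a word, [(a, true)] stands for the generator [a] and [(a, false)] for its
   inverse. *)
Definition word (A : choiceType) := seq (A * bool).

Inductive word_eq (A : choiceType) : word A -> word A -> Prop :=
| word_eq_refl w : word_eq w w
| word_eq_sym w1 w2 : word_eq w1 w2 -> word_eq w2 w1
| word_eq_trans w1 w2 w3 : word_eq w1 w2 -> word_eq w2 w3 -> word_eq w1 w3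
| word_eq_cancel w1 w2 a b :
    word_eq (w1 ++ [:: (a, b), (a, ~~ b) & w2]) (w1 ++ w2).

Definition word_inv (A : choiceType) (w : word A) : word A :=
  rev [seq (l.1, ~~ l.2) | l <- w].

Section FreeGroup.
Variable A : choiceType.
Implicit Types u v w : word A.

Lemma word_eq_catl w u v : word_eq u v -> word_eq (w ++ u) (w ++ v).
Proof.
elim=> [u'|u' v' _|u1 u2 u3 _ + _|u1 u2 a b]; first exact: word_eq_refl.
- exact: word_eq_sym.
- exact: word_eq_trans.
- by rewrite !catA; exact: word_eq_cancel.
Qed.

Lemma word_eq_catr w u v : word_eq u v -> word_eq (u ++ w) (v ++ w).
Proof.
elim=> [u'|u' v' _|u1 u2 u3 _ + _|u1 u2 a b]; first exact: word_eq_refl.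
- exact: word_eq_sym.
- exact: word_eq_trans.
- by rewrite -!catA; exact: word_eq_cancel.
Qed.

Lemma word_eq_cat u u' v v' :
  word_eq u u' -> word_eq v v' -> word_eq (u ++ v) (u' ++ v').
Proof.
by move=> uu' vv'; exact: word_eq_trans (word_eq_catr v uu') (word_eq_catl u' vv').
Qed.

Lemma word_inv_cat u v : word_inv (u ++ v) = word_inv v ++ word_inv u.
Proof. by rewrite /word_inv map_cat rev_cat. Qed.

Lemma word_invK : involutive (@word_inv A).
Proof.
move=> w; rewrite /word_inv map_rev revK -map_comp -[RHS]map_id.
by apply: eq_map => -[a b] /=; rewrite negbK.
Qed.

Lemma word_eq_inv u v : word_eq u v -> word_eq (word_inv u) (word_inv v).
Proof.
elim=> [u'|u' v' _|u1 u2 u3 _ + _|u1 u2 a b]; first exact: word_eq_refl.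
- exact: word_eq_sym.
- exact: word_eq_trans.
- rewrite !word_inv_cat.
  have -> : word_inv [:: (a, b), (a, ~~ b) & u2]
      = word_inv u2 ++ [:: (a, b); (a, ~~ b)].
    by rewrite -[[:: _, _ & _]]/([:: (a, b); (a, ~~ b)] ++ u2) word_inv_cat
      /word_inv /rev /= negbK.
  by rewrite -catA; exact: word_eq_cancel.
Qed.

Lemma word_eq_mulV w : word_eq (w ++ word_inv w) [::].
Proof.
elim: w => [|[a b] w IH]; first exact: word_eq_refl.
rewrite -cat1s word_inv_cat -catA (catA w).
apply: word_eq_trans (word_eq_catl _ (word_eq_catr _ IH)) _.
exact: (@word_eq_cancel _ [::] [::] a b).
Qed.

Definition word_eqb u v : bool := `[< word_eq u v >].

Lemma word_eqb_equiv : equiv_class_of word_eqb.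
Proof.
split=> [w|u v|v u w]; first by apply/asboolP; exact: word_eq_refl.
- by apply/idP/idP => /asboolP uv; apply/asboolP; exact: word_eq_sym.
- move=> /asboolP uv /asboolP vw; apply/asboolP; exact: word_eq_trans uv vw.
Qed.

Definition word_equiv := EquivRelPack word_eqb_equiv.

Definition free_group := {eq_quot word_equiv}.
HB.instance Definition _ := Choice.on free_group.
HB.instance Definition _ := EqQuotient.on free_group.

Lemma free_groupP u v : \pi_free_group u = \pi_free_group v <-> word_eq u v.
Proof.
split=> [/eqmodP|uv]; first by move/asboolP.
by apply/eqmodP/asboolP.
Qed.

Definition free_one : free_group := \pi_free_group [::].
Definition free_mul (x y : free_group) : free_group :=
  \pi_free_group (repr x ++ repr y).
Definition free_inv (x : free_group) : free_group :=
  \pi_free_group (word_inv (repr x)).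

Lemma free_mulE u v :
  free_mul (\pi_free_group u) (\pi_free_group v) = \pi_free_group (u ++ v).
Proof.
by apply/free_groupP; apply: word_eq_cat; apply/free_groupP; rewrite reprK.
Qed.

Lemma free_invE u : free_inv (\pi_free_group u) = \pi_free_group (word_inv u).
Proof.
by apply/free_groupP; apply: word_eq_inv; apply/free_groupP; rewrite reprK.
Qed.

Let free_surj x : exists w, x = \pi_free_group w.
Proof. by exists (repr x); rewrite reprK. Qed.

Lemma free_mulA : associative free_mul.
Proof.
move=> x y z; have [u ->] := free_surj x; have [v ->] := free_surj y; have [w ->] := free_surj z.
by rewrite (free_mulE v) (free_mulE u v) (free_mulE u) (free_mulE (u ++ v)) catA.
Qed.

Lemma free_mul1 : left_id free_one free_mul.
Proof. by move=> x; have [u ->] := free_surj x; rewrite (free_mulE [::]). Qed.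

Lemma free_mulr1 : right_id free_one free_mul.
Proof. by move=> x; have [u ->] := free_surj x; rewrite (free_mulE u) cats0. Qed.

Lemma free_mulV : right_inverse free_one free_inv free_mul.
Proof.
move=> x; have [u ->] := free_surj x; rewrite (free_invE u) (free_mulE u).
by apply/free_groupP; exact: word_eq_mulV.
Qed.

Lemma free_mulVg : left_inverse free_one free_inv free_mul.
Proof.
move=> x; have [u ->] := free_surj x; rewrite (free_invE u) (free_mulE _ u).
apply/free_groupP.
by rewrite -{2}[u]word_invK; exact: word_eq_mulV.
Qed.

HB.instance Definition _ :=
  isGroup.Build free_group free_mulA free_mul1 free_mulr1 free_mulVg free_mulV.

Definition free_word (w : word A) : free_group := \pi_free_group w.
Definition free_gen (a : A) : free_group := free_word [:: (a, true)].

End FreeGroup.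

Definition normal_subgroup (G : groupType) (N : set G) : Prop :=
  [/\ N 1%g, (forall x y, N x -> N y -> N (x / y)%g)
    & (forall x y, N x -> N (x ^ y)%g)].

Definition normal_closure (G : groupType) (S : set G) : set G :=
  smallest (@normal_subgroup G) S.

Lemma normal_closure_normal (G : groupType) (S : set G) :
  normal_subgroup (normal_closure S).
Proof.
split=> [N [] []//|x y Nx Ny N NS|x y Nx N NS].
- by case: (NS) => -[_ + _] _; apply; [exact: Nx|exact: Ny].
- by case: (NS) => -[_ _ +] _; apply; exact: Nx.
Qed.

Section QuotientGroup.
Variables (G : groupType) (S : set G).
Local Open Scope group_scope.

Let N := normal_closure S.

Let N1 : N 1.
Proof. by case: (normal_closure_normal S). Qed.
Let NF x y : N x -> N y -> N (x / y).
Proof. by case: (normal_closure_normal S) => _ + _; apply. Qed.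
Let NJ x y : N x -> N (x ^ y).
Proof. by case: (normal_closure_normal S) => _ _; apply. Qed.
Let NV x : N x -> N x^-1.
Proof. by move=> Nx; rewrite -div1g; exact: NF. Qed.
Let NM x y : N x -> N y -> N (x * y).
Proof. by move=> Nx Ny; rewrite -[y]invgK; apply: NF => //; exact: NV. Qed.

Definition coset_eqb (x y : G) : bool := `[< N (x^-1 * y) >].

Lemma coset_eqb_equiv : equiv_class_of coset_eqb.
Proof.
split=> [x|x y|y x z]; first by apply/asboolP; rewrite mulVg.
- apply/idP/idP => /asboolP /NV; rewrite invgM invgK => ?; exact/asboolP.
- move=> /asboolP xy /asboolP yz; apply/asboolP.
  by have := NM xy yz; rewrite mulgA mulgK.
Qed.

Definition coset_equiv := EquivRelPack coset_eqb_equiv.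

Definition quot_group := {eq_quot coset_equiv}.
HB.instance Definition _ := Choice.on quot_group.
HB.instance Definition _ := EqQuotient.on quot_group.

Lemma quot_groupP x y :
  \pi_quot_group x = \pi_quot_group y <-> normal_closure S (x^-1 * y).
Proof.
split=> [/eqmodP|xy]; first by move/asboolP.
by apply/eqmodP/asboolP.
Qed.

Definition quot_one : quot_group := \pi_quot_group 1.
Definition quot_mul (x y : quot_group) : quot_group :=
  \pi_quot_group (repr x * repr y).
Definition quot_inv (x : quot_group) : quot_group :=
  \pi_quot_group (repr x)^-1.

Lemma quot_mulE x y :
  quot_mul (\pi_quot_group x) (\pi_quot_group y) = \pi_quot_group (x * y).
Proof.
rewrite /quot_mul; set x' := repr _; set y' := repr _.
have xx' : N (x'^-1 * x) by apply/quot_groupP; rewrite /x' reprK.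
have yy' : N (y'^-1 * y) by apply/quot_groupP; rewrite /y' reprK.
apply/quot_groupP; have := NM (NJ y' xx') yy'; rewrite /conjg.
by rewrite invgM !mulgA mulgK.
Qed.

Lemma quot_invE x : quot_inv (\pi_quot_group x) = \pi_quot_group x^-1.
Proof.
rewrite /quot_inv; set x' := repr _.
have xx' : N (x^-1 * x') by apply/quot_groupP; rewrite /x' reprK.
apply/quot_groupP; have := NJ (x^-1) xx'; rewrite /conjg.
by rewrite !invgK !mulgA mulgV mul1g.
Qed.

Let quot_surj x : exists w, x = \pi_quot_group w.
Proof. by exists (repr x); rewrite reprK. Qed.

Lemma quot_mulA : associative quot_mul.
Proof.
move=> x y z; have [u ->] := quot_surj x; have [v ->] := quot_surj y.
have [w ->] := quot_surj z.
by rewrite (quot_mulE v) (quot_mulE u v) (quot_mulE u) (quot_mulE (u * v)) mulgA.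
Qed.

Lemma quot_mul1 : left_id quot_one quot_mul.
Proof. by move=> x; have [u ->] := quot_surj x; rewrite (quot_mulE 1) mul1g. Qed.

Lemma quot_mulr1 : right_id quot_one quot_mul.
Proof. by move=> x; have [u ->] := quot_surj x; rewrite (quot_mulE u) mulg1. Qed.

Lemma quot_mulV : right_inverse quot_one quot_inv quot_mul.
Proof.
move=> x; have [u ->] := quot_surj x.
by rewrite (quot_invE u) (quot_mulE u) mulgV.
Qed.

Lemma quot_mulVg : left_inverse quot_one quot_inv quot_mul.
Proof.
move=> x; have [u ->] := quot_surj x.
by rewrite (quot_invE u) (quot_mulE _ u) mulVg.
Qed.

HB.instance Definition _ :=
  isGroup.Build quot_group quot_mulA quot_mul1 quot_mulr1 quot_mulVg quot_mulV.

Definition quot_proj (x : G) : quot_group := \pi_quot_group x.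

End QuotientGroup.

Lemma within_continuousP (X Y : topologicalType) (A : set X) (f : X -> Y) :
  {within A, continuous f} <->
  forall x, A x -> forall U, nbhs (f x) U -> nbhs x [set y | A y -> U (f y)].
Proof.
rewrite continuous_subspace_in; split=> [cf x Ax U fxU|cf x /set_mem Ax U fxU].
  have : nbhs (x : subspace A) (f @^-1` U) := cf x (mem_set Ax) U fxU.
  by rewrite /nbhs /= -nbhs_subspace_in.
suff : nbhs (x : subspace A) (f @^-1` U) by [].
by rewrite /nbhs /= -nbhs_subspace_in//; exact: cf.
Qed.

Lemma within_continuous_comp (X Y Z : topologicalType) (A : set X) (B : set Y) (f : X -> Y) (g : Y -> Z) :
  {within A, continuous f} -> (forall x, A x -> B (f x)) ->
  {within B, continuous g} -> {within A, continuous (g \o f)}.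
Proof.
move=> /within_continuousP cf AB /within_continuousP cg.
apply/within_continuousP => x Ax U gfxU.
have := cf x Ax _ (cg (f x) (AB x Ax) U gfxU).
by apply: filterS => y + Ay; apply => //; exact: AB.
Qed.

Lemma within_continuous_ext (X Y : topologicalType) (A : set X) (f g : X -> Y) :
  (forall x, A x -> f x = g x) -> {within A, continuous f} ->
  {within A, continuous g}.
Proof.
move=> fg /within_continuousP cf; apply/within_continuousP => x Ax U.
rewrite -fg// => /(cf x Ax); apply: filterS => y + Ay.
by rewrite -fg//; apply.
Qed.

Lemma continuous_pair (X Y Z : topologicalType) (f : X -> Y) (g : X -> Z) :
  continuous f -> continuous g -> continuous (fun x => (f x, g x)).
Proof. by move=> cf cg x; apply: cvg_pair; [exact: cf|exact: cg]. Qed.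

Lemma continuous_fst (X Y : topologicalType) : continuous (@fst X Y).
Proof. by move=> x; exact: cvg_fst. Qed.

Lemma continuous_snd (X Y : topologicalType) : continuous (@snd X Y).
Proof. by move=> x; exact: cvg_snd. Qed.

Section FundamentalGroup.
Context {R : realType} {T : topologicalType} (q : T).

Local Notation I := (`[0, 1]%classic : set R).

(* Paths and loops are functions on the whole of [R]; only their values on
   [0, 1] matter. *)
Record loop := Loop {
  loop_fun :> R -> T;
  loop_cont : {within I, continuous loop_fun};
  loop0 : loop_fun 0 = q;
  loop1 : loop_fun 1 = q }.

HB.instance Definition _ := gen_eqMixin loop.
HB.instance Definition _ := gen_choiceMixin loop.

(* [H (s, t)]: [s] is the time of the homotopy, [t] the time along the loop. *)
Definition homotopic (c d : loop) : Prop := exists H : R * R -> T,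
  [/\ {within I `*` I, continuous H},
      forall t, I t -> H (0, t) = c t,
      forall t, I t -> H (1, t) = d t
    & forall s, I s -> H (s, 0) = q /\ H (s, 1) = q].

Let II (t : R) : I t <-> 0 <= t <= 1.
Proof. by rewrite /= in_itv. Qed.

Let I0 : I 0. Proof. by apply/II; rewrite lexx ler01. Qed.
Let I1 : I 1. Proof. by apply/II; rewrite lexx ler01. Qed.

Let Ihalfl (t : R) : 0 <= t <= 2^-1 -> I (2 * t).
Proof. by move=> ?; apply/II; lra. Qed.
Let Ihalfr (t : R) : 2^-1 <= t <= 1 -> I (2 * t - 1).
Proof. by move=> ?; apply/II; lra. Qed.

Lemma homotopic_reparam (e c d : loop) (f g : R -> R) :
  continuous f -> continuous g ->
  (forall t, I t -> I (f t)) -> (forall t, I t -> I (g t)) ->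
  (forall t, I t -> c t = e (f t)) -> (forall t, I t -> d t = e (g t)) ->
  f 0 = g 0 -> f 1 = g 1 -> homotopic c d.
Proof.
move=> cf cg If Ig ce de fg0 fg1.
pose h (x : R * R) := (1 - x.1) * f x.2 + x.1 * g x.2.
have ch : continuous h.
  move=> x; apply: cvgD; apply: cvgM.
  - by apply: cvgB; [exact: cvg_cst|exact: cvg_fst].
  - by apply: continuous_comp; [exact: cvg_snd|exact: cf].
  - exact: cvg_fst.
  - by apply: continuous_comp; [exact: cvg_snd|exact: cg].
have Ih x : (I `*` I) x -> I (h x).
  case: x => s t [/= /II Is It]; rewrite /h /=; apply/II.
  by move: (If _ It) (Ig _ It) => /II ? /II ?; nra.
exists (e \o h); split.
- apply: within_continuous_comp Ih (@loop_cont e).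
  exact: continuous_subspaceT.
- by move=> t It; rewrite /h /= subr0 mul1r mul0r addr0 ce.
- by move=> t It; rewrite /h /= subrr mul0r mul1r add0r de.
- move=> s Is; rewrite /h /= -fg0 -fg1 -!mulrDl subrK !mul1r.
  by rewrite -!ce// loop0 loop1.
Qed.

Lemma homotopic_refl c : homotopic c c.
Proof. by apply: (@homotopic_reparam c c c id id) => //; move=> x. Qed.

Lemma homotopic_sym c d : homotopic c d -> homotopic d c.
Proof.
move=> [H [cH H0 H1 Hq]]; exists (H \o (fun x => (1 - x.1, x.2))); split.
- apply: within_continuous_comp cH => //.
    apply/continuous_subspaceT/continuous_pair; last exact: continuous_snd.
    by move=> x; apply: cvgB; [exact: cvg_cst|exact: cvg_fst].
  by move=> [s t] [/= /II Is It]; split => //=; apply/II; lra.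
- by move=> t It /=; rewrite subr0 H1.
- by move=> t It /=; rewrite subrr H0.
- by move=> s /II Is /=; apply: Hq; apply/II; lra.
Qed.

Lemma within_paste (P : set R) (F G : R * R -> T) :
  {within P `*` I, continuous F} -> {within P `*` I, continuous G} ->
  closed P ->
  (forall s, P s -> F (s, 1) = G (s, 0)) ->
  {within P `*` I, continuous (fun x : R * R =>
     if x.2 <= 2^-1 then F (x.1, 2 * x.2) else G (x.1, 2 * x.2 - 1))}.
Proof.
move=> cF cG clP FG.
have cl (a b : R) : closed (P `*` `[a, b]%classic).
  rewrite (_ : _ `*` _ = fst @^-1` P `&` snd @^-1` `[a, b]%classic) //.
  apply: closedI.
  - by move/continuous_closedP: (@continuous_fst R R); apply.
  - move/continuous_closedP: (@continuous_snd R R); apply.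
    exact: interval_closed.
have -> : P `*` I = P `*` `[0, 2^-1]%classic `|` P `*` `[2^-1, 1]%classic.
  apply/seteqP; split=> -[s t] /=; rewrite !in_itv /=.
    move=> [Ps tI]; have [tle|tgt] := leP t 2^-1; [left|right]; split=> //; lra.
  by move=> [] [Ps tI]; split=> //; lra.
apply: withinU_continuous; [exact: cl|exact: cl| |].
- apply: (@within_continuous_ext _ _ _ (F \o (fun x => (x.1, 2 * x.2)))).
    by move=> [s t] [/= _]; rewrite in_itv /= => /andP[_ ->].
  apply: within_continuous_comp cF.
    apply/continuous_subspaceT/continuous_pair; first exact: continuous_fst.
    by move=> x; apply: cvgM; [exact: cvg_cst|exact: cvg_snd].
  by move=> [s t] [/= Ps]; rewrite in_itv /= => It; split=> //=; exact: Ihalfl.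
- apply: (@within_continuous_ext _ _ _ (G \o (fun x => (x.1, 2 * x.2 - 1)))).
    move=> [s t] [/= Ps]; rewrite in_itv /= => /andP[t1 _].
    case: ifPn => // t2; have -> : t = 2^-1 by apply/eqP; rewrite eq_le t1 t2.
    by rewrite divff// subrr FG.
  apply: within_continuous_comp cG.
    apply/continuous_subspaceT/continuous_pair; first exact: continuous_fst.
    move=> x; apply: cvgB; last exact: cvg_cst.
    by apply: cvgM; [exact: cvg_cst|exact: cvg_snd].
  by move=> [s t] [/= Ps]; rewrite in_itv /= => It; split=> //=; exact: Ihalfr.
Qed.

Lemma homotopic_trans c d e : homotopic c d -> homotopic d e -> homotopic c e.
Proof.
move=> [H [cH H0 H1 Hq]] [K [cK K0 K1 Kq]].
have sw (F : R * R -> T) : {within I `*` I, continuous F} ->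
    {within I `*` I, continuous (F \o (fun x => (x.2, x.1)))}.
  move=> cF; apply: within_continuous_comp cF.
    apply/continuous_subspaceT/continuous_pair.
    - exact: continuous_snd.
    - exact: continuous_fst.
  by move=> [s t] [].
have clI : closed I by exact: interval_closed.
have HK s : I s -> (H \o (fun x => (x.2, x.1))) (s, 1) =
                   (K \o (fun x => (x.2, x.1))) (s, 0).
  by move=> Is /=; rewrite H1// K0.
have := sw _ (within_paste (sw _ cH) (sw _ cK) clI HK).
move=> cL; eexists; split; first exact: cL.
- by move=> t It /=; rewrite ifT ?invr_ge0 ?ler0n// mulr0 H0.
- move=> t It /=; rewrite ifF; last by apply/negbTE; lra.
  by rewrite mulr1 (_ : 2 - 1 = 1 :> R) ?K1//; lra.
- move=> s /II Is /=; case: ifPn => sle; first by apply/Hq/Ihalfl; lra.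
  by apply/Kq/Ihalfr; lra.
Qed.

Definition homotopicb (c d : loop) : bool := `[< homotopic c d >].

Lemma homotopicb_equiv : equiv_class_of homotopicb.
Proof.
split=> [c|c d|d c e]; first by apply/asboolP; exact: homotopic_refl.
- by apply/idP/idP => /asboolP cd; apply/asboolP; exact: homotopic_sym.
- move=> /asboolP cd /asboolP de; apply/asboolP; exact: homotopic_trans cd de.
Qed.

Definition homotopic_equiv := EquivRelPack homotopicb_equiv.

Definition pi1 := {eq_quot homotopic_equiv}.
HB.instance Definition _ := Choice.on pi1.
HB.instance Definition _ := EqQuotient.on pi1.

Definition loop_class (c : loop) : pi1 := \pi_pi1 c.

Lemma loop_classP c d : loop_class c = loop_class d <-> homotopic c d.
Proof.
split=> [/eqmodP|cd]; first by move/asboolP.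
by apply/eqmodP/asboolP.
Qed.

Lemma loop_cst_proof : {within I, continuous (cst q : R -> T)}.
Proof. by apply: continuous_subspaceT => x; exact: cvg_cst. Qed.

Definition loop_cst := Loop loop_cst_proof erefl erefl.

Lemma within_reparam (c : loop) (f : R -> R) :
  continuous f -> (forall t, I t -> I (f t)) ->
  {within I, continuous (c \o f)}.
Proof.
move=> cf If; apply: within_continuous_comp If (@loop_cont c).
exact: continuous_subspaceT.
Qed.

Lemma continuous_rev : continuous (fun t : R => 1 - t).
Proof. by move=> x; apply: cvgB; [exact: cvg_cst|exact: cvg_id]. Qed.

Lemma loop_rev_proof (c : loop) : {within I, continuous (fun t => c (1 - t))}.
Proof.
apply: (within_reparam (f := fun t => 1 - t)) continuous_rev _.
by move=> t /II ?; apply/II; lra.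
Qed.

Lemma loop_rev0 (c : loop) : c (1 - 0) = q.
Proof. by rewrite subr0 loop1. Qed.

Lemma loop_rev1 (c : loop) : c (1 - 1) = q.
Proof. by rewrite subrr loop0. Qed.

Definition loop_rev c := Loop (@loop_rev_proof c) (loop_rev0 c) (loop_rev1 c).

Definition cat_fun (c d : R -> T) (t : R) : T :=
  if t <= 2^-1 then c (2 * t) else d (2 * t - 1).

Lemma loop_cat_proof (c d : loop) : {within I, continuous (cat_fun c d)}.
Proof.
have c2 (e : loop) : {within setT `*` I, continuous (e \o @snd R R)}.
  apply: within_continuous_comp (@loop_cont e); last by move=> [s t] [].
  by apply: continuous_subspaceT => x; exact: cvg_snd.
have H := within_paste (c2 c) (c2 d) closedT.
apply: (@within_continuous_ext _ _ _
   ((fun x : R * R => if x.2 <= 2^-1 then (c \o snd) (x.1, 2 * x.2)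
      else (d \o snd) (x.1, 2 * x.2 - 1)) \o (fun t => (0, t)))) => //.
apply: within_continuous_comp; last first.
- by apply: H => s _ /=; rewrite loop0 loop1.
- by move=> t It; split.
- by apply/continuous_subspaceT/continuous_pair => x;
    [exact: cvg_cst|exact: cvg_id].
Qed.

Lemma loop_cat0 (c d : loop) : cat_fun c d 0 = q.
Proof. by rewrite /cat_fun ifT ?invr_ge0 ?ler0n// mulr0 loop0. Qed.

Lemma loop_cat1 (c d : loop) : cat_fun c d 1 = q.
Proof.
rewrite /cat_fun ifF; last by apply/negbTE; lra.
by rewrite mulr1 (_ : 2 - 1 = 1 :> R) ?loop1//; lra.
Qed.

Definition loop_cat c d := Loop (@loop_cat_proof c d) (loop_cat0 c d) (loop_cat1 c d).

Lemma homotopic_cat c c' d d' :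
  homotopic c c' -> homotopic d d' -> homotopic (loop_cat c d) (loop_cat c' d').
Proof.
move=> [H [cH H0 H1 Hq]] [K [cK K0 K1 Kq]].
have HK s : I s -> H (s, 1) = K (s, 0).
  by move=> Is; rewrite (Hq _ Is).2 (Kq _ Is).1.
have clI : closed I by exact: interval_closed.
eexists; split; first exact: (within_paste cH cK clI HK).
- move=> t /II It /=; rewrite /cat_fun; case: ifPn => tle.
    by rewrite H0//; apply: Ihalfl; lra.
  by rewrite K0//; apply: Ihalfr; lra.
- move=> t /II It /=; rewrite /cat_fun; case: ifPn => tle.
    by rewrite H1//; apply: Ihalfl; lra.
  by rewrite K1//; apply: Ihalfr; lra.
- move=> s Is /=; rewrite ifT ?invr_ge0 ?ler0n// mulr0 (Hq _ Is).1; split=> //.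
  rewrite ifF; last by apply/negbTE; lra.
  by rewrite mulr1 (_ : 2 - 1 = 1 :> R) ?(Kq _ Is).2//; lra.
Qed.

Lemma homotopic_rev c d : homotopic c d -> homotopic (loop_rev c) (loop_rev d).
Proof.
move=> [H [cH H0 H1 Hq]]; exists (H \o (fun x => (x.1, 1 - x.2))); split.
- apply: within_continuous_comp cH => //.
    apply/continuous_subspaceT/continuous_pair; first exact: continuous_fst.
    by move=> x; apply: cvgB; [exact: cvg_cst|exact: cvg_snd].
  by move=> [s t] [/= Is /II It]; split => //=; apply/II; lra.
- by move=> t /II It /=; rewrite H0//; apply/II; lra.
- by move=> t /II It /=; rewrite H1//; apply/II; lra.
- by move=> s Is /=; rewrite subr0 subrr; have [-> ->] := Hq s Is.
Qed.

Let caff (a b : R) : continuous (fun t : R => a * t + b).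
Proof.
move=> x; apply: cvgD; last exact: cvg_cst.
by apply: cvgM; [exact: cvg_cst|exact: cvg_id].
Qed.

Let cminr (f g : R -> R) : continuous f -> continuous g ->
  continuous (fun t => Num.min (f t) (g t)).
Proof. by move=> cf cg x; apply: continuous_min; [exact: cf|exact: cg]. Qed.

Let cmaxr (f g : R -> R) : continuous f -> continuous g ->
  continuous (fun t => Num.max (f t) (g t)).
Proof. by move=> cf cg x; apply: continuous_max; [exact: cf|exact: cg]. Qed.

Lemma homotopic_cat_rev c : homotopic (loop_cat c (loop_rev c)) loop_cst.
Proof.
apply: (@homotopic_reparam c _ _
  (fun t => Num.min (2 * t + 0) (- 2 * t + 2)) (fun=> 0)).
- by apply: cminr; exact: caff.
- by move=> x; exact: cvg_cst.
- by move=> t /II It; apply/II; rewrite /Num.min; case: ifPn => ?; lra.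
- by [].
- move=> t /II It /=; rewrite /cat_fun; case: ifPn => tle.
    by congr (c _); rewrite /Num.min; case: ifPn => ?; lra.
  by rewrite /=; congr (c _); rewrite /Num.min; case: ifPn => ?; lra.
- by move=> t _ /=; rewrite loop0.
- by rewrite /Num.min; case: ifPn => ?; lra.
- by rewrite /Num.min; case: ifPn => ?; lra.
Qed.

Lemma homotopic_rev_cat c : homotopic (loop_cat (loop_rev c) c) loop_cst.
Proof.
apply: (@homotopic_reparam c _ _
  (fun t => Num.max (2 * t + (-1)) (- 2 * t + 1)) (fun=> 1)).
- by apply: cmaxr; exact: caff.
- by move=> x; exact: cvg_cst.
- by move=> t /II It; apply/II; rewrite /Num.max; case: ifPn => ?; lra.
- by [].
- move=> t /II It /=; rewrite /cat_fun; case: ifPn => tle.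
    by rewrite /=; congr (c _); rewrite /Num.max; case: ifPn => ?; lra.
  by congr (c _); rewrite /Num.max; case: ifPn => ?; lra.
- by move=> t _ /=; rewrite loop1.
- by rewrite /Num.max; case: ifPn => ?; lra.
- by rewrite /Num.max; case: ifPn => ?; lra.
Qed.

Lemma homotopic_cst_cat c : homotopic (loop_cat loop_cst c) c.
Proof.
apply: (@homotopic_reparam c _ _ (fun t => Num.max (0 * t + 0) (2 * t + (- 1))) id).
- by apply: cmaxr; exact: caff.
- by move=> x.
- by move=> t /II It; apply/II; rewrite /Num.max; case: ifPn => ?; lra.
- by [].
- move=> t /II It /=; rewrite /cat_fun; case: ifPn => tle.
    rewrite /= -(loop0 c); congr (c _).
    by rewrite /Num.max; case: ifPn => ?; lra.
  by congr (c _); rewrite /Num.max; case: ifPn => ?; lra.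
- by [].
- by rewrite /Num.max; case: ifPn => ?; lra.
- by rewrite /Num.max; case: ifPn => ?; lra.
Qed.

Lemma homotopic_cat_cst c : homotopic (loop_cat c loop_cst) c.
Proof.
apply: (@homotopic_reparam c _ _ (fun t => Num.min (0 * t + 1) (2 * t + 0)) id).
- by apply: cminr; exact: caff.
- by move=> x.
- by move=> t /II It; apply/II; rewrite /Num.min; case: ifPn => ?; lra.
- by [].
- move=> t /II It /=; rewrite /cat_fun; case: ifPn => tle.
    by congr (c _); rewrite /Num.min; case: ifPn => ?; lra.
  rewrite /= -(loop1 c); congr (c _).
  by rewrite /Num.min; case: ifPn => ?; lra.
- by [].
- by rewrite /Num.min; case: ifPn => ?; lra.
- by rewrite /Num.min; case: ifPn => ?; lra.
Qed.

Lemma homotopic_catA c d e :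
  homotopic (loop_cat c (loop_cat d e)) (loop_cat (loop_cat c d) e).
Proof.
apply: homotopic_sym.
pose f (t : R) := Num.min (Num.min (2 * t + 0) (1 * t + 4^-1)) (2^-1 * t + 2^-1).
have fE t : [\/ f t = 2 * t /\ t <= 4^-1, f t = t + 4^-1 /\ 4^-1 <= t <= 2^-1
    | f t = 2^-1 * t + 2^-1 /\ 2^-1 <= t].
  rewrite /f; case: (leP (2 * t + 0)) => ?; case: (leP _ (2^-1 * t + 2^-1)) => ?;
    solve [by apply: Or31; split; lra|by apply: Or32; split; lra
          |by apply: Or33; split; lra].
apply: (@homotopic_reparam (loop_cat c (loop_cat d e)) _ _ f id).
- by apply: cminr; [apply: cminr|]; exact: caff.
- by move=> x.
- by move=> t /II It; apply/II; have [] := fE t => -[-> ?]; lra.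
- by [].
- move=> t /II It /=; rewrite /cat_fun /= /cat_fun.
  have [t1|t1] := leP t 2^-1; last first.
    have -> : f t = 2^-1 * t + 2^-1.
      by have [] := fE t => -[-> ?]; lra.
    rewrite ifF; last by apply/negbTE; lra.
    rewrite ifF; last by apply/negbTE; lra.
    by congr (e _); lra.
  have [t2|t2] := leP (2 * t) 2^-1.
    have -> : f t = 2 * t.
      by have [] := fE t => -[-> ?]; lra.
    by rewrite ifT//; lra.
  have -> : f t = t + 4^-1.
    by rewrite /f; case: (leP (2 * _ + 0)) => ?; case: leP => ?; lra.
  rewrite ifF; last by apply/negbTE; lra.
  by rewrite ifT; [congr (d _)|]; lra.
- by [].
- by have [] := fE 0 => -[-> ?]; lra.
- by have [] := fE 1 => -[-> ?]; lra.
Qed.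

Definition pi1_one : pi1 := loop_class loop_cst.
Definition pi1_mul (x y : pi1) : pi1 := loop_class (loop_cat (repr x) (repr y)).
Definition pi1_inv (x : pi1) : pi1 := loop_class (loop_rev (repr x)).

Let reprK1 (x : pi1) : loop_class (repr x) = x.
Proof. exact: reprK. Qed.

Lemma pi1_mulE c d : pi1_mul (loop_class c) (loop_class d) = loop_class (loop_cat c d).
Proof.
by apply/loop_classP; apply: homotopic_cat; apply/loop_classP; rewrite reprK1.
Qed.

Lemma pi1_invE c : pi1_inv (loop_class c) = loop_class (loop_rev c).
Proof.
by apply/loop_classP; apply: homotopic_rev; apply/loop_classP; rewrite reprK1.
Qed.

Let pi1_surj x : exists c, x = loop_class c.
Proof. by exists (repr x); rewrite reprK1. Qed.

Lemma pi1_mulA : associative pi1_mul.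
Proof.
move=> x y z; have [u ->] := pi1_surj x; have [v ->] := pi1_surj y.
have [w ->] := pi1_surj z.
rewrite (pi1_mulE v) (pi1_mulE u v) (pi1_mulE u) (pi1_mulE (loop_cat u v)).
by apply/loop_classP; exact: homotopic_catA.
Qed.

Lemma pi1_mul1 : left_id pi1_one pi1_mul.
Proof.
move=> x; have [u ->] := pi1_surj x; rewrite (pi1_mulE loop_cst).
by apply/loop_classP; exact: homotopic_cst_cat.
Qed.

Lemma pi1_mulr1 : right_id pi1_one pi1_mul.
Proof.
move=> x; have [u ->] := pi1_surj x; rewrite (pi1_mulE u).
by apply/loop_classP; exact: homotopic_cat_cst.
Qed.

Lemma pi1_mulV : right_inverse pi1_one pi1_inv pi1_mul.
Proof.
move=> x; have [u ->] := pi1_surj x; rewrite (pi1_invE u) (pi1_mulE u).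
by apply/loop_classP; exact: homotopic_cat_rev.
Qed.

Lemma pi1_mulVg : left_inverse pi1_one pi1_inv pi1_mul.
Proof.
move=> x; have [u ->] := pi1_surj x; rewrite (pi1_invE u) (pi1_mulE _ u).
by apply/loop_classP; exact: homotopic_rev_cat.
Qed.

HB.instance Definition _ :=
  isGroup.Build pi1 pi1_mulA pi1_mul1 pi1_mulr1 pi1_mulVg pi1_mulV.

End FundamentalGroup.

Arguments loop R {T} q.
Arguments pi1 R {T} q.

Section Sphere.
Variable R : realType.
Implicit Types x u v : 'rV[R]_3.

Definition dotv u v : R := (u *m v^T) 0 0.

Definition sphere : set 'rV[R]_3 := [set x | dotv x x = 1].

Definition det3 x u v : R := \det (\matrix_(i < 3) [:: x; u; v]`_i).

(* [(u, v)] is a positively oriented frame of the tangent plane of the sphere at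
   [x]; the sphere is oriented by its outward normal. *)
Definition pos_frame x u v : Prop := 0 < det3 x u v.

(* The directions of the nonzero tangent vectors [u1], [u2], [u3] at [x] are
   distinct and in counterclockwise cyclic order, as seen from outside. *)
Definition ccw x u1 u2 u3 : Prop :=
  exists a b, exists r1 r2 r3 t1 t2 t3 : R,
  [/\ [/\ dotv x a = 0, dotv x b = 0, dotv a b = 0, dotv a a = 1 & dotv b b = 1],
      pos_frame x a b,
      [/\ 0 < r1, 0 < r2 & 0 < r3],
      [/\ t1 < t2, t2 < t3 & t3 < t1 + 2 * pi]
    & [/\ u1 = r1 *: (cos t1 *: a + sin t1 *: b),
          u2 = r2 *: (cos t2 *: a + sin t2 *: b)
        & u3 = r3 *: (cos t3 *: a + sin t3 *: b)]].

End Sphere.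

Arguments sphere {R}.

(* A finite graph (multiple edges and loops allowed) together with an embedding
   in the sphere whose edges are regular [C^1] arcs. An arc is parametrized by
   [0, 1] from its source to its target; since a [C^1] function on [0, 1] extends
   to a neighbourhood of it, derivatives at 0 and 1 are two-sided, and the values
   of an arc outside [0, 1] are irrelevant. *)
Record plane_graph (R : realType) := PlaneGraph {
  vertex : finType;
  edge : finType;
  source : edge -> vertex;
  target : edge -> vertex;
  pos : vertex -> 'rV[R]_3;
  arc : edge -> R -> 'rV[R]_3;
  pos_sphere : forall v, sphere (pos v);
  pos_inj : injective pos;
  arc_sphere : forall e t, 0 <= t <= 1 -> sphere (arc e t);
  arc0 : forall e, arc e 0 = pos (source e);
  arc1 : forall e, arc e 1 = pos (target e);
  arc_derivable : forall e t, 0 <= t <= 1 -> derivable (arc e) t 1;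
  arc_C1 : forall e, {within `[0, 1], continuous (derive1 (arc e))};
  arc_regular : forall e t, 0 <= t <= 1 -> derive1 (arc e) t != 0;
  arc_vertex : forall e t v, 0 < t < 1 -> arc e t <> pos v;
  arc_inj : forall e1 e2 t1 t2, 0 < t1 < 1 -> 0 < t2 < 1 ->
    arc e1 t1 = arc e2 t2 -> e1 = e2 /\ t1 = t2 }.

Section PlaneGraph.
Context {R : realType}.
Variable G : plane_graph R.

(* An edge with an orientation; [true] is the orientation from source to target. *)
Definition dart : finType := (edge G * bool)%type.

Definition opp_dart (a : dart) : dart := (a.1, ~~ a.2).

Definition head (a : dart) : vertex G := if a.2 then target a.1 else source a.1.

(* The velocity at [arc a.1 s] of the edge [a.1] run along the orientation. *)
Definition dart_velocity (a : dart) (s : R) : 'rV[R]_3 :=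
  if a.2 then derive1 (arc a.1) s else - derive1 (arc a.1) s.

(* The direction in which the edge of [a] leaves the vertex [head a]. *)
Definition out_direction (a : dart) : 'rV[R]_3 :=
  - dart_velocity a (if a.2 then 1 else 0).

(* Half-edges rather than edges are cyclically ordered, so that a loop occurs
   twice at its vertex. *)
Definition ccw_star (v : vertex G) (a1 a2 a3 : dart) : Prop :=
  [/\ head a1 = v, head a2 = v, head a3 = v
    & ccw (pos v) (out_direction a1) (out_direction a2) (out_direction a3)].

(* The three half-edges at a vertex leave it in distinct tangent directions,
   i.e. they have a counterclockwise order. *)
Definition trivalent : Prop := forall v : vertex G,
  #|[set a : dart | head a == v]%SET| = 3%N /\
  exists a1 a2 a3, ccw_star v a1 a2 a3.

Definition vertex_set : set 'rV[R]_3 := range (@pos R G).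

Definition graph_set : set 'rV[R]_3 :=
  vertex_set `|` \bigcup_(e in [set: edge G]) (arc e @` `[0, 1]).

Definition face (f : set 'rV[R]_3) : Prop :=
  exists2 x, (sphere `\` graph_set) x
           & f = connected_component (sphere `\` graph_set) x.

(* The vectors [d] and [derive1 (arc e) s] are tangent to the sphere at [c t], so
   that the last condition says that they are linearly independent. *)
Definition crosses (c : R -> 'rV[R]_3) (t : R) (e : edge G) (s : R)
    (d : 'rV[R]_3) : Prop :=
  [/\ 0 < s < 1, c t = arc e s, is_derive t 1 c d
    & det3 (c t) d (derive1 (arc e) s) != 0].

Definition relator (a1 a2 a3 : dart) : free_group dart :=
  let lambda := @free_gen dart in
  (lambda a1 * (lambda (opp_dart a2))^-1 * lambda a3 *
   (lambda (opp_dart a1))^-1 * lambda a2 * (lambda (opp_dart a3))^-1)%g.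

Definition relators : set (free_group dart) :=
  [set w | exists v a1 a2 a3, ccw_star v a1 a2 a3 /\ w = relator a1 a2 a3].

Definition Pi : groupType := quot_group relators.

Definition homeomorphism_on (X Y : topologicalType) (A : set X) (B : set Y)
    (f : X -> Y) : Prop :=
  exists g : Y -> X,
  [/\ {within A, continuous f}, {within B, continuous g},
      forall x, A x -> B (f x) /\ g (f x) = x
    & forall y, B y -> A (g y) /\ f (g y) = y].

(* [R * R] stands for the complex plane: [csqr] is z |-> z ^ 2. *)
Definition disc : set (R * R) := [set z | z.1 ^+ 2 + z.2 ^+ 2 < 1].
Definition csqr (z : R * R) : R * R := (z.1 ^+ 2 - z.2 ^+ 2, 2 * z.1 * z.2).

Definition evenly_covered2 (L : topologicalType) (p : L -> 'rV[R]_3)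
    (x : 'rV[R]_3) : Prop :=
  exists (W : set 'rV[R]_3) (U1 U2 : set L),
  [/\ open W, W x, [/\ open U1, open U2, U1 `&` U2 = set0 & U1 `|` U2 = p @^-1` W],
      homeomorphism_on U1 (W `&` sphere) p
    & homeomorphism_on U2 (W `&` sphere) p].

Definition branched2 (L : topologicalType) (p : L -> 'rV[R]_3)
    (x : 'rV[R]_3) : Prop :=
  exists (W : set 'rV[R]_3) (phi : 'rV[R]_3 -> R * R) (psi : L -> R * R),
  [/\ open W /\ W x, phi x = (0, 0),
      homeomorphism_on (W `&` sphere) disc phi,
      homeomorphism_on (p @^-1` W) disc psi
    & forall y, W (p y) -> phi (p y) = csqr (psi y)].

Record branched_double_cover (L : topologicalType) (p : L -> 'rV[R]_3) : Prop := {
  cover_cont : continuous p;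
  cover_sphere : forall y, sphere (p y);
  cover_even : forall x, sphere x -> ~ vertex_set x -> evenly_covered2 p x;
  cover_branch : forall x, vertex_set x -> branched2 p x }.

(* The labels [true] and [false] are + and -; the label of a point over the graph
   is irrelevant. *)
Record sheet_labelling (L : topologicalType) (p : L -> 'rV[R]_3)
    (sheet : L -> bool) : Prop := {
  sheet_inhabited : forall f b, face f -> exists y, f (p y) /\ sheet y = b;
  sheet_component : forall f y, face f -> f (p y) ->
    connected_component (p @^-1` f) y = [set z | f (p z) /\ sheet z = sheet y];
  sheet_crossing : forall (c : R -> L) (t : R) (e : edge G) (s : R) d,
    {within `[0, 1], continuous c} -> 0 < t < 1 ->
    crosses (p \o c) t e s d ->
    (forall u, 0 <= u <= 1 -> u != t -> ~ graph_set (p (c u))) ->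
    sheet (c 1) = ~~ sheet (c 0) }.

Definition generic (L : topologicalType) (p : L -> 'rV[R]_3) (c : R -> L) : Prop :=
  (forall t, 0 <= t <= 1 -> ~ vertex_set (p (c t))) /\
  (forall t, 0 <= t <= 1 -> graph_set (p (c t)) ->
     0 < t < 1 /\ exists e s d, crosses (p \o c) t e s d).

(* The letter read when [c] crosses the graph at time [t]: the second component
   of [l] is both the label of the sheet that is left and the exponent of the
   letter. *)
Definition crossing_letter (L : topologicalType) (p : L -> 'rV[R]_3)
    (sheet : L -> bool) (c : R -> L) (t : R) (l : dart * bool) : Prop :=
  exists s d,
  [/\ crosses (p \o c) t l.1.1 s d,
      pos_frame (p (c t)) (if l.2 then d else - d) (dart_velocity l.1 s),
      \forall u \near t^'-, sheet (c u) = l.2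
    & \forall u \near t^'+, sheet (c u) = ~~ l.2].

(* [k] lists in order the crossing times and the letters read there; for a generic
   curve there are finitely many, since transverse crossings are isolated. *)
Definition geometric_element (L : topologicalType) (p : L -> 'rV[R]_3)
    (sheet : L -> bool) (c : R -> L) (g : Pi) : Prop :=
  exists k : seq (R * (dart * bool)),
  [/\ sorted <%R [seq x.1 | x <- k],
      forall t, t \in [seq x.1 | x <- k] <-> 0 <= t <= 1 /\ graph_set (p (c t)),
      forall x, x \in k -> crossing_letter p sheet c x.1 x.2
    & g = quot_proj relators (free_word [seq x.2 | x <- k])].

End PlaneGraph.

(* Main.v *)
(** Call potential a function with values in [Pi G], defined off the graph on an open
    subset of the cover, which is constant along paths avoiding the graph and is
    multiplied on the right by the letter read at each transverse crossing. Every
    point has a potential in some neighbourhood: around a branch point there are six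
    pieces (three sectors on two sheets), and the product of the six jumps is a
    relator, hence trivial. As any two points off the graph that are close to a given
    point are joined by a short generic path, two potentials near a point differ by a
    left translation; so potentials can be continued along every path, uniquely, and
    the result depends only on the homotopy class. Along a generic loop, the
    continuation multiplies the value at the base point by the geometric element,
    which is therefore invariant and multiplicative. Finally every loop is homotopic
    to a generic one, since a short piece lying in a disc chart may be replaced by any
    other path in this chart with the same ends. *)

Require Import Defs.
From HB Require Import structures.
From mathcomp Require Import all_boot all_order all_algebra.
From mathcomp Require Import ring lra.
From mathcomp Require Import all_classical all_reals all_analysis.
Import numFieldNormedType.Exports.

Set Implicit Arguments.
Unset Strict Implicit.
Unset Printing Implicit Defensive.

Import Order.TTheory GRing.Theory Num.Theory.
Import Defs.

Local Open Scope classical_set_scope.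
Local Open Scope ring_scope.

(** * Real analysis *)

(** Paths and homotopies are only continuous: they may meet the graph in a Cantor set and run
    through branch points, so the crossings of a homotopy cannot be counted. This is why
    continuation works with germs that ignore the values on the graph. Such germs are rigid because
    letters multiply on the right and thus cancel in the quotient of two potentials. The delicate
    point is a branch point, around which the translation relating two potentials might depend on
    the piece; the connectedness of the punctured disc on the cover rules this out. Passing from
    local to global, along a path or in the parameter of a homotopy, is always the same induction on
    intervals, [cousin]. The analysis at a vertex serves to show that regular $C^1$ arcs leaving in
    distinct directions do not spiral: in polar coordinates each is the graph of an angle depending
    continuously on the radius, close to its initial direction, so that the cyclic order of the
    half-edges is the same on all small circles. *)

Section Cousin.
Variable R : realType.
Implicit Types (a b t x y z : R) (P : R -> R -> Prop).

(** Compactness of a segment, in the form in which the subdivision arguments below use it. The local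
    hypothesis asks for a neighbourhood containing the whole of [x, y] instead of bounding its
    length, so that it can be fed with neighbourhoods obtained from filters. The supremum [s] of the
    points reached from [a] is itself reached, and could be passed if it were less than [b]. *)
Lemma cousin P a b : a <= b ->
  (forall x y z, a <= x -> x <= y -> y <= z -> z <= b -> P x y -> P y z -> P x z) ->
  (forall t, a <= t <= b -> exists2 A, nbhs t A &
     forall x y, a <= x -> x <= t -> t <= y -> y <= b ->
       (forall z, x <= z <= y -> A z) -> P x y) ->
  P a b.
Proof.
move=> ab Ptr Ploc.
pose S := [set y | a <= y <= b /\ P a y].
have Sa : S a.
  split; first by rewrite lexx.
  have [|A tA AP] := Ploc a; first by rewrite lexx.
  apply: AP => // z za; have -> : z = a by apply/eqP; rewrite eq_le andbC.
  exact: nbhs_singleton.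
have Sb : ubound S b by move=> y [/andP[]].
have hS : has_sup S by split; [exists a|exists b].
have [s sE] : exists s, s = sup S by exists (sup S).
have sb : s <= b by rewrite sE; apply: ge_sup => //; exists a.
have as_ : a <= s by rewrite sE; apply: ub_le_sup => //; exists b.
have [|A] := Ploc s; first by rewrite as_.
move=> /nbhs_ballP[e /= e0 eA] AP.
have [y [yab Py] yse] := sup_adherent e0 hS; rewrite -sE in yse.
have ys : y <= s by rewrite sE; apply: ub_le_sup => //; exists b.
have /andP[ay yb] := yab.
(* [z] is s + e / 2 cut off at [b]: it is reached, so [z <= s], which leaves only [b <= s]. *)
have [z [zse zb zE]] : exists z,
    [/\ s <= z <= s + e / 2, z <= b & z <= s -> b <= s].
  exists (Num.min b (s + e / 2)); split.
  - by rewrite le_min ge_min sb; lra.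
  - by rewrite ge_min lexx.
  - by rewrite ge_min => /orP[//|]; lra.
have Pz : P a z.
  apply: (Ptr a y z) => //; first by lra.
  apply: AP => //; try by lra.
  by move=> u u1; apply: eA; rewrite /ball /= ltr_norml; lra.
have zs : z <= s by rewrite sE; apply: ub_le_sup; [exists b|split=> //; lra].
have bs := zE zs; have -> : b = z by lra.
by [].
Qed.

End Cousin.

Section RealAnalysis.
Variable R : realType.
Implicit Types (t e u h : R) (f : R -> R).

Lemma near_leftP t (P : R -> Prop) :
  (\forall u \near t^'-, P u) <-> exists2 e, 0 < e & forall u, t - e < u < t -> P u.
Proof.
split=> [/nbhs_ballP[e /= e0 eP]|[e e0 eP]].
  exists e => // u /andP[u1 u2]; apply: eP => //.
  by rewrite /ball /= ltr_norml; lra.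
apply/nbhs_ballP; exists e => //= u; rewrite /ball /= ltr_norml => ? ?.
by apply: eP; lra.
Qed.

Lemma near_rightP t (P : R -> Prop) :
  (\forall u \near t^'+, P u) <-> exists2 e, 0 < e & forall u, t < u < t + e -> P u.
Proof.
split=> [/nbhs_ballP[e /= e0 eP]|[e e0 eP]].
  exists e => // u /andP[u1 u2]; apply: eP => //.
  by rewrite /ball /= ltr_norml; lra.
apply/nbhs_ballP; exists e => //= u; rewrite /ball /= ltr_norml => ? ?.
by apply: eP; lra.
Qed.

Lemma nbhs_realP t (A : set R) :
  nbhs t A <-> exists2 e, 0 < e & forall u, t - e < u < t + e -> A u.
Proof.
split=> [/nbhs_ballP[e /= e0 eP]|[e e0 eP]].
  by exists e => // u ut; apply: eP; rewrite /ball /= ltr_norml; lra.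
apply/nbhs_ballP; exists e => //= u; rewrite /ball /= ltr_norml => ?.
by apply: eP; lra.
Qed.

Lemma is_derive_pos_sign f t (l : R) : is_derive t 1 f l -> f t = 0 -> 0 < l ->
  exists2 e, 0 < e & forall u, (t - e < u < t -> f u < 0) /\ (t < u < t + e -> 0 < f u).
Proof.
move=> [df fl] ft l0; move: df; rewrite /derivable => /cvg_ex[/= l' hl].
have ll : l' = l by rewrite -fl; apply/esym; apply: cvg_lim hl.
rewrite {}ll in hl.
have : \forall h \near 0^', 0 < h^-1 * (f (h + t) - f t).
  near=> h; rewrite -[h in h + t]mulr1.
  by near: h; exact: (cvgr_gt _ hl _ l0).
move=> /nbhs_ballP[e /= e0 eP]; exists e => // u.
have q : u != t -> t - e < u < t + e -> 0 < (u - t)^-1 * f u.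
  move=> ut ue; have := eP (u - t); rewrite /ball /= sub0r normrN subrK ft subr0.
  by apply; [rewrite ltr_norml; lra|rewrite subr_eq0].
split=> ue.
- have := q ltac:(lra) ltac:(lra).
  by rewrite nmulr_rgt0// invr_lt0; lra.
- have := q ltac:(lra) ltac:(lra).
  by rewrite pmulr_rgt0// invr_gt0; lra.
Unshelve. all: by end_near. Qed.

Lemma is_derive_neg_sign f t (l : R) : is_derive t 1 f l -> f t = 0 -> l < 0 ->
  exists2 e, 0 < e & forall u, (t - e < u < t -> 0 < f u) /\ (t < u < t + e -> f u < 0).
Proof.
move=> df ft l0.
have [||e e0 eP] := @is_derive_pos_sign (- f) t (- l) _.
- by rewrite fctE ft oppr0.
- by rewrite oppr_gt0.
exists e => // u; have [el er] := eP u; split=> [/el|/er]; rewrite fctE.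
- by rewrite oppr_lt0.
- by rewrite oppr_gt0.
Qed.

Lemma is_derive_mxP m n (M : R -> 'M[R]_(m, n)) t (d : 'M[R]_(m, n)) :
  is_derive t 1 M d <-> forall i j, is_derive t 1 (fun x => M x i j) (d i j).
Proof.
split=> [[dM <-] i j|dM].
  split; first exact: (derivable_mxP _ _ _).1.
  by rewrite derive_mx// mxE.
have dM' : derivable M t 1.
  by apply/derivable_mxP => i j; have [] := dM i j.
split=> //; apply/matrixP => i j; rewrite derive_mx// mxE.
by have [] := dM i j.
Qed.

Lemma is_derive_add f g t a b : is_derive t 1 f a -> is_derive t 1 g b ->
  is_derive t 1 (fun x => f x + g x) (a + b).
Proof. exact: is_deriveD. Qed.

Lemma is_derive_sub f g t a b : is_derive t 1 f a -> is_derive t 1 g b ->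
  is_derive t 1 (fun x => f x - g x) (a - b).
Proof. exact: is_deriveB. Qed.

Lemma is_derive_mul f g t a b : is_derive t 1 f a -> is_derive t 1 g b ->
  is_derive t 1 (fun x => f x * g x) (a * g t + f t * b).
Proof.
move=> fa gb; apply: is_derive_eq (is_deriveM fa gb) _.
by rewrite /GRing.scale /= addrC (mulrC a).
Qed.

Lemma is_derive_affine (k l t : R) : is_derive t 1 (fun u => k * u + l) k.
Proof.
have kid : is_derive t 1 (fun u => k * u) (0 * t + k * 1).
  exact: is_derive_mul.
have := is_derive_add kid (is_derive_cst l t 1).
by rewrite mul0r add0r mulr1 addr0.
Qed.

Lemma is_derive_affine_comp m n (M : R -> 'M[R]_(m, n)) (k l : R) t d :
  is_derive (k * t + l) 1 M d -> is_derive t 1 (fun u => M (k * u + l)) (k *: d).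
Proof.
move=> /is_derive_mxP dM; apply/is_derive_mxP => i j.
have := @is_derive1_comp _ (fun x => M x i j) (fun u => k * u + l) t _ _ (dM i j)
  (is_derive_affine k l t).
by rewrite mxE mulrC.
Qed.

End RealAnalysis.

(** * Geometry of the sphere *)

Section SphereGeometry.
Variable R : realType.
Implicit Types (x y u v w a b d : 'rV[R]_3).

Lemma dotvE u v : dotv u v = u 0 0 * v 0 0 + u 0 1 * v 0 1 + u 0 2 * v 0 2.
Proof.
rewrite /dotv mxE !big_ord_recl big_ord0 !mxE addr0 addrA.
by congr (_ + u _ _ * v _ _ + u _ _ * v _ _); apply: val_inj.
Qed.

Lemma det3E x u v : det3 x u v =
  x 0 0 * (u 0 1 * v 0 2 - u 0 2 * v 0 1)
  - x 0 1 * (u 0 0 * v 0 2 - u 0 2 * v 0 0)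
  + x 0 2 * (u 0 0 * v 0 1 - u 0 1 * v 0 0).
Proof.
rewrite /det3 (expand_det_row _ 0) !big_ord_recl big_ord0 /cofactor.
rewrite !(expand_det_row _ 0) !big_ord_recl !big_ord0 /cofactor !det_mx11.
rewrite !mxE /=.
have E (i : 'I_3) (j : 'I_2) k : lift i j = k -> forall w, w 0 (lift i j) = w 0 k :> R.
  by move=> ->.
have l2 : lift (lift ord0 ord0) 0 = 0 :> 'I_2 by apply: val_inj.
rewrite l2 !(E ord0 0 1) ?(E ord0 (lift ord0 ord0) 2) ?(E 1 0 0) ?(E 1 (lift ord0 0) 2)
  ?(E (lift ord0 ord0) 0 0) ?(E (lift ord0 ord0) (lift ord0 0) 2)
  ?(E (lift ord0 (lift ord0 ord0)) 0 0) ?(E (lift ord0 (lift ord0 ord0)) (lift ord0 0) 1);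
  try exact: val_inj.
by rewrite /bump /=; ring.
Qed.

Lemma rV3P x y : x 0 0 = y 0 0 -> x 0 1 = y 0 1 -> x 0 2 = y 0 2 -> x = y.
Proof.
move=> e0 e1 e2; apply/rowP => i.
have [->|[->|->]] : i = 0 \/ i = 1 \/ i = 2.
  by case: i => -[|[|[|//]]] ilt; [left|right; left|right; right]; apply: val_inj.
all: by [].
Qed.

Lemma dotvC u v : dotv u v = dotv v u. Proof. by rewrite !dotvE; ring. Qed.

Lemma dotvDl u v w : dotv (u + v) w = dotv u w + dotv v w.
Proof. by rewrite !dotvE !mxE; ring. Qed.

Lemma dotvBl u v w : dotv (u - v) w = dotv u w - dotv v w.
Proof. by rewrite !dotvE !mxE; ring. Qed.

Lemma dotvNl u w : dotv (- u) w = - dotv u w.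
Proof. by rewrite !dotvE !mxE; ring. Qed.

Lemma dotvZl k v w : dotv (k *: v) w = k * dotv v w.
Proof. by rewrite !dotvE !mxE; ring. Qed.

Lemma det3N x u v : det3 x (- u) v = - det3 x u v.
Proof. by rewrite !det3E !mxE; ring. Qed.

Lemma det3Nr x u v : det3 x u (- v) = - det3 x u v.
Proof. by rewrite !det3E !mxE; ring. Qed.

Lemma det3Zl k x u v : det3 x (k *: u) v = k * det3 x u v.
Proof. by rewrite !det3E !mxE; ring. Qed.

(* The cross product of two tangent vectors at [x] is a multiple of [x]. *)
Lemma tangent_det3 y x u v : dotv x x = 1 -> dotv x u = 0 -> dotv x v = 0 ->
  det3 y u v = dotv y x * det3 x u v.
Proof.
move=> xx xu xv.
have : det3 y u v * dotv x x - dotv y x * det3 x u v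
     = det3 y x v * dotv x u - det3 y x u * dotv x v.
  by rewrite !det3E !dotvE; ring.
by rewrite xx xu xv !mulr0 subrr mulr1 => /eqP; rewrite subr_eq0 => /eqP.
Qed.

Record frame x a b : Prop := Frame {
  frame_xx : dotv x x = 1;
  frame_aa : dotv a a = 1;
  frame_bb : dotv b b = 1;
  frame_xa : dotv x a = 0;
  frame_xb : dotv x b = 0;
  frame_ab : dotv a b = 0;
  frame_det1 : det3 x a b = 1 }.

(** The product of two determinants is the determinant of the matrix of scalar products, here
    expanded along its first row. *)
Lemma gram_det3 x u v y a b : det3 x u v * det3 y a b =
  dotv x y * (dotv u a * dotv v b - dotv u b * dotv v a)
  - dotv x a * (dotv u y * dotv v b - dotv u b * dotv v y)
  + dotv x b * (dotv u y * dotv v a - dotv u a * dotv v y).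
Proof. by rewrite !det3E !dotvE; ring. Qed.

(** The Gram determinant shows that the square of [det3 x a b] is 1, and positivity excludes -1. *)
Lemma frame_of_orthonormal x a b : dotv x x = 1 -> dotv a a = 1 -> dotv b b = 1 ->
  dotv x a = 0 -> dotv x b = 0 -> dotv a b = 0 -> 0 < det3 x a b -> frame x a b.
Proof.
move=> xx aa bb xa xb ab dpos; split=> //.
have : det3 x a b ^+ 2 = 1.
  by rewrite expr2 gram_det3 xx aa bb xa xb ab (dotvC a x) (dotvC b x)
    (dotvC b a) xa xb ab; ring.
by move=> /eqP; rewrite sqrf_eq1 => /orP[/eqP//|/eqP dN]; move: dpos; rewrite dN; lra.
Qed.

Lemma frame_det3 x a b u v : frame x a b ->
  det3 x u v = dotv u a * dotv v b - dotv u b * dotv v a.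
Proof.
move=> [xx aa bb xa xb ab d1]; rewrite -[LHS]mulr1 -d1 gram_det3 xx xa xb.
by ring.
Qed.

Lemma frame_decomp x a b y : frame x a b ->
  y = dotv y x *: x + dotv y a *: a + dotv y b *: b.
Proof.
move=> [xx aa bb xa xb ab d1].
pose M : 'M[R]_3 := \matrix_(i < 3) [:: x; a; b]`_i.
have MM : M *m M^T = 1%:M.
  apply/matrixP => i j; rewrite mxE.
  have -> : \sum_k M i k * M^T k j = dotv (row i M) (row j M).
    by rewrite /dotv mxE; apply: eq_bigr => k _; rewrite !mxE.
  rewrite !rowK mxE.
  case: i => -[|[|[|//]]] ilt; case: j => -[|[|[|//]]] jlt; rewrite /= -?val_eqE //=.
  - by rewrite dotvC.
  - by rewrite dotvC.
  - by rewrite dotvC.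
(* A one-sided inverse of a square matrix is two-sided: orthonormal rows give orthonormal columns,
   and the entries of this identity express the coordinate vectors in the frame. *)
have MT : M^T *m M = 1%:M by exact: mulmx1C.
have E k l : x 0 k * x 0 l + a 0 k * a 0 l + b 0 k * b 0 l = (k == l)%:R.
  have := congr1 (fun A : 'M[R]_3 => A k l) MT; rewrite !mxE !big_ord_recl big_ord0.
  by rewrite !mxE /= addr0 addrA.
have key l : y 0 l = (dotv y x *: x + dotv y a *: a + dotv y b *: b) 0 l.
  transitivity (y 0 0 * (0 == l)%:R + y 0 1 * (1 == l)%:R + y 0 2 * (2 == l)%:R).
    case: l => -[|[|[|//]]] ilt; rewrite -!val_eqE /= ?mulr0 ?mulr1 ?addr0 ?add0r;
      by congr (y _ _); apply: val_inj.
  by rewrite -!E !mxE !dotvE; ring.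
by apply: rV3P.
Qed.

Lemma frame_dotv x a b u v : frame x a b ->
  dotv u v = dotv u x * dotv v x + dotv u a * dotv v a + dotv u b * dotv v b.
Proof.
move=> fr; rewrite {1}(frame_decomp u fr) !dotvDl !dotvZl.
by rewrite (dotvC x) (dotvC a) (dotvC b).
Qed.

Lemma dotv_ge0 u : 0 <= dotv u u.
Proof. by rewrite dotvE; nra. Qed.

Lemma dotv_eq0 u : dotv u u = 0 -> u = 0.
Proof. by rewrite dotvE => h; apply: rV3P; rewrite !mxE; nra. Qed.

Lemma dotv_gt0 u : u != 0 -> 0 < dotv u u.
Proof.
move=> u0; rewrite lt_neqAle dotv_ge0 andbT eq_sym.
by apply: contraNneq u0 => /dotv_eq0 ->.
Qed.

Definition cross3 u v : 'rV[R]_3 := \row_(i < 3)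
  [:: u 0 1 * v 0 2 - u 0 2 * v 0 1; u 0 2 * v 0 0 - u 0 0 * v 0 2;
      u 0 0 * v 0 1 - u 0 1 * v 0 0]`_i.

Lemma frame_cross x a : dotv x x = 1 -> dotv a a = 1 -> dotv x a = 0 ->
  frame x a (cross3 x a).
Proof.
move=> xx aa xa.
have cc : dotv (cross3 x a) (cross3 x a) = dotv x x * dotv a a - dotv x a ^+ 2.
  by rewrite !dotvE !mxE /=; ring.
split=> //.
- by rewrite cc xx aa xa; ring.
- by rewrite dotvE !mxE /=; ring.
- by rewrite dotvE !mxE /=; ring.
- transitivity (dotv (cross3 x a) (cross3 x a)); last by rewrite cc xx aa xa; ring.
  by rewrite det3E dotvE !mxE /=; ring.
Qed.

Lemma frame_of_tangent x v : dotv x x = 1 -> dotv x v = 0 -> v != 0 ->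
  exists a b (r : R), [/\ frame x a b, 0 < r & v = r *: a].
Proof.
move=> xx xv v0; have vv := dotv_gt0 v0.
have s0 : 0 < Num.sqrt (dotv v v) by rewrite sqrtr_gt0.
have ss : Num.sqrt (dotv v v) ^+ 2 = dotv v v by rewrite sqr_sqrtr// ltW.
exists ((Num.sqrt (dotv v v))^-1 *: v), (cross3 x ((Num.sqrt (dotv v v))^-1 *: v)),
  (Num.sqrt (dotv v v)); split=> //.
- apply: frame_cross => //.
    rewrite dotvZl dotvC dotvZl -[X in _ * (_ * X)]ss mulrA -expr2 -exprMn.
    by rewrite mulVf ?expr1n// gt_eqF.
  by rewrite dotvC dotvZl dotvC xv mulr0.
- by rewrite scalerA mulfV ?scale1r// gt_eqF.
Qed.

(** The cross products of [x] with the coordinate vectors contain all coordinates of [x] up to sign,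
    so they do not all vanish; a nonzero one, normalized, starts the frame. *)
Lemma exists_frame x : dotv x x = 1 -> exists a b, frame x a b.
Proof.
move=> xx.
pose e (k : 'I_3) : 'rV[R]_3 := \row_(i < 3) (i == k)%:R.
have [k ck] : exists k, cross3 x (e k) != 0.
  apply: contrapT => /forallNP h.
  have x0 k : cross3 x (e k) = 0 by apply/eqP; apply/negPn/negP; exact: h.
  have := congr1 (fun A : 'rV[R]_3 => A 0 2) (x0 1).
  have := congr1 (fun A : 'rV[R]_3 => A 0 1) (x0 2).
  have := congr1 (fun A : 'rV[R]_3 => A 0 1) (x0 0).
  have := congr1 (fun A : 'rV[R]_3 => A 0 2) (x0 0).
  rewrite !mxE /= !mulr1 !mulr0 ?subr0 ?sub0r.
  by move: xx; rewrite dotvE; nra.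
have [|a [b [r [fr _ _]]]] := frame_of_tangent xx _ ck; last by exists a, b.
by rewrite dotvE !mxE /=; ring.
Qed.

Lemma is_derive_dotv (c : R -> 'rV[R]_3) (t : R) d w : is_derive t 1 c d ->
  is_derive t 1 (fun z => dotv (c z) w) (dotv d w).
Proof.
move=> /is_derive_mxP dc.
rewrite (_ : (fun z => _) = fun z =>
  c z 0 0 * w 0 0 + c z 0 1 * w 0 1 + c z 0 2 * w 0 2); last first.
  by apply/funext => z; rewrite dotvE.
have q i : is_derive t 1 (fun z => c z 0 i * w 0 i) (d 0 i * w 0 i).
  apply: is_derive_eq (is_derive_mul (dc 0 i) (is_derive_cst (w 0 i) t 1)) _.
  by rewrite mulr0 addr0.
by rewrite dotvE; apply: is_derive_add.
Qed.

Lemma sphere_tangent (c : R -> 'rV[R]_3) (t : R) d :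
  (\forall z \near t, dotv (c z) (c z) = 1) -> is_derive t 1 c d ->
  dotv (c t) d = 0.
Proof.
move=> cs /[dup] cd /is_derive_mxP dc.
have q i : is_derive t 1 (fun z => c z 0 i * c z 0 i) (d 0 i * c t 0 i + c t 0 i * d 0 i).
  exact: is_derive_mul (dc 0 i) (dc 0 i).
have dd := is_derive_add (is_derive_add (q 0) (q 1)) (q 2).
have d0 : is_derive t 1
    (fun z => c z 0 0 * c z 0 0 + c z 0 1 * c z 0 1 + c z 0 2 * c z 0 2) 0.
  pose F (z : R) : R := c z 0 0 * c z 0 0 + c z 0 1 * c z 0 1 + c z 0 2 * c z 0 2.
  have h : \forall z \near t, (cst 1 : R -> R) z = F z.
    by apply: filterS cs => z; rewrite dotvE.
  exact: (@near_eq_is_derive _ _ _ _ _ _ _ _ h).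
case: dd => _ dd; case: d0 => _ d0; move: dd; rewrite d0 dotvE => /eqP.
rewrite eq_sym => /eqP h; lra.
Qed.

Lemma continuous_dotv w : continuous (fun x => dotv x w).
Proof.
rewrite (_ : (fun u => _) = fun u : 'rV[R]_3 =>
  u 0 0 * w 0 0 + u 0 1 * w 0 1 + u 0 2 * w 0 2); last first.
  by apply/funext => u; rewrite dotvE.
have q i : continuous (fun u : 'rV[R]_3 => u 0 i * w 0 i).
  move=> x; have c0 := @coord_continuous R 1 3 0 i x.
  exact: cvgM c0 (cvg_cst (w 0 i)).
by move=> x; exact: cvgD (cvgD (q 0 x) (q 1 x)) (q 2 x).
Qed.

End SphereGeometry.

(** * Inverse functions, closed parts of the graph, projection charts of the sphere *)

Section EdgeTools.
Variable R : realType.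

Lemma derive_pos_lt (X dX : R -> R) (A B : R) :
  {within `[A, B], continuous X} ->
  (forall u, A < u < B -> is_derive u 1 X (dX u)) ->
  (forall u, A < u < B -> 0 < dX u) ->
  forall u v, A <= u <= B -> A <= v <= B -> u < v -> X u < X v.
Proof.
move=> cX dXE dX0 u v uAB vAB uv; apply: (@gtr0_derive1_lt_cc _ X A B) => //.
- by move=> x; rewrite in_itv /= => /dXE [].
- by move=> x; rewrite in_itv /= => xAB; rewrite derive1E; have [_ ->] := dXE _ xAB; exact: dX0.
Qed.

(** The derivative is assumed positive only inside the interval, because at a vertex the squared
    radius along an edge has derivative 0 at the end point; differentiability of the inverse is
    accordingly claimed only at interior points. *)
Lemma increasing_inverse (X dX : R -> R) (A B : R) : A < B ->
  {within `[A, B], continuous X} ->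
  (forall u, A < u < B -> is_derive u 1 X (dX u)) ->
  (forall u, A < u < B -> 0 < dX u) ->
  exists tau : R -> R,
  [/\ forall u, A <= u <= B -> tau (X u) = u,
      forall y, X A <= y <= X B -> A <= tau y <= B /\ X (tau y) = y,
      forall u, A < u < B -> is_derive (X u) 1 tau (dX u)^-1
    & forall u v, A <= u <= B -> A <= v <= B -> u < v -> X u < X v].
Proof.
move=> AB cX dXE dX0; have mX := derive_pos_lt cX dXE dX0.
have iX u v : A <= u <= B -> A <= v <= B -> X u = X v -> u = v.
  move=> uAB vAB e; apply/eqP; case: ltgtP => // uv.
    by have := mX _ _ uAB vAB uv; rewrite e ltxx.
  by have := mX _ _ vAB uAB uv; rewrite e ltxx.
pose tau y := xget A [set u | A <= u <= B /\ X u = y].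
have tauK u : A <= u <= B -> tau (X u) = u.
  by move=> uAB; rewrite /tau; case: xgetP => [v _ [vAB /iX]|/(_ u)[]//]; apply.
exists tau; split=> //.
- move=> y yAB; have [] := @segment_continuous_le_surjective R A B X (ltW AB) _ cX y.
  + by rewrite ltW// mX ?lexx ?ltW.
  + by rewrite /= in_itv.
  by move=> u /=; rewrite in_itv /= => uAB <-; rewrite tauK.
- move=> u uAB; have /andP[Au uB] := uAB.
  have nAB : \forall v \near u, A < v < B.
    apply/nbhs_realP; exists (Num.min (u - A) (B - u)).
      by rewrite lt_min !subr_gt0 Au.
    by move=> v; case: (leP (u - A)) => ?; lra.
  apply: is_derive_inverse.
  + by apply: filterS nAB => v vAB; apply: tauK; lra.
  + apply: filterS nAB => v vAB; apply/differentiable_continuous/derivable1_diffP.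
    by have [] := dXE v vAB.
  + exact: dXE.
  + by rewrite gt_eqF// dX0.
Qed.

Lemma is_derive_continuous (V : normedModType R) (f : R -> V) (t : R) l :
  is_derive t 1 f l -> {for t, continuous f}.
Proof.
by move=> [df _]; apply/differentiable_continuous/derivable1_diffP.
Qed.

Lemma arc_continuous (G : plane_graph R) (e : edge G) (t : R) : 0 <= t <= 1 ->
  {for t, continuous (arc e)}.
Proof.
move=> t01; apply/differentiable_continuous/derivable1_diffP.
exact: arc_derivable.
Qed.

(** A finite union of compact sets. With [V] and [S] chosen to leave out the pieces of the graph
    near a given point, closedness of what remains provides a neighbourhood of that point which
    meets only these pieces. *)
Lemma graph_part_closed (G : plane_graph R) (V : set (vertex G)) (S : edge G -> set R) :
  (forall e, compact (S e)) -> (forall e t, S e t -> 0 <= t <= 1) ->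
  closed ((@pos R G) @` V `|` \bigcup_(e in setT) (arc e @` S e)).
Proof.
move=> cS S01; apply: closedU.
  apply: compact_closed; first exact: norm_hausdorff.
  by apply: finite_compact; apply: finite_image; exact: finite_finset.
apply: closed_bigcup; first exact: finite_finset.
move=> e _; apply: compact_closed; first exact: norm_hausdorff.
apply: continuous_compact => //; apply: continuous_in_subspaceT => t /set_mem.
by move=> /S01; exact: arc_continuous.
Qed.

Lemma graph_set_closed (G : plane_graph R) : closed (graph_set G).
Proof.
apply: (@graph_part_closed G setT (fun=> `[0, 1]%classic)) => [_|e t].
  exact: segment_compact.
by rewrite /= in_itv.
Qed.

Lemma nbhs_not_closed (T : topologicalType) (K : set T) x :
  closed K -> ~ K x -> nbhs x (~` K).
Proof. by move=> cK Kx; apply: open_nbhs_nbhs; split=> //; exact: closed_openC. Qed.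

(** The inverse of the orthogonal projection of the open hemisphere around [x] to the tangent
    plane. *)
Definition sphere_param (x a b : 'rV[R]_3) (X Y : R) : 'rV[R]_3 :=
  X *: a + Y *: b + Num.sqrt (1 - X ^+ 2 - Y ^+ 2) *: x.

Section Param.
Variables x a b : 'rV[R]_3.
Hypothesis fr : frame x a b.

Lemma sphere_param_a X Y : dotv (sphere_param x a b X Y) a = X.
Proof.
case: fr => xx aa bb xa xb ab _.
by rewrite !dotvDl !dotvZl aa (dotvC b) ab xa; ring.
Qed.

Lemma sphere_param_b X Y : dotv (sphere_param x a b X Y) b = Y.
Proof.
case: fr => xx aa bb xa xb ab _.
by rewrite !dotvDl !dotvZl bb ab xb; ring.
Qed.

Lemma sphere_param_x X Y :
  dotv (sphere_param x a b X Y) x = Num.sqrt (1 - X ^+ 2 - Y ^+ 2).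
Proof.
case: fr => xx aa bb xa xb ab _.
by rewrite !dotvDl !dotvZl (dotvC a) (dotvC b) xx xa xb; ring.
Qed.

Lemma sphere_param_sphere X Y : X ^+ 2 + Y ^+ 2 <= 1 ->
  sphere (sphere_param x a b X Y).
Proof.
move=> XY1; rewrite /sphere /= (frame_dotv _ _ fr).
rewrite sphere_param_a sphere_param_b sphere_param_x -!expr2 sqr_sqrtr; last by lra.
by ring.
Qed.

Lemma sphere_paramK y : sphere y -> 0 < dotv y x ->
  sphere_param x a b (dotv y a) (dotv y b) = y.
Proof.
move=> sy yx; rewrite [RHS](frame_decomp y fr) /sphere_param.
rewrite (_ : 1 - _ - _ = dotv y x ^+ 2); last first.
  by move: sy; rewrite /sphere /= (frame_dotv _ _ fr) => <-; ring.
by rewrite sqrtr_sqr gtr0_norm// addrC addrA.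
Qed.

Lemma sphere_param0 : sphere_param x a b 0 0 = x.
Proof. by rewrite /sphere_param !scale0r !expr0n /= !subr0 sqrtr1 !add0r scale1r. Qed.

Lemma sphere_param_continuous (T : topologicalType) (f g : T -> R) t :
  {for t, continuous f} -> {for t, continuous g} ->
  {for t, continuous (fun z => sphere_param x a b (f z) (g z))}.
Proof.
move=> cf cg.
have cs : {for t, continuous (fun z => Num.sqrt (1 - f z ^+ 2 - g z ^+ 2))}.
  apply: (@continuous_comp _ _ _ (fun z => 1 - f z ^+ 2 - g z ^+ 2) Num.sqrt).
    apply: cvgB; first apply: cvgB; first exact: cvg_cst.
    - exact: (cvgM cf cf).
    - exact: (cvgM cg cg).
  exact: sqrt_continuous.
exact: continuousD (continuousD (continuousZr_tmp cf) (continuousZr_tmp cg)) (continuousZr_tmp cs).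
Qed.

(** This curve runs through [x] at time 1/2 on the great circle of [b] and [x]; it is the standard
    path across an edge with tangent [a]. The coefficient of [x] has derivative 0 there, because its
    derivative carries the factor [Y], which vanishes. *)
Lemma meridian_derive eps : is_derive (2^-1 : R) 1
  (fun t => sphere_param x a b 0 (eps / 2 - eps * t)) (- eps *: b).
Proof.
pose Y (t : R) := - eps * t + eps / 2.
have dY : is_derive (2^-1 : R) 1 Y (- eps) := is_derive_affine _ _ _.
have Y2 : Y 2^-1 = 0 by rewrite /Y; lra.
have dsqrt : is_derive (2^-1 : R) 1 (fun t => Num.sqrt (1 - Y t * Y t)) 0.
  have dY2 := is_derive_sub (is_derive_cst (1 : R) (2^-1 : R) 1) (is_derive_mul dY dY).
  have pos : 0 < 1 - Y 2^-1 * Y 2^-1 by rewrite Y2; lra.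
  have h := @is_derive1_comp R Num.sqrt (fun t => 1 - Y t * Y t) _ _ _
    (is_derive1_sqrt pos) dY2.
  by apply: is_derive_eq h _; rewrite Y2 !mulr0 mul0r addr0 subrr mulr0.
have -> : (fun t : R => sphere_param x a b 0 (eps / 2 - eps * t))
    = (fun t => Y t *: b + Num.sqrt (1 - Y t * Y t) *: x).
  apply/funext => t; rewrite /sphere_param scale0r add0r expr0n /= subr0.
  by rewrite (_ : eps / 2 - eps * t = Y t) ?expr2// /Y addrC mulNr.
apply/is_derive_mxP => i j.
have h := is_derive_add (is_derive_mul dY (is_derive_cst (b i j) (2^-1 : R) 1))
  (is_derive_mul dsqrt (is_derive_cst (x i j) (2^-1 : R) 1)).
rewrite (_ : (fun _ => _) = (fun t => Y t * b i j + Num.sqrt (1 - Y t * Y t) * x i j)).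
  by apply: is_derive_eq h _; rewrite !mxE mul0r !mulr0 !addr0.
by apply/funext => t; rewrite !mxE.
Qed.

End Param.

Lemma sqr_lt4 (z rho : R) : `|z| < rho -> rho <= 2^-1 -> z ^+ 2 < 4^-1.
Proof. by rewrite ltr_norml => ? ?; nra. Qed.

End EdgeTools.

Lemma exists_lt4 (R : realFieldType) (x y z w : R) : 0 < x -> 0 < y -> 0 < z -> 0 < w ->
  exists q, [/\ 0 < q, q < x, q < y, q < z & q < w].
Proof.
move=> x0 y0 z0 w0.
have [m [m0 mx my mz mw]] : exists m, [/\ 0 < m, m <= x, m <= y, m <= z & m <= w].
  exists (Num.min (Num.min x y) (Num.min z w)); rewrite !lt_min !ge_min x0 y0 z0 w0.
  by rewrite !lexx !orbT.
by exists (m / 2); split; lra.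
Qed.

Lemma segment_lt (R : realFieldType) (x y t e : R) : x < e -> y < e -> 0 <= t <= 1 ->
  x + t * (y - x) < e.
Proof.
move=> xe ye t01; rewrite -subr_gt0.
have -> : e - (x + t * (y - x)) = (1 - t) * (e - x) + t * (e - y) by ring.
have [t0|t0] := leP t 2^-1.
  by apply: ltr_wpDr; [apply: mulr_ge0|apply: mulr_gt0]; lra.
by apply: ltr_wpDl; [apply: mulr_ge0|apply: mulr_gt0]; lra.
Qed.

Lemma segment_norm_lt (R : realFieldType) (x y t e : R) : `|x| < e -> `|y| < e ->
  0 <= t <= 1 -> `|x + t * (y - x)| < e.
Proof.
rewrite !ltr_norml => /andP[x1 x2] /andP[y1 y2] t01; rewrite segment_lt// andbT.
have := @segment_lt _ (- x) (- y) t e ltac:(lra) ltac:(lra) t01.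
have -> : - x + t * (- y - - x) = - (x + t * (y - x)) by ring.
by lra.
Qed.

(** * The graph near an interior point of an edge *)

Section EdgeChart.
Variables (R : realType) (G : plane_graph R).

(* In [W], [zeta] is positive to the left of [e] and negative to its right. *)
Record two_sided (e : edge G) (W : set 'rV[R]_3) (zeta : 'rV[R]_3 -> R) : Prop := {
  ts_open : open W;
  ts_continuous : forall x, W x -> {for x, continuous zeta};
  ts_graph : forall x, W x -> sphere x -> (graph_set G x <-> zeta x = 0);
  ts_vertex : forall x, W x -> sphere x -> ~ vertex_set G x;
  ts_edge : forall c t e' u d, W (c t) -> crosses c t e' u d -> e' = e;
  ts_cross : forall (c : R -> 'rV[R]_3) (t : R) u d, (\forall z \near t, sphere (c z)) -> W (c t) ->
    crosses c t e u d ->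
    exists2 r, 0 < r & forall z,
      (t - r < z < t -> W (c z) /\ 0 < det3 (c t) d (derive1 (arc e) u) * zeta (c z)) /\
      (t < z < t + r -> W (c z) /\ det3 (c t) d (derive1 (arc e) u) * zeta (c z) < 0);
  ts_join : forall x y, W x -> W y -> sphere x -> sphere y -> 0 < zeta x * zeta y ->
    exists c : R -> 'rV[R]_3, [/\ c 0 = x, c 1 = y & forall t, 0 <= t <= 1 ->
      [/\ {for t, continuous c}, W (c t), sphere (c t) & 0 < zeta x * zeta (c t)]];
  ts_across : exists c : R -> 'rV[R]_3, [/\ 0 < zeta (c 0), zeta (c 1) < 0,
      forall t, 0 <= t <= 1 -> [/\ {for t, continuous c}, W (c t) & sphere (c t)]
    & exists t u d, [/\ 0 < t < 1, crosses c t e u d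
        & forall z, 0 <= z <= 1 -> z != t -> zeta (c z) != 0]] }.

Lemma edge_graph_coordinates (e : edge G) (s : R) : 0 < s < 1 -> exists a b (r : R),
  [/\ frame (arc e s) a b, 0 < r & derive1 (arc e) s = r *: a].
Proof.
move=> s01; have s01' : 0 <= s <= 1 by lra.
have [|||a [b [r [fr r0 vE]]]] := @frame_of_tangent R (arc e s) (derive1 (arc e) s).
- exact: (arc_sphere e s01').
- apply: (@sphere_tangent _ (arc e) s).
    apply/nbhs_realP; exists (Num.min s (1 - s)); first by rewrite lt_min; lra.
    move=> u us; apply: arc_sphere.
    by move: us; case: (leP s) => ?; lra.
  by rewrite derive1E; apply/derivableP; exact: arc_derivable.
- exact: arc_regular.
by exists a, b, r.
Qed.

Lemma near_pos (f : R -> R) (s : R) : {for s, continuous f} -> 0 < f s ->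
  \forall u \near s, 0 < f u.
Proof. by move=> cf fs; exact: (cvgr_gt _ cf). Qed.

Lemma edge_derive_continuous (e : edge G) (s : R) : 0 < s < 1 ->
  {for s, continuous (derive1 (arc e))}.
Proof.
move=> s01; have c01 : {within (`]0, 1[%classic : set R), continuous (derive1 (arc e))}.
  apply: continuous_subspaceW (arc_C1 (e := e)).
  by apply: subset_itv; rewrite bnd_simp.
move: c01; rewrite continuous_open_subspace; last exact: interval_open.
by apply; rewrite inE /= in_itv.
Qed.

(* Near [arc e s] the edge is the graph of [g] in the coordinates
   [(dotv x a, dotv x b)] of the sphere. *)
Record edge_coordinates (e : edge G) (s : R) (O : set 'rV[R]_3) (a b : 'rV[R]_3)
    (A B eps rho : R) (g : R -> R) : Prop := {
  ec_frame : frame (arc e s) a b;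
  ec_tangent : exists2 r, 0 < r & derive1 (arc e) s = r *: a;
  ec_itv : [/\ A < s < B, 0 < A & B < 1];
  ec_pos : forall u, A < u < B -> 0 < dotv (derive1 (arc e) u) a;
  ec_graph : forall u, A < u < B -> g (dotv (arc e u) a) = dotv (arc e u) b;
  ec_derive : forall u, A < u < B -> is_derive (dotv (arc e u) a) 1 g
    (dotv (derive1 (arc e) u) b * (dotv (derive1 (arc e) u) a)^-1);
  ec_eps : 0 < eps <= rho / 2 /\ rho <= 2^-1;
  ec_cont : forall y, `|y| < eps -> {for y, continuous g} /\ `|g y| < rho / 2;
  ec_arc : forall y, `|y| < eps -> exists2 u, A < u < B &
    [/\ dotv (arc e u) a = y, dotv (arc e u) b = g y & 0 < dotv (arc e u) (arc e s)];
  ec_param : forall X Y, `|X| < rho -> `|Y| < rho ->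
    O (sphere_param (arc e s) a b X Y) /\
    (graph_set G (sphere_param (arc e s) a b X Y) ->
      exists2 u, A < u < B & sphere_param (arc e s) a b X Y = arc e u) }.

(** The tangential coordinate [X] has a positive derivative around [s], so it can be inverted on
    some [A, B], and [g] is the other coordinate [Y] read through this inverse [tau]. The rest of
    the graph is closed and misses [arc e s], which gives the size [rho] of a square free of it. *)
Lemma edge_coordinatesP (e : edge G) (s : R) (O : set 'rV[R]_3) :
  0 < s < 1 -> nbhs (arc e s) O ->
  exists a b A B eps rho g, edge_coordinates e s O a b A B eps rho g.
Proof.
move=> s01 Oe; have [a [b [r [fr r0 vE]]]] := edge_graph_coordinates e s01.
have s01' : 0 <= s <= 1 by lra.
set x0 := arc e s in fr Oe *.
have [xx aa bb xa xb ab d1] := fr.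
pose X u := dotv (arc e u) a.
pose Y u := dotv (arc e u) b.
pose X' u := dotv (derive1 (arc e) u) a.
pose Y' u := dotv (derive1 (arc e) u) b.
have dX w (u : R) : 0 <= u <= 1 ->
    is_derive u 1 (fun u => dotv (arc e u) w) (dotv (derive1 (arc e) u) w).
  move=> u01; apply: is_derive_dotv; rewrite derive1E; apply/derivableP.
  exact: arc_derivable.
have X's : X' s = r by rewrite /X' vE dotvZl aa mulr1.
have [A [B [sAB [A0 B1] ABP]]] : exists A B : R, [/\ A < s < B, 0 < A /\ B < 1 &
    forall u, A <= u <= B -> 0 < X' u /\ 0 < dotv (arc e u) x0].
  have n1 : \forall u \near s, 0 < X' u.
    apply: near_pos; last by rewrite X's.
    apply: (@continuous_comp _ _ _ (derive1 (arc e)) (fun v => dotv v a)).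
      exact: edge_derive_continuous.
    exact: continuous_dotv.
  have n2 : \forall u \near s, 0 < dotv (arc e u) x0.
    apply: near_pos; last by rewrite xx.
    by apply: is_derive_continuous (dX x0 s s01').
  have /nbhs_realP[d d0 dP] : nbhs s [set u | 0 < X' u /\ 0 < dotv (arc e u) x0].
    exact: filterI.
  have [||||q [q0 qd _ qs q1]] := @exists_lt4 R d d s (1 - s); try lra.
  exists (s - q), (s + q); split; [lra|by split; lra|].
  by move=> u uq; have [] := dP u ltac:(lra).
have AB : A < B by lra.
have [tau [tauK XtauK dtau X_lt]] : exists tau : R -> R,
    [/\ forall u, A <= u <= B -> tau (X u) = u,
        forall y, X A <= y <= X B -> A <= tau y <= B /\ X (tau y) = y,
        forall u, A < u < B -> is_derive (X u) 1 tau (X' u)^-1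
      & forall u v, A <= u <= B -> A <= v <= B -> u < v -> X u < X v].
  apply: increasing_inverse => //.
  - apply: continuous_in_subspaceT => u; rewrite inE /= in_itv /= => uAB.
    by apply: is_derive_continuous (dX a u _); lra.
  - by move=> u uAB; apply: dX; lra.
  - by move=> u uAB; have [] := ABP u ltac:(lra).
have Xs : X s = 0 by rewrite /X xa.
have Ys : Y s = 0 by rewrite /Y xb.
have [XA0 XB0] : X A < 0 /\ 0 < X B.
  by rewrite -Xs; split; apply: X_lt; lra.
pose g y := Y (tau y).
have gX (u : R) : A <= u <= B -> g (X u) = Y u by move=> uAB; rewrite /g tauK.
have in_AB (y : R) : X A < y < X B -> A < tau y < B.
  move=> yAB; have [tAB Xt] := XtauK y ltac:(lra).
  have hA : tau y <> A by move=> h; move: Xt; rewrite h; lra.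
  have hB : tau y <> B by move=> h; move: Xt; rewrite h; lra.
  by move/eqP: hA; move/eqP: hB; lra.
have dg (u : R) : A < u < B -> is_derive (X u) 1 g (Y' u * (X' u)^-1).
  move=> uAB; apply: is_derive1_comp; last exact: dtau.
  by rewrite tauK; [apply: dX|]; lra.
have cg (y : R) : X A < y < X B -> {for y, continuous g}.
  move=> yAB; have [tAB Xt] := XtauK y ltac:(lra).
  by have := is_derive_continuous (dg _ (in_AB y yAB)); rewrite Xt.
have g0 : g 0 = 0 by rewrite -Xs gX//; lra.
(* [K] is the graph with the open piece of [e] between the times [A] and [B] removed. *)
pose S e' : set R := if e' == e then `[0, A]%classic `|` `[B, 1]%classic else `[0, 1]%classic.
pose K := (@pos R G) @` setT `|` \bigcup_(e' in setT) (arc e' @` S e').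
have Kc : closed K.
  apply: graph_part_closed => [e'|e' t]; rewrite /S; case: ifP => _.
  - by apply: compactU; exact: segment_compact.
  - exact: segment_compact.
  - by case; rewrite /= in_itv /=; lra.
  - by rewrite /= in_itv.
have Kx : ~ K x0.
  case=> [[v _ vx]|[e' _ [t St tx]]].
    by have := @arc_vertex R G e s v s01; rewrite -/x0 vx.
  have [t0|t0] := eqVneq t 0.
    by have := @arc_vertex R G e s (source e') s01; rewrite -arc0 -t0 tx.
  have [t1|t1] := eqVneq t 1.
    by have := @arc_vertex R G e s (target e') s01; rewrite -arc1 -t1 tx.
  have t01 : 0 < t < 1.
    move: St; rewrite /S; case: ifP => _; last by rewrite /= in_itv /=; lra.
    by case; rewrite /= in_itv /=; lra.
  have [ee ts] := arc_inj t01 s01 tx.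
  by move: St; rewrite /S ee eqxx; case; rewrite /= in_itv /=; lra.
have graphK x : graph_set G x -> ~ K x -> exists2 u : R, A < u < B & x = arc e u.
  case=> [[v _ vx] []|[e' _ [t /=]]]; first by left; exists v.
  rewrite in_itv /= => t01 tx nK; have [ee|ne] := eqVneq e' e.
    exists t; last by rewrite -tx ee.
    apply: contra_notT nK; rewrite negb_and -!leNgt => h; right; exists e' => //.
    exists t => //; rewrite /S ee eqxx /=.
    by case/orP: h => ?; [left|right]; rewrite in_itv /=; lra.
  case: nK; right; exists e' => //; exists t => //.
  by rewrite /S (negbTE ne) /= in_itv.
(* The bound 1/2 keeps the square of half-side [rho] inside the unit disc, where the projection can
   be inverted. *)
have [rho rho0 rhoP] : exists2 rho : R, 0 < rho <= 2^-1 &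
    forall X Y, `|X| < rho -> `|Y| < rho -> (O `&` ~` K) (sphere_param x0 a b X Y).
  have cp : {for (0, 0), continuous
      (fun z : R * R => sphere_param x0 a b z.1 z.2)}.
    by apply: sphere_param_continuous; [exact: cvg_fst|exact: cvg_snd].
  have Ox : nbhs (sphere_param x0 a b 0 0) (O `&` ~` K).
    by rewrite sphere_param0; apply: filterI => //; exact: nbhs_not_closed.
  have /nbhs_ballP[q /= q0 qP] := cp _ Ox.
  exists (Num.min q 2^-1).
    by clear -q0; case: (leP q) => ?; lra.
  move=> X1 Y1 hX hY; apply: (qP (X1, Y1)); split; rewrite /ball /= sub0r normrN.
    by apply: lt_le_trans hX _; rewrite ge_min lexx.
  by apply: lt_le_trans hY _; rewrite ge_min lexx.
(* Both [g] and the height above its graph will stay below [rho / 2], so that their sum, the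
   coordinate along [b], stays below [rho]. *)
have [eps [eps0 epsA epsB epsr epsg]] : exists eps : R, [/\ 0 < eps, eps < - X A, eps < X B,
    eps <= rho / 2 & forall y, `|y| < eps -> `|g y| < rho / 2].
  have c0 := cg 0 ltac:(lra).
  have r20 : `|g 0| < rho / 2 by rewrite g0 normr0; lra.
  have /nbhs_realP[q q0 qP] : nbhs (0 : R) [set y | `|g y| < rho / 2].
    by move: c0 => /cvgr_norm_lt /(_ _ r20).
  have [||||eps [? ? ? ? ?]] := @exists_lt4 R q (rho / 2) (- X A) (X B); try lra.
  exists eps; split=> //; first lra.
  move=> y; rewrite ltr_norml => yq; apply: qP; lra.
exists a, b, A, B, eps, rho, g; split=> //.
- by exists r.
- by move=> u uAB; have [] := ABP u ltac:(lra).
- by move=> u uAB; rewrite gX//; lra.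
- by split; lra.
- by move=> y yeps; split; [apply: cg; move: yeps; rewrite ltr_norml; lra|exact: epsg].
- move=> y; rewrite ltr_norml => yeps; have yX : X A < y < X B by lra.
  have [tAB Xt] := XtauK y ltac:(lra); exists (tau y); first exact: in_AB.
  by split=> //; have [] := ABP _ tAB.
- move=> X1 Y1 hX hY; have [OX nK] := rhoP _ _ hX hY; split=> // gr.
  exact: graphK.
Qed.

(** In the tangent frame the edge is the graph of [g], and [zeta] is the height above it, positive
    on the left because [a] is the direction of the edge and [b] is its counterclockwise quarter
    turn. The tangential coordinate and [zeta] map the part of [W] on the sphere onto a square, so
    both sides are convex in these coordinates. *)
Lemma edge_chart (e : edge G) (s : R) (O : set 'rV[R]_3) : 0 < s < 1 -> nbhs (arc e s) O ->
  exists W zeta, [/\ two_sided e W zeta, W (arc e s)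
    & forall x, W x -> sphere x -> O x].
Proof.
move=> s01 Oe.
have [a [b [A [B [eps [rho [g]]]]]]] := edge_coordinatesP s01 Oe.
case=> fr [r r0 vE] [sAB A0 B1] X'0 gX dg [eps0 rho2] cg garc par.
have xs u : A < u < B -> sphere (arc e u) by move=> ?; apply: arc_sphere; lra.
set x0 := arc e s in fr garc par *.
have [xx aa bb xa xb ab d1] := fr.
pose zeta x := dotv x b - g (dotv x a).
pose W := [set x | [/\ 0 < dotv x x0, `|dotv x a| < eps & `|zeta x| < eps]].
have g0 : g 0 = 0 by have := gX s sAB; rewrite -/x0 xa xb.
have Wx0 : W x0.
  by rewrite /W /= xx xa /zeta xa xb g0 subrr normr0; split=> //; lra.
have zc x : `|dotv x a| < eps -> {for x, continuous zeta}.
  move=> xe; have c2 : {for x, continuous (fun y => g (dotv y a))}.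
    apply: (@continuous_comp _ _ _ (fun v => dotv v a) g); first exact: continuous_dotv.
    exact: (cg _ xe).1.
  exact: (continuousB (@continuous_dotv _ b x) c2).
have coord x : W x -> sphere x -> [/\ `|dotv x a| < rho, `|dotv x b| < rho
    & sphere_param x0 a b (dotv x a) (dotv x b) = x].
  move=> [xx0 xe ze] sx; split; first by lra.
    have := (cg _ xe).2; move: ze; rewrite /zeta !ltr_norml => ? ?; lra.
  exact: sphere_paramK.
have WO x : W x -> sphere x -> O x.
  by move=> Wx sx; have [h1 h2 <-] := coord x Wx sx; have [] := par _ _ h1 h2.
have Wgraph x : W x -> sphere x -> graph_set G x -> exists2 u, A < u < B & x = arc e u.
  move=> Wx sx gx; have [h1 h2 h3] := coord x Wx sx; have [_] := par _ _ h1 h2.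
  by rewrite h3; apply.
have zeta_arc u : A < u < B -> zeta (arc e u) = 0.
  by move=> uAB; rewrite /zeta gX// subrr.
have Wopen : open W.
  rewrite openE => x [xx0 xe ze]; rewrite /interior.
  have n1 : \forall y \near x, 0 < dotv y x0.
    exact: (cvgr_gt _ (@continuous_dotv _ x0 x) _ xx0).
  have n2 : \forall y \near x, `|dotv y a| < eps.
    by move: (@continuous_dotv _ a x) => /cvgr_norm_lt /(_ _ xe).
  have n3 : \forall y \near x, `|zeta y| < eps.
    by move: (zc x xe) => /cvgr_norm_lt /(_ _ ze).
  by apply: filterS3 n1 n2 n3 => y; split.
exists W, zeta; split=> //; split=> //.
- by move=> x [_ xe _]; exact: zc.
- move=> x Wx sx; split=> [/(Wgraph x Wx sx)[u uAB ->]|zx]; first exact: zeta_arc.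
  have [h1 h2 h3] := coord x Wx sx; have [xx0 xe ze] := Wx.
  have [u uAB [ua ub ux]] := garc _ xe.
  right; exists e => //; exists u; first by rewrite /= in_itv /=; lra.
  rewrite -(sphere_paramK fr (xs u uAB) ux) ua ub -[RHS]h3; congr (sphere_param _ _ _ _ _).
  by apply/esym/eqP; rewrite -subr_eq0; apply/eqP.
- move=> x Wx sx [v _ vx]; have [] := Wgraph x Wx sx; first by left; exists v.
  by move=> u uAB xu; apply: (@arc_vertex R G e u v); [lra|rewrite -xu vx].
- move=> c t e' u d Wc [u01 cu _ _].
  have sc : sphere (c t) by rewrite cu; apply: arc_sphere; lra.
  have gc : graph_set G (c t).
    by right; exists e' => //; exists u; [rewrite /= in_itv /=; lra|rewrite cu].
  have [u' uAB cu'] := Wgraph _ Wc sc gc.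
  have u'01 : 0 < u' < 1 by lra.
  by have [] := arc_inj u01 u'01 (etrans (esym cu) cu').
- move=> c t u d sc Wc [u01 cu cd dN].
  have sct : sphere (c t) by rewrite cu; apply: arc_sphere; lra.
  have gc : graph_set G (c t).
    by right; exists e => //; exists u; [rewrite /= in_itv /=; lra|rewrite cu].
  have [u' u'AB cu'] := Wgraph _ Wc sct gc.
  have u'01 : 0 < u' < 1 by lra.
  have [_ uu'] := arc_inj u01 u'01 (etrans (esym cu) cu').
  have uAB : A < u < B by rewrite uu'.
  have X0 := X'0 u uAB.
  have td : dotv (c t) d = 0 by apply: sphere_tangent cd; exact: sc.
  have ta : dotv (c t) (derive1 (arc e) u) = 0.
    rewrite cu; apply: (@sphere_tangent _ (arc e) u).
      apply/nbhs_realP; exists (Num.min u (1 - u)); first by rewrite lt_min; lra.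
      move=> z zu; apply: arc_sphere.
      by move: zu; clear; case: (leP u) => ?; lra.
    by rewrite derive1E; apply/derivableP; apply: arc_derivable; lra.
  set D := det3 (c t) d _ in dN *.
  have xx0 : 0 < dotv x0 (c t) by rewrite dotvC; case: Wc.
  have key := frame_det3 d (derive1 (arc e) u) fr.
  rewrite (tangent_det3 x0 sct td ta) -/D in key.
  have zt : zeta (c t) = 0 by rewrite cu zeta_arc.
  (* By the chain rule the derivative of [zeta] along [c] is minus a 2 x 2 determinant divided by
     [dotv (derive1 (arc e) u) a]; by [tangent_det3] this determinant, taken at [x0], is [D] times
     the positive number [dotv x0 (c t)]. Hence [D * zeta] decreases through 0. *)
  have dz : is_derive t 1 (fun z => D * zeta (c z)) (D * - (dotv x0 (c t) * D
      / dotv (derive1 (arc e) u) a)).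
    have gu : is_derive (dotv (c t) a) 1 g
        (dotv (derive1 (arc e) u) b * (dotv (derive1 (arc e) u) a)^-1).
      by rewrite cu; exact: dg.
    have h := is_derive_sub (is_derive_dotv b cd)
      (is_derive1_comp gu (is_derive_dotv a cd)).
    apply: is_derive_eq (is_derive_mul (is_derive_cst D t 1) h) _.
    rewrite mul0r add0r; congr (_ * _); rewrite key.
    by field; rewrite gt_eqF.
  have [||q q0 qP] := is_derive_neg_sign dz.
  - by rewrite zt mulr0.
  - rewrite [ltLHS](_ : _ = - (dotv x0 (c t) * D ^+ 2 / dotv (derive1 (arc e) u) a)).
      by rewrite oppr_lt0 divr_gt0// mulr_gt0// exprn_even_gt0.
    by ring.
  have /nbhs_realP[q' q'0 q'P] : nbhs t [set z | W (c z)].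
    apply: (is_derive_continuous cd); apply: open_nbhs_nbhs; split=> //.
  have [m [m0 mq mq' _ _]] := exists_lt4 q0 q'0 q0 q'0.
  exists m => // z; split=> zt'; split.
  - by apply: q'P; clear -zt' m0 mq'; lra.
  - by apply: (qP z).1; clear -zt' mq; lra.
  - by apply: q'P; clear -zt' m0 mq'; lra.
  - by apply: (qP z).2; clear -zt' mq; lra.
- move=> x y Wx Wy sx sy xy0.
  (* The path is a segment in the coordinates given by [dotv _ a] and [zeta], along which [zeta]
     keeps its sign. *)
  pose X (t : R) := dotv x a + t * (dotv y a - dotv x a).
  pose h (t : R) := zeta x + t * (zeta y - zeta x).
  have [xx0 xe xz] := Wx; have [yx0 ye yz] := Wy.
  have [hx1 hx2 hx3] := coord x Wx sx; have [hy1 hy2 hy3] := coord y Wy sy.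
  have Xe t : 0 <= t <= 1 -> `|X t| < eps.
    exact: segment_norm_lt.
  have he t : 0 <= t <= 1 -> `|h t| < eps.
    exact: segment_norm_lt.
  have ghrho t : 0 <= t <= 1 -> `|g (X t) + h t| < rho.
    move=> t01; have := he t t01; have := (cg _ (Xe t t01)).2.
    by rewrite !ltr_norml; lra.
  have sq (z : R) : `|z| < rho -> z ^+ 2 < 4^-1.
    by move=> zr; apply: sqr_lt4 zr _; lra.
  exists (fun t => sphere_param x0 a b (X t) (g (X t) + h t)); split.
  - by rewrite /X /h !mul0r !addr0 /zeta addrC subrK.
  - rewrite /X /h !mul1r (addrC (dotv x a)) subrK (addrC (zeta x)) subrK.
    by rewrite /zeta addrC subrK.
  move=> t t01; split.
  - have cX : {for t, continuous X}.
      apply: continuousD; first exact: cvg_cst.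
      by apply: continuousM; [exact: cvg_id|exact: cvg_cst].
    apply: sphere_param_continuous => //.
    apply: continuousD.
      by apply: (@continuous_comp _ _ _ X g) => //; exact: (cg _ (Xe t t01)).1.
    apply: continuousD; first exact: cvg_cst.
    by apply: continuousM; [exact: cvg_id|exact: cvg_cst].
  - have Xr : `|X t| < rho by apply: lt_le_trans (Xe t t01) _; lra.
    have := sq _ Xr; have := sq _ (ghrho t t01) => ? ?.
    split; rewrite /zeta ?sphere_param_a ?sphere_param_b ?sphere_param_x//.
    + by rewrite sqrtr_gt0; lra.
    + exact: Xe.
    + by rewrite addrC addKr; exact: he.
  - have Xr : `|X t| < rho by apply: lt_le_trans (Xe t t01) _; lra.
    have := sq _ Xr; have := sq _ (ghrho t t01) => ? ?.
    by apply: sphere_param_sphere => //; lra.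
  - rewrite [X in _ * X]/zeta sphere_param_a// sphere_param_b// (addrC (g _)) addrK /h.
    have x0' : zeta x != 0 by apply: contraTneq xy0 => ->; rewrite mul0r ltxx.
    have xx2 : 0 < zeta x * zeta x by rewrite -expr2 exprn_even_gt0.
    have := @segment_lt _ (- (zeta x * zeta x)) (- (zeta x * zeta y)) t 0
      ltac:(lra) ltac:(lra) t01.
    by rewrite -oppr_lt0; congr (_ < _); ring.
(* Down the meridian through [x0], from height eps / 2 to - eps / 2, meeting the edge at time 1/2
   only. *)
- pose Y (t : R) := eps / 2 - eps * t.
  have Ye t : 0 <= t <= 1 -> `|Y t| < eps.
    move=> t01; rewrite /Y (_ : _ - _ = eps / 2 + t * (- (eps / 2) - eps / 2)); last by field.
    by apply: segment_norm_lt => //; rewrite ?normrN gtr0_norm; lra.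
  have Ysq t : 0 <= t <= 1 -> Y t ^+ 2 < 4^-1.
    by move=> /Ye Yt; apply: sqr_lt4 Yt _; lra.
  have Y2 : Y 2^-1 = 0 by rewrite /Y; lra.
  exists (fun t => sphere_param x0 a b 0 (Y t)).
  have zY t : zeta (sphere_param x0 a b 0 (Y t)) = Y t.
    by rewrite /zeta sphere_param_a// sphere_param_b// g0 subr0.
  split.
  - by rewrite zY /Y; lra.
  - by rewrite zY /Y; lra.
  - move=> t t01; have Yt := Ysq t t01; split.
    + apply: sphere_param_continuous; first exact: cvg_cst.
      apply: continuousB; first exact: cvg_cst.
      by apply: continuousM; [exact: cvg_cst|exact: cvg_id].
    + split; rewrite ?zY ?sphere_param_a ?sphere_param_x//.
      * by rewrite sqrtr_gt0 expr0n /=; lra.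
      * by rewrite normr0; lra.
      * exact: Ye.
    + by apply: sphere_param_sphere => //; rewrite expr0n /=; lra.
  exists 2^-1, s, (- eps *: b); split; first by lra.
  - split=> //.
    + by rewrite Y2 sphere_param0.
    + exact: meridian_derive.
    + rewrite Y2 sphere_param0 (frame_det3 _ _ fr) vE !dotvZl (dotvC b) ab aa bb.
      rewrite (_ : _ - _ = eps * r); last by ring.
      by rewrite mulf_neq0// gt_eqF//; lra.
  - move=> z z01 zt; rewrite zY /Y; apply: contraNneq zt => Yz.
    have e0 : eps != 0 by rewrite gt_eqF//; lra.
    by apply/eqP/(mulfI e0); lra.
Qed.

End EdgeChart.

(** * The graph near a vertex *)

Section DartPolar.
Variables (R : realType) (G : plane_graph R).
Implicit Types (al : dart G) (tau : R).

Definition dart_time al tau : R := if al.2 then 1 - tau else tau.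

(* [dart_arc al] runs along the edge of [al] starting from [head al]. *)
Definition dart_arc al tau : 'rV[R]_3 := arc al.1 (dart_time al tau).

(** The sign is there because a dart points towards its head, while [dart_arc] runs away from it. *)
Definition dart_out al tau : 'rV[R]_3 := - dart_velocity al (dart_time al tau).

Lemma dart_arc0 al : dart_arc al 0 = pos (head al).
Proof.
rewrite /dart_arc /dart_time /head; case: al.2.
  by rewrite subr0 arc1.
by rewrite arc0.
Qed.

Lemma dart_out0 al : dart_out al 0 = out_direction al.
Proof. by rewrite /dart_out /out_direction /dart_time subr0. Qed.

Lemma dart_time01 al tau : (0 <= dart_time al tau <= 1) = (0 <= tau <= 1).
Proof. by rewrite /dart_time; case: al.2 => //; apply/idP/idP => ?; lra. Qed.

Lemma dart_arc_derive al tau : 0 <= tau <= 1 ->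
  is_derive tau 1 (dart_arc al) (dart_out al tau).
Proof.
rewrite -(dart_time01 al) => t01.
have := arc_derivable t01 (e := al.1) => /derivableP; rewrite -derive1E.
rewrite /dart_out /dart_arc /dart_velocity /dart_time; case: al.2 => h; last first.
  by rewrite opprK.
have {}h : is_derive (-1 * tau + 1) 1 (arc al.1) (derive1 (arc al.1) (1 - tau)).
  by rewrite mulN1r addrC.
have := is_derive_affine_comp h; rewrite scaleN1r.
by under eq_fun do rewrite mulN1r addrC.
Qed.

(** At an end point the derivative of an arc is continuous only relatively to [0, 1], hence the
    restriction on [tau]. *)
Lemma dart_out_near al w : 0 < dotv (out_direction al) w ->
  exists2 del, 0 < del & forall tau, 0 <= tau <= 1 -> tau < del ->
    0 < dotv (dart_out al tau) w.
Proof.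
rewrite -dart_out0 => w0.
have t0 : (`[0, 1]%classic : set R) (dart_time al 0).
  by rewrite /= in_itv /= dart_time01 lexx ler01.
have c0 := (within_continuousP _ _).1 (arc_C1 (e := al.1)) _ t0.
have nb : nbhs (derive1 (arc al.1) (dart_time al 0))
    [set y | 0 < dotv (- (if al.2 then y else - y)) w].
  pose F (y : 'rV[R]_3) := dotv (- (if al.2 then y else - y)) w.
  have cF : {for (derive1 (arc al.1) (dart_time al 0)), continuous F}.
    rewrite /F; case: al.2.
      rewrite (_ : (fun y => _) = (fun y => dotv y (- w))); first exact: continuous_dotv.
      by apply/funext => y; rewrite dotvNl dotvC -dotvNl dotvC.
    rewrite (_ : (fun y => _) = (fun y => dotv y w)); first exact: continuous_dotv.
    by apply/funext => y; rewrite opprK.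
  exact: (cvgr_gt _ cF).
have /nbhs_realP[del del0 dP] := c0 _ nb; exists del; first exact: del0.
move=> tau t01 td.
rewrite /dart_out /dart_velocity; apply: dP.
  by rewrite /dart_time; case: al.2; lra.
by rewrite /= in_itv /= dart_time01.
Qed.

Lemma polar_atan (X Y : R) : 0 < X ->
  X = Num.sqrt (X ^+ 2 + Y ^+ 2) * cos (atan (Y / X)) /\
  Y = Num.sqrt (X ^+ 2 + Y ^+ 2) * sin (atan (Y / X)).
Proof.
move=> X0.
have q : Num.sqrt (X ^+ 2 + Y ^+ 2) = X * Num.sqrt (1 + (Y / X) ^+ 2).
  rewrite -{2}(ger0_norm (ltW X0)) -sqrtr_sqr -sqrtrM ?sqr_ge0//; congr Num.sqrt.
  by field; rewrite gt_eqF.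
have s0 : Num.sqrt (1 + (Y / X) ^+ 2) != 0.
  by rewrite gt_eqF// sqrtr_gt0 ltr_pwDl// sqr_ge0.
have c : Num.sqrt (X ^+ 2 + Y ^+ 2) * cos (atan (Y / X)) = X.
  by rewrite q cos_atan -mulrA mulfV// mulr1.
split; first by rewrite c.
have cn : cos (atan (Y / X)) != 0 by rewrite cos_atan invr_eq0.
have : tan (atan (Y / X)) = Y / X := atanK _.
rewrite /tan => /(canRL (mulfVK cn)) ->.
by rewrite mulrCA c; field; rewrite gt_eqF.
Qed.

(* Near [head al], the edge of [al] has the equation [angle = h radius] in the polar
   coordinates attached to the frame [(a, b)]. *)
Record dart_polar al (x a b : 'rV[R]_3) (kap del rmax : R) (h : R -> R) : Prop := {
  dp_r0 : 0 < rmax;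
  dp_out : forall tau, 0 < tau < del ->
    0 < dotv (dart_arc al tau) a * dotv (dart_out al tau) a
      + dotv (dart_arc al tau) b * dotv (dart_out al tau) b;
  dp_ne : forall tau, 0 < tau < del ->
    0 < dotv (dart_arc al tau) a ^+ 2 + dotv (dart_arc al tau) b ^+ 2;
  dp_arc : forall tau, 0 < tau < del ->
    let r := Num.sqrt (dotv (dart_arc al tau) a ^+ 2 + dotv (dart_arc al tau) b ^+ 2) in
    dotv (dart_arc al tau) a = r * cos (h r) /\ dotv (dart_arc al tau) b = r * sin (h r);
  dp_time : forall r, 0 < r < rmax -> exists2 tau, 0 < tau < del &
    [/\ 0 < dotv (dart_arc al tau) x, dotv (dart_arc al tau) a = r * cos (h r)
      & dotv (dart_arc al tau) b = r * sin (h r)];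
  dp_cont : forall r, 0 < r < rmax -> {for r, continuous h} /\ `|h r| < kap }.

(** Adding the two products [m1] and [m2] gives Y Y' > - k^2 X X', and k^2 <= 1/4. Geometrically,
    two vectors of a narrow cone make an acute angle. *)
Lemma cone_product (k X Y X' Y' : R) : k <= 2^-1 -> 0 < X -> 0 < X' ->
  - (k * X) < Y < k * X -> - (k * X') < Y' < k * X' -> 0 < X * X' + Y * Y'.
Proof.
move=> k2 X0 X'0 hY hY'.
have m1 : 0 < (k * X - Y) * (k * X' - Y') by rewrite mulr_gt0; lra.
have m2 : 0 < (k * X + Y) * (k * X' + Y') by rewrite mulr_gt0; lra.
have k0 : 0 < k by nra.
have m3 : 0 < X * X' by rewrite mulr_gt0.
have m4 : 0 <= X * X' * (4^-1 - k ^+ 2) by rewrite mulr_ge0 ?(ltW m3)//; nra.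
by nra.
Qed.

(** Near the vertex the velocity stays in a narrow cone around [a]. Integrating, so does the
    position, and the two make an acute angle; hence the squared radius [Q] increases and can be
    inverted, and the angle becomes a function of the radius that stays below [kap]. Every small
    [del] is allowed, since the three half-edges at a vertex need a common one. *)
Lemma dart_polarP al (a b : 'rV[R]_3) (r kap : R) :
  frame (pos (head al)) a b -> 0 < r -> out_direction al = r *: a -> 0 < kap ->
  exists2 del0, 0 < del0 & forall del, 0 < del <= del0 ->
    exists rmax h, dart_polar al (pos (head al)) a b kap del rmax h.
Proof.
set x := pos (head al) => fr r0 oE kap0; have [xx aa bb xa xb ab d1] := fr.
(* [k'] is the slope of the cone: at most 1/2 for [cone_product], and such that the half-angle
   [atan k'] is at most [kap]. *)
have [k' [k'0 k'2 k'kap]] : exists k', [/\ 0 < k', k' <= 2^-1 & atan k' <= kap].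
  have pi0 := pi_gt0 R.
  have [||||k [k0 kk kpi _ _]] := @exists_lt4 R kap (pi / 2) kap kap => //; first by lra.
  have tk : 0 < tan k by rewrite -tan0 ltr_tan// in_itv /=; lra.
  exists (Num.min 2^-1 (tan k)); split.
  - by rewrite lt_min tk invr_gt0 ltr0n.
  - by rewrite ge_min lexx.
  - apply: le_trans (_ : atan (tan k) <= _).
      by apply: le_atan; rewrite ge_min lexx orbT.
    by rewrite tanK ?in_itv /=; lra.
have dm v : dotv v (k' *: a - b) = k' * dotv v a - dotv v b.
  by rewrite !dotvE !mxE; ring.
have dp v : dotv v (k' *: a + b) = k' * dotv v a + dotv v b.
  by rewrite !dotvE !mxE; ring.
have dk : dotv a (k' *: a - b) = k' /\ dotv a (k' *: a + b) = k'.
  by rewrite dm dp aa ab; split; ring.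
have [d1' d10 p1] : exists2 del, 0 < del & forall tau, 0 <= tau <= 1 -> tau < del ->
    0 < dotv (dart_out al tau) a.
  by apply: dart_out_near; rewrite oE dotvZl aa mulr1.
have [d2 d20 p2] : exists2 del, 0 < del & forall tau, 0 <= tau <= 1 -> tau < del ->
    0 < dotv (dart_out al tau) (k' *: a - b).
  by apply: dart_out_near; rewrite oE dotvZl dk.1 mulr_gt0.
have [d3 d30 p3] : exists2 del, 0 < del & forall tau, 0 <= tau <= 1 -> tau < del ->
    0 < dotv (dart_out al tau) (k' *: a + b).
  by apply: dart_out_near; rewrite oE dotvZl dk.2 mulr_gt0.
have cf w tau : 0 <= tau <= 1 -> is_derive tau 1 (fun t => dotv (dart_arc al t) w)
    (dotv (dart_out al tau) w).
  by move=> t01; apply: is_derive_dotv; exact: dart_arc_derive.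
have [d4 d40 p4] : exists2 del, 0 < del & forall tau, 0 - del < tau < 0 + del ->
    0 < dotv (dart_arc al tau) x.
  apply/nbhs_realP; apply: near_pos.
    by apply: is_derive_continuous (cf x 0 _); rewrite lexx ler01.
  by rewrite dart_arc0 xx.
have [e [e0 ed1 ed2 ed3 ed4]] := exists_lt4 d10 d20 d30 d40.
exists (Num.min e 2^-1); first by rewrite lt_min e0 invr_gt0 ltr0n.
move=> del; rewrite le_min => /and3P[del0 dele del2].
have t01 tau : 0 <= tau <= del -> 0 <= tau <= 1 by move=> ?; lra.
have itvoo_cc (u : R) : 0 < u < del -> 0 <= u <= del by move=> ?; lra.
(* A coordinate that vanishes at the vertex and increases along the arc is positive. This is applied
   to [a] and to the normals of the two sides of the cone. *)
have pw w : dotv x w = 0 ->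
    (forall tau, 0 < tau < del -> 0 < dotv (dart_out al tau) w) ->
    forall tau, 0 < tau <= del -> 0 < dotv (dart_arc al tau) w.
  move=> xw pw tau td; have <- : dotv (dart_arc al 0) w = 0 by rewrite dart_arc0.
  apply: (@derive_pos_lt _ (fun t => dotv (dart_arc al t) w)
    (fun t => dotv (dart_out al t) w) 0 del _ _ pw); [| |lra|lra|lra].
  - apply: continuous_in_subspaceT => t; rewrite inE /= in_itv /= => td'.
    exact: is_derive_continuous (cf w t (t01 t td')).
  - by move=> t td'; apply: cf; lra.
have pa tau : 0 < tau < del -> 0 < dotv (dart_out al tau) a.
  by move=> td; apply: p1; lra.
have pb tau : 0 < tau < del ->
    - (k' * dotv (dart_out al tau) a) < dotv (dart_out al tau) b < k' * dotv (dart_out al tau) a.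
  move=> td; have := p2 tau ltac:(lra) ltac:(lra); have := p3 tau ltac:(lra) ltac:(lra).
  by rewrite dm dp; lra.
have qa tau : 0 < tau <= del -> 0 < dotv (dart_arc al tau) a by apply: pw.
have qb tau : 0 < tau <= del ->
    - (k' * dotv (dart_arc al tau) a) < dotv (dart_arc al tau) b < k' * dotv (dart_arc al tau) a.
  move=> td.
  have h2 := pw (k' *: a - b) _ _ tau td; have h3 := pw (k' *: a + b) _ _ tau td.
  have {}h2 : 0 < dotv (dart_arc al tau) (k' *: a - b).
    apply: h2 => [|t td']; last by apply: p2; lra.
    by rewrite dm xa xb mulr0 subr0.
  have {}h3 : 0 < dotv (dart_arc al tau) (k' *: a + b).
    apply: h3 => [|t td']; last by apply: p3; lra.
    by rewrite dp xa xb mulr0 addr0.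
  move: h2 h3.
  by rewrite dm dp; lra.
have out tau : 0 < tau < del ->
    0 < dotv (dart_arc al tau) a * dotv (dart_out al tau) a
      + dotv (dart_arc al tau) b * dotv (dart_out al tau) b.
  move=> td; have td' : 0 < tau <= del by lra.
  exact: cone_product k'2 (qa tau td') (pa tau td) (qb tau td') (pb tau td).
pose xi tau := dotv (dart_arc al tau) a.
pose eta tau := dotv (dart_arc al tau) b.
pose Q tau := xi tau * xi tau + eta tau * eta tau.
have dQ tau : 0 <= tau <= 1 -> is_derive tau 1 Q
    ((dotv (dart_out al tau) a * xi tau + xi tau * dotv (dart_out al tau) a)
    + (dotv (dart_out al tau) b * eta tau + eta tau * dotv (dart_out al tau) b)).
  by move=> tt; apply: is_derive_add; apply: is_derive_mul; exact: cf.
have [th [thK Qth dth Q_lt]] : exists th : R -> R,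
  [/\ forall u, 0 <= u <= del -> th (Q u) = u,
      forall y, Q 0 <= y <= Q del -> 0 <= th y <= del /\ Q (th y) = y,
      forall u, 0 < u < del -> {for Q u, continuous th}
    & forall u v, 0 <= u <= del -> 0 <= v <= del -> u < v -> Q u < Q v].
  have cQ : {within `[0, del], continuous Q}.
    apply: continuous_in_subspaceT => t; rewrite inE /= in_itv /= => td'.
    exact: is_derive_continuous (dQ t (t01 t td')).
  have dQ' u : 0 < u < del -> is_derive u 1 Q _ := fun ud => dQ u (t01 u (itvoo_cc u ud)).
  have [u ud|th [h1 h2 h3 h4]] := increasing_inverse del0 cQ dQ'.
    by have := out u ud; rewrite -/(xi u) -/(eta u); lra.
  exists th; split=> // u ud; exact: is_derive_continuous (h3 u ud).
have Q0 : Q 0 = 0 by rewrite /Q /xi /eta dart_arc0 xa xb mulr0 addr0.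
have Qd : 0 < Q del by rewrite -Q0; apply: Q_lt; clear -del0; lra.
have QE tau : Q tau = xi tau ^+ 2 + eta tau ^+ 2 by rewrite /Q !expr2.
pose h r := atan (eta (th (r ^+ 2)) / xi (th (r ^+ 2))).
have arcE tau : 0 < tau < del -> let r := Num.sqrt (Q tau) in
    xi tau = r * cos (h r) /\ eta tau = r * sin (h r).
  move=> td /=; have Q1 : 0 < Q tau by rewrite -Q0; apply: Q_lt; clear -td; lra.
  have xi0 : 0 < xi tau by apply: qa; lra.
  rewrite /h sqr_sqrtr ?(ltW Q1)// thK ?QE; first exact: polar_atan.
  by lra.
have timeE z : 0 < z < Num.sqrt (Q del) ->
    [/\ 0 < th (z ^+ 2) < del, Q (th (z ^+ 2)) = z ^+ 2 & Num.sqrt (Q (th (z ^+ 2))) = z].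
  move=> /andP[z1 z2].
  have z2Q : 0 < z ^+ 2 < Q del.
    rewrite exprn_gt0//= -[ltRHS]sqr_sqrtr ?(ltW Qd)//.
    by rewrite ltr_pXn2r// nnegrE ?sqrtr_ge0// ltW.
  have [tQ QtQ] := Qth (z ^+ 2) ltac:(lra).
  have n0 : th (z ^+ 2) != 0.
    by apply/eqP => e1; move: QtQ; rewrite e1; clear -Q0 z2Q; lra.
  have nd : th (z ^+ 2) != del.
    by apply/eqP => e1; move: QtQ; rewrite e1; clear -z2Q; lra.
  by split; [clear -tQ n0 nd; lra|exact: QtQ|rewrite QtQ sqrtr_sqr gtr0_norm].
exists (Num.sqrt (Q del)), h; split.
- by rewrite sqrtr_gt0.
- exact: out.
- by move=> tau td; rewrite -QE -Q0; apply: Q_lt; clear -td; lra.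
- by move=> tau td; rewrite -QE; exact: arcE.
- move=> z zz; have [td Qt st] := timeE z zz; exists (th (z ^+ 2)) => //.
  have := arcE _ td; rewrite st => -[h1 h2]; split=> //.
  by apply: p4; clear -td dele ed4; lra.
- move=> z zz; have [td Qt st] := timeE z zz.
  have xi0 : 0 < xi (th (z ^+ 2)) by apply: qa; clear -td; lra.
  split.
  + apply: continuous_comp; last exact: continuous_atan.
    have cth : {for z, continuous (fun y : R => th (y ^+ 2))}.
      apply: (@continuous_comp _ _ _ (fun y : R => y ^+ 2) th); first exact: exprn_continuous.
      by rewrite -Qt; exact: dth.
    have t01' : 0 <= th (z ^+ 2) <= 1 by apply: t01; clear -td; lra.
    apply: continuousM.
      exact: (continuous_comp cth (is_derive_continuous (cf b _ t01'))).
    apply: continuousV; first by rewrite gt_eqF.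
    exact: (continuous_comp cth (is_derive_continuous (cf a _ t01'))).
  + apply: lt_le_trans k'kap; have := qb (th (z ^+ 2)) ltac:(clear -td; lra).
    rewrite -/(xi _) -/(eta _) => hb; rewrite ltr_norml -atanN /h.
    by apply/andP; split; apply: lt_atan; rewrite ?ltr_pdivlMr ?ltr_pdivrMr//; clear -hb; lra.
Qed.

End DartPolar.

(** * Angles in the tangent plane and polar coordinates *)

Section Angles.
Variable R : realType.
Implicit Types (X Y r theta : R) (x y a b : 'rV[R]_3).

Lemma angle_inj (s t : R) : cos s = cos t -> sin s = sin t -> `|s - t| < 2 * pi -> s = t.
Proof.
move=> cst sst st.
wlog : s t cst sst st / t <= s => [hw|ts].
  have [|/ltW] := leP t s; first exact: hw.
  by move=> st'; apply/esym/hw => //; rewrite distrC.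
have c1 : cos (s - t) = 1.
  by rewrite cosB cst sst -!expr2 cos2Dsin2.
have p0 := pi_gt0 R.
rewrite ger0_norm in st; last by lra.
have [h|h] := leP (s - t) pi.
  have := @cos_inj R (s - t) 0; rewrite !in_itv /= cos0 c1 => /(_ _ _ erefl) h0.
  suff : s - t = 0 by lra.
  by apply: h0; lra.
have c2 : cos (2 * pi - (s - t)) = 1.
  by rewrite cosB mulr_natl cos2pi sin2pi c1; ring.
have := @cos_inj R (2 * pi - (s - t)) 0; rewrite !in_itv /= cos0 c2 => /(_ _ _ erefl) h0.
suff : 2 * pi - (s - t) = 0 by lra.
by apply: h0; lra.
Qed.

(** Turning back by [theta] reduces to angles in [0, 2 pi), where [acos] or 2 pi minus [acos] serves
    according to the sign of the sine. *)
Lemma circle_angle X Y theta : X ^+ 2 + Y ^+ 2 = 1 ->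
  exists2 t, theta <= t < theta + 2 * pi & X = cos t /\ Y = sin t.
Proof.
move=> XY1; have p0 := pi_gt0 R.
pose X' := X * cos theta + Y * sin theta; pose Y' := Y * cos theta - X * sin theta.
have cs := cos2Dsin2 theta.
have XE : X = X' * cos theta - Y' * sin theta.
  rewrite -[LHS]mulr1 -cs /X' /Y'; ring.
have YE : Y = X' * sin theta + Y' * cos theta.
  rewrite -[LHS]mulr1 -cs /X' /Y'; ring.
have XY' : X' ^+ 2 + Y' ^+ 2 = 1.
  by rewrite -[RHS]mulr1 -{1}XY1 -cs /X' /Y'; ring.
have X'1 : -1 <= X' <= 1 by have := sqr_ge0 Y'; nra.
suff [t t0 [Xt Yt]] : exists2 t, 0 <= t < 2 * pi & X' = cos t /\ Y' = sin t.
  exists (theta + t); first by lra.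
  by rewrite cosD sinD -Xt -Yt {1}XE {1}YE; split; ring.
have sq : Num.sqrt (1 - X' ^+ 2) = `|Y'|.
  by rewrite -sqrtr_sqr -XY' addrC addKr.
have [Y0|Y0] := leP 0 Y'.
  exists (acos X'); first by have := acos_ge0 X'1; have := acos_lepi X'1; lra.
  by rewrite acosK ?in_itv//= sin_acos// sq ger0_norm.
exists (2 * pi - acos X').
  have a0 : 0 < acos X'.
    apply: acos_gt0; have X1 : X' != 1 by apply/eqP => h; move: XY'; rewrite h; nra.
    by have /andP[-> ?] := X'1; rewrite lt_neqAle X1.
  by have := acos_lepi X'1; lra.
rewrite cosB sinB mulr_natl cos2pi sin2pi acosK ?in_itv//= sin_acos// sq.
by rewrite ltr0_norm//; split; ring.
Qed.

Definition rad a b y : R := Num.sqrt (dotv y a ^+ 2 + dotv y b ^+ 2).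

Definition polar a b y theta : Prop :=
  dotv y a = rad a b y * cos theta /\ dotv y b = rad a b y * sin theta.

Lemma polar_exists a b y theta : exists2 t, theta <= t < theta + 2 * pi & polar a b y t.
Proof.
have [r0|r0] := eqVneq (rad a b y) 0.
  exists theta; first by have := pi_gt0 R; lra.
  have : dotv y a ^+ 2 + dotv y b ^+ 2 <= 0 by rewrite -sqrtr_eq0 -/(rad a b y) r0.
  by rewrite /polar r0 !mul0r => ?; split; nra.
have rr : rad a b y ^+ 2 = dotv y a ^+ 2 + dotv y b ^+ 2.
  by rewrite sqr_sqrtr// addr_ge0// sqr_ge0.
have [|t tt [ht1 ht2]] := @circle_angle (dotv y a / rad a b y) (dotv y b / rad a b y) theta.
  by rewrite !expr_div_n -mulrDl -rr mulfV// expf_neq0.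
by exists t => //; rewrite /polar -ht1 -ht2; split; field.
Qed.

Lemma polar_inj a b y (s t : R) : 0 < rad a b y -> polar a b y s -> polar a b y t ->
  `|s - t| < 2 * pi -> s = t.
Proof.
move=> r0 [s1 s2] [t1 t2]; have rn : rad a b y != 0 by rewrite gt_eqF.
by apply: angle_inj; apply: (mulfI rn); rewrite -?s1 -?s2.
Qed.

Lemma polar_shift a b y (s : R) : polar a b y s -> polar a b y (s + 2 * pi).
Proof. by rewrite /polar mulr_natl cosD2pi sinD2pi. Qed.

Lemma rad_continuous a b : continuous (rad a b).
Proof.
move=> y; apply: (@continuous_comp _ _ _
  (fun y => dotv y a ^+ 2 + dotv y b ^+ 2) Num.sqrt); last exact: sqrt_continuous.
have ca := @continuous_dotv _ a y; have cb := @continuous_dotv _ b y.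
exact: (cvgD (cvgM ca ca) (cvgM cb cb)).
Qed.

(** A continuous branch of the angle: in the axes turned by [theta] the projection of [y] lies on
    the positive half-axis, near which the angle is [atan] of the slope. *)
Lemma polar_near a b y theta : 0 < rad a b y -> polar a b y theta ->
  exists Theta : 'rV[R]_3 -> R, [/\ {for y, continuous Theta}, Theta y = theta
    & \forall z \near y, polar a b z (Theta z)].
Proof.
move=> r0 [py1 py2]; have cs := cos2Dsin2 theta.
pose X z := dotv z (cos theta *: a + sin theta *: b).
pose Y z := dotv z (cos theta *: b - sin theta *: a).
have XE z : X z = dotv z a * cos theta + dotv z b * sin theta.
  by rewrite /X !dotvE !mxE; ring.
have YE z : Y z = dotv z b * cos theta - dotv z a * sin theta.
  by rewrite /Y !dotvE !mxE; ring.
have Xy : X y = rad a b y.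
  by rewrite XE {1}py1 {1}py2 -[RHS]mulr1 -cs; ring.
have Yy : Y y = 0 by rewrite YE {1}py1 {1}py2; ring.
have X0 : 0 < X y by rewrite Xy.
exists (fun z => theta + atan (Y z / X z)); split.
- suff c : {for y, continuous (fun z => atan (Y z / X z))} by exact: cvgD (cvg_cst theta) c.
  apply: (@continuous_comp _ _ _ (fun z => Y z / X z)); last exact: continuous_atan.
  have cX := @continuous_dotv _ (cos theta *: a + sin theta *: b) y.
  have cY := @continuous_dotv _ (cos theta *: b - sin theta *: a) y.
  by apply: (continuousM cY); apply: continuousV; [rewrite gt_eqF|exact: cX].
- by rewrite Yy mul0r atan0 addr0.
- have nX : \forall z \near y, 0 < X z.
    exact: (cvgr_gt _ (@continuous_dotv _ (cos theta *: a + sin theta *: b) y)).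
  apply: filterS nX => z Xz.
  have radE : rad a b z = Num.sqrt (X z ^+ 2 + Y z ^+ 2).
    by congr Num.sqrt; rewrite XE YE -[LHS]mulr1 -cs; ring.
  have [] := polar_atan (Y z) Xz; rewrite /polar cosD sinD radE.
  move: (Num.sqrt _) (cos (atan _)) (sin (atan _)) => q c s hX hY.
  split.
  - transitivity (cos theta * X z - sin theta * Y z).
      by rewrite XE YE -[LHS]mulr1 -cs; ring.
    by rewrite hX hY; ring.
  - transitivity (sin theta * X z + cos theta * Y z).
      by rewrite XE YE -[LHS]mulr1 -cs; ring.
    by rewrite hX hY; ring.
Qed.

Lemma frame_rotate x a b theta : frame x a b ->
  frame x (cos theta *: a + sin theta *: b) (cos theta *: b - sin theta *: a).
Proof.
move=> fr; have [xx aa bb xa xb ab d1] := fr.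
have cs := cos2Dsin2 theta.
set u := cos theta *: a + _; set w := cos theta *: b - _.
have [ua ub ux] : [/\ dotv u a = cos theta, dotv u b = sin theta & dotv u x = 0].
  by rewrite !dotvDl !dotvZl aa bb (dotvC b) ab (dotvC a x) (dotvC b x) xa xb; split; ring.
have [wa wb wx] : [/\ dotv w a = - sin theta, dotv w b = cos theta & dotv w x = 0].
  by rewrite !dotvBl !dotvZl aa bb (dotvC b) ab (dotvC a x) (dotvC b x) xa xb; split; ring.
apply: frame_of_orthonormal => //.
- by rewrite (frame_dotv _ _ fr) ua ub ux -cs; ring.
- by rewrite (frame_dotv _ _ fr) wa wb wx -cs; ring.
- by rewrite dotvC.
- by rewrite dotvC.
- by rewrite (frame_dotv _ _ fr) ua ub ux wa wb wx; ring.
- rewrite (frame_det3 _ _ fr) ua ub wa wb mulrN opprK -!expr2 cs.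
  exact: ltr01.
Qed.

Variable G : plane_graph R.

(** This is [dart_polar] transported to a frame common to all half-edges at a vertex: [theta] is the
    direction in which the edge leaves, and [T] stands for [theta] plus the former [h]. *)
Record dart_angle (al : dart G) (x a b : 'rV[R]_3) (theta kap del rmax : R)
    (T : R -> R) : Prop := {
  da_rmax : 0 < rmax;
  da_out : forall tau, 0 < tau < del ->
    0 < dotv (dart_arc al tau) a * dotv (dart_out al tau) a
      + dotv (dart_arc al tau) b * dotv (dart_out al tau) b;
  da_arc : forall tau, 0 < tau < del -> 0 < rad a b (dart_arc al tau) /\
    polar a b (dart_arc al tau) (T (rad a b (dart_arc al tau)));
  da_time : forall r, 0 < r < rmax -> exists2 tau, 0 < tau < del &
    [/\ 0 < dotv (dart_arc al tau) x, dotv (dart_arc al tau) a = r * cos (T r)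
      & dotv (dart_arc al tau) b = r * sin (T r)];
  da_cont : forall r, 0 < r < rmax -> {for r, continuous T} /\ `|T r - theta| < kap }.

Lemma dart_angleP (al : dart G) a b (r theta kap : R) :
  frame (pos (head al)) a b -> 0 < r -> 0 < kap ->
  out_direction al = r *: (cos theta *: a + sin theta *: b) ->
  exists2 del0, 0 < del0 & forall del, 0 < del <= del0 ->
    exists rmax T, dart_angle al (pos (head al)) a b theta kap del rmax T.
Proof.
move=> fr r0 kap0 oE; have cs := cos2Dsin2 theta.
have [del0 del00 dP] := dart_polarP (frame_rotate theta fr) r0 oE kap0.
exists del0; first exact: del00.
move=> del /dP[rmax [h [h1 h2 h3 h4 h5 h6]]].
have la z : dotv z (cos theta *: a + sin theta *: b)
    = cos theta * dotv z a + sin theta * dotv z b by rewrite !dotvE !mxE; ring.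
have lb z : dotv z (cos theta *: b - sin theta *: a)
    = cos theta * dotv z b - sin theta * dotv z a by rewrite !dotvE !mxE; ring.
have sqE z : dotv z (cos theta *: a + sin theta *: b) ^+ 2
    + dotv z (cos theta *: b - sin theta *: a) ^+ 2 = dotv z a ^+ 2 + dotv z b ^+ 2.
  by rewrite la lb -[RHS]mulr1 -cs; ring.
have rot z (s : R) (q : R) : dotv z (cos theta *: a + sin theta *: b) = q * cos s ->
    dotv z (cos theta *: b - sin theta *: a) = q * sin s ->
    dotv z a = q * cos (theta + s) /\ dotv z b = q * sin (theta + s).
  rewrite la lb cosD sinD => e1 e2.
  rewrite mulrBr mulrDr !(mulrCA q) -e1 -e2.
  by split; rewrite -[LHS]mulr1 -cs; ring.
exists rmax, (fun r => theta + h r); split.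
- exact: h1.
- move=> tau /h2; rewrite !la !lb; set p := dotv _ a; set q := dotv _ b.
  set p' := dotv (dart_out _ _) a; set q' := dotv (dart_out _ _) b.
  by rewrite (_ : _ + _ = (p * p' + q * q') * (cos theta ^+ 2 + sin theta ^+ 2));
    [rewrite cs mulr1|ring].
- move=> tau td; split; first by rewrite sqrtr_gt0 -sqE; exact: h3.
  by have [] := h4 _ td; rewrite sqE => e1 e2; apply: rot.
- by move=> q /h5[tau td [c1 c2 c3]]; exists tau => //; have [] := rot _ _ _ c2 c3.
- move=> q /h6[c1 c2]; split; last by rewrite addrC addKr.
  exact: cvgD (cvg_cst theta) c1.
Qed.

End Angles.

Lemma locally_constant_path (R : realType) (X : topologicalType) (K : Type)
    (k : X -> K) (A : set X) (c : R -> X) (a b : R) : a <= b ->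
  {within `[a, b], continuous c} -> (forall t, a <= t <= b -> A (c t)) ->
  (forall x, A x -> nbhs x [set y | A y -> k y = k x]) -> k (c a) = k (c b).
Proof.
move=> ab /within_continuousP cc Ac kA.
apply: (@cousin R (fun x y => k (c x) = k (c y)) a b ab) => [x y z _ _ _ _ -> //|t tab].
have tab' : `[a, b]%classic t by rewrite /= in_itv.
exists [set u | `[a, b]%classic u -> A (c u) -> k (c u) = k (c t)].
  exact: (cc t tab' _ (kA _ (Ac t tab))).
move=> x y ax xt ty yb nb; transitivity (k (c t)).
  by apply: nb; [lra|rewrite /= in_itv /=; lra|apply: Ac; lra].
by apply/esym/nb; [lra|rewrite /= in_itv /=; lra|apply: Ac; lra].
Qed.

Lemma within_pointwise (R : realType) (X : topologicalType) (c : R -> X) (a b : R) :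
  (forall t, a <= t <= b -> {for t, continuous c}) -> {within `[a, b], continuous c}.
Proof.
by move=> cc; apply: continuous_in_subspaceT => t; rewrite inE /= in_itv; exact: cc.
Qed.

(** * The cyclic order of the three half-edges at a vertex *)

Section StarAngles.
Variables (R : realType) (G : plane_graph R) (v : vertex G) (star : 'I_3 -> dart G).
Variables (a b : 'rV[R]_3) (th rr : 'I_3 -> R).
Hypothesis head_star : forall i, head (star i) = v.
Hypothesis fr : frame (pos v) a b.
Hypothesis rr0 : forall i, 0 < rr i.
Hypothesis outE : forall i,
  out_direction (star i) = rr i *: (cos (th i) *: a + sin (th i) *: b).
Hypothesis th_lt : [/\ th 0 < th 1, th 1 < th 2 & th 2 < th 0 + 2 * pi].

Lemma dart_angle_le al x theta kap del rmax rmax' T : 0 < rmax' <= rmax ->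
  dart_angle (G := G) al x a b theta kap del rmax T ->
  dart_angle al x a b theta kap del rmax' T.
Proof.
move=> /andP[r0 rr'] [h1 h2 h3 h4 h5]; split=> //.
- by move=> r /andP[r1 r2]; apply: h4; rewrite r1 (lt_le_trans r2).
- by move=> r /andP[r1 r2]; apply: h5; rewrite r1 (lt_le_trans r2).
Qed.

(** The bound 1/4 on [del] keeps the two end pieces of an edge disjoint when both its ends are at
    [v]. *)
Lemma star_angles : exists (del rmax : R) (T : 'I_3 -> R -> R),
  [/\ 0 < del <= 4^-1,
      forall i, exists kap, dart_angle (star i) (pos v) a b (th i) kap del rmax (T i)
    & forall r, 0 < r < rmax -> [/\ T 0 r < T 1 r, T 1 r < T 2 r & T 2 r < T 0 r + 2 * pi]].
Proof.
have [t01 t12 t20] := th_lt.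
(* Deviations below half of every angular gap leave the order of the half-edges unchanged at each
   radius. *)
have [||||kap [kap0 k1 k2 k3 _]] := @exists_lt4 R ((th 1 - th 0) / 2) ((th 2 - th 1) / 2)
  ((th 0 + 2 * pi - th 2) / 2) 1; try lra.
have D i : exists2 del0, 0 < del0 & forall del, 0 < del <= del0 ->
    exists rmax T, dart_angle (star i) (pos v) a b (th i) kap del rmax T.
  by rewrite -(head_star i); apply: dart_angleP (rr0 i) kap0 (outE i); rewrite head_star.
have [d0 d00 P0] := D 0; have [d1 d10 P1] := D 1; have [d2 d20 P2] := D 2.
have [|del [del0 dd0 dd1 dd2 dd3]] := @exists_lt4 R d0 d1 d2 4^-1 d00 d10 d20; first by lra.
have [r0 [T0 A0]] := P0 del ltac:(lra).
have [r1 [T1 A1]] := P1 del ltac:(lra).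
have [r2 [T2 A2]] := P2 del ltac:(lra).
have [r [rpos rr0' rr1 rr2 _]] :=
  exists_lt4 (da_rmax A0) (da_rmax A1) (da_rmax A2) (da_rmax A2).
have {}A0 : dart_angle (star 0) (pos v) a b (th 0) kap del r T0.
  by apply: dart_angle_le A0; lra.
have {}A1 : dart_angle (star 1) (pos v) a b (th 1) kap del r T1.
  by apply: dart_angle_le A1; lra.
have {}A2 : dart_angle (star 2) (pos v) a b (th 2) kap del r T2.
  by apply: dart_angle_le A2; lra.
exists del, r, (fun i => nth T0 [:: T0; T1; T2] i); split.
- by lra.
- move=> i; exists kap; case: i => -[|[|[|//]]] ilt; rewrite [nth _ _ _]/=.
  + by rewrite (_ : Ordinal ilt = 0)//; apply: val_inj.
  + by rewrite (_ : Ordinal ilt = 1)//; apply: val_inj.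
  + by rewrite (_ : Ordinal ilt = 2)//; apply: val_inj.
- move=> s sr /=; have [_ h0] := da_cont A0 sr; have [_ h1] := da_cont A1 sr.
  have [_ h2] := da_cont A2 sr; move: h0 h1 h2; rewrite !ltr_norml => ? ? ?.
  by split; lra.
Qed.

End StarAngles.

(** * Sectors between consecutive half-edges *)

Section Sectors.
Variables (R : realType) (a b : 'rV[R]_3) (T : 'I_3 -> R -> R) (rmax : R).
Implicit Types (y z : 'rV[R]_3) (i j : 'I_3).
Hypothesis T_lt : forall r, 0 < r < rmax ->
  [/\ T 0 r < T 1 r, T 1 r < T 2 r & T 2 r < T 0 r + 2 * pi].
Hypothesis T_cont : forall i r, 0 < r < rmax -> {for r, continuous (T i)}.

(* Sector [i] lies between the half-edges [i] and [i + 1], with [3 = 0]. *)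
Definition sector_end i r : R := if i == 2 then T 0 r + 2 * pi else T (i + 1) r.

Definition in_sector i y : Prop :=
  exists2 t, T i (rad a b y) < t < sector_end i (rad a b y) & polar a b y t.

Lemma ord3P (P : 'I_3 -> Prop) : P 0 -> P 1 -> P 2 -> forall i, P i.
Proof.
move=> P0 P1 P2; case=> -[|[|[|//]]] ilt.
- by rewrite (_ : Ordinal ilt = 0)//; apply: val_inj.
- by rewrite (_ : Ordinal ilt = 1)//; apply: val_inj.
- by rewrite (_ : Ordinal ilt = 2)//; apply: val_inj.
Qed.

Let add01 : 0 + 1 = 1 :> 'I_3. Proof. exact: val_inj. Qed.
Let add11 : 1 + 1 = 2 :> 'I_3. Proof. exact: val_inj. Qed.

Lemma in_sector_inj i j y : 0 < rad a b y < rmax -> in_sector i y -> in_sector j y -> i = j.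
Proof.
move=> ry [s si ps] [t tj pt]; have [T01 T12 T20] := T_lt ry.
have st : s = t.
  apply: polar_inj ps pt _; first by case/andP: ry.
  move: si tj; rewrite ltr_norml /sector_end.
  by move: i j; apply: ord3P; apply: ord3P; rewrite ?add01 ?add11 /= => ? ?; lra.
move: si tj; rewrite st /sector_end.
by move: i j; apply: ord3P; apply: ord3P; rewrite ?add01 ?add11 //= => ? ?; exfalso; lra.
Qed.

Lemma in_sector_exists y : 0 < rad a b y < rmax ->
  (exists i, in_sector i y) \/ (exists i, polar a b y (T i (rad a b y))).
Proof.
move=> ry; have [T01 T12 T20] := T_lt ry.
have [t tt pt] := @polar_exists R a b y (T 0 (rad a b y)).
have [e0|n0] := eqVneq t (T 0 (rad a b y)); first by right; exists 0; rewrite -e0.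
have [e1|n1] := eqVneq t (T 1 (rad a b y)); first by right; exists 1; rewrite -e1.
have [e2|n2] := eqVneq t (T 2 (rad a b y)); first by right; exists 2; rewrite -e2.
left; have [t1|t1] := ltP t (T 1 (rad a b y)).
  by exists 0, t => //; rewrite /sector_end /= add01; lra.
have [t2|t2] := ltP t (T 2 (rad a b y)).
  by exists 1, t => //; rewrite /sector_end /= add11; lra.
by exists 2, t => //; rewrite /sector_end /=; lra.
Qed.

Lemma in_sector_near i y : 0 < rad a b y < rmax -> in_sector i y ->
  \forall z \near y, in_sector i z.
Proof.
move=> ry [t /andP[t1 t2] pt]; have [r0 _] := andP ry.
have [Th [cTh Thy nTh]] := polar_near r0 pt.
have cT j : {for y, continuous (fun z => T j (rad a b z))}.
  by apply: (@continuous_comp _ _ _ (rad a b) (T j)); [exact: rad_continuous|exact: T_cont].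
have cE : {for y, continuous (fun z => sector_end i (rad a b z))}.
  rewrite /sector_end; case: (i == 2); last exact: cT.
  have c2 : {for y, continuous (fun _ : 'rV[R]_3 => 2 * pi : R)}.
    exact: cst_continuous.
  exact: (continuousD (cT 0) c2).
have n1 : \forall z \near y, 0 < Th z - T i (rad a b z).
  have := cvgr_gt _ (cvgB cTh (cT i)); apply.
  by rewrite Thy subr_gt0.
have n2 : \forall z \near y, 0 < sector_end i (rad a b z) - Th z.
  have := cvgr_gt _ (cvgB cE cTh); apply.
  by rewrite Thy subr_gt0.
by apply: filterS3 nTh n1 n2 => z pz z1 z2; exists (Th z) => //; lra.
Qed.

(** The value 2 is also the default where no sector contains [y]. *)
Definition sector y : 'I_3 :=
  if `[< in_sector 0 y >] then 0 else if `[< in_sector 1 y >] then 1 else 2.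

Lemma sectorP i y : 0 < rad a b y < rmax -> in_sector i y -> sector y = i.
Proof.
move=> ry iy; have inj j := in_sector_inj (j := j) ry iy; rewrite /sector.
case: asboolP => [/inj|n0] //; case: asboolP => [/inj|n1] //.
by move: i iy n0 n1 {inj}; apply: ord3P.
Qed.

End Sectors.

Section VertexSectors.
Variables (R : realType) (G : plane_graph R).

(** [k] numbers the sectors around [v]; half-edge [i] lies between the sectors [i - 1] and [i],
    indices modulo 3. As a dart of [star] points towards [v], a crossing direction that forms a
    positive frame with its velocity is counterclockwise. *)
Record vertex_sectors (v : vertex G) (star : 'I_3 -> dart G) (W : set 'rV[R]_3)
    (k : 'rV[R]_3 -> 'I_3) : Prop := {
  vs_open : open W;
  vs_pos : W (pos v);
  vs_vertex : forall y, W y -> vertex_set G y -> y = pos v;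
  vs_const : forall y, W y -> sphere y -> ~ graph_set G y ->
    nbhs y [set z | sphere z -> k z = k y];
  vs_jump : forall (c : R -> 'rV[R]_3) (t : R) e u d, (\forall z \near t, sphere (c z)) ->
    W (c t) -> crosses c t e u d ->
    exists2 i, (star i).1 = e & exists2 r, 0 < r & forall z,
      let pos_cross := 0 < det3 (c t) d (dart_velocity (star i) u) in
      (t - r < z < t -> k (c z) = if pos_cross then i - 1 else i) /\
      (t < z < t + r -> k (c z) = if pos_cross then i else i - 1) }.

(** Points on the same side of the edge are joined inside the chart without meeting the graph, so a
    locally constant function cannot distinguish them. *)
Lemma two_sided_const (K : Type) (k : 'rV[R]_3 -> K) e W W1 zeta :
  (forall y, W y -> sphere y -> ~ graph_set G y -> nbhs y [set z | sphere z -> k z = k y]) ->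
  two_sided (G := G) e W1 zeta -> (forall y, W1 y -> sphere y -> W y) ->
  forall y z, W1 y -> W1 z -> sphere y -> sphere z -> 0 < zeta y * zeta z -> k y = k z.
Proof.
move=> kc ts WW y z Wy Wz sy sz yz0.
have [c [c0 c1 cP]] := ts_join ts Wy Wz sy sz yz0.
rewrite -c0 -c1; apply: (@locally_constant_path _ _ _ k
  [set x | [/\ W1 x, sphere x & ~ graph_set G x]] c 0 1) => //.
- by apply: within_pointwise => t t01; have [] := cP t t01.
- move=> t t01 /=; have [_ Wt st ct0] := cP t t01; split=> // /(ts_graph ts Wt st) z0.
  by move: ct0; rewrite z0 mulr0 ltxx.
- move=> x [Wx sx gx]; apply: filterS (kc x (WW x Wx sx) sx gx) => w kw [_ sw _].
  exact: kw.
Qed.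

(** The circle of latitude around [x] will be the test curve at a crossing: the sectors that it
    visits are known from its angle. *)
Lemma circle_curve (x a b : 'rV[R]_3) (rho theta : R) : frame x a b -> 0 < rho < 1 ->
  let C z := sphere_param x a b (rho * cos (theta + z)) (rho * sin (theta + z)) in
  [/\ forall z, [/\ sphere (C z), 0 < dotv (C z) x, rad a b (C z) = rho
        & polar a b (C z) (theta + z)],
      is_derive (0 : R) 1 C (rho * cos theta *: b - rho * sin theta *: a)
    & dotv x (C 0) = Num.sqrt (1 - rho ^+ 2)].
Proof.
move=> fr /andP[r0 r1] C.
have r2 : rho ^+ 2 < 1 by rewrite expr2; nra.
have sq z : (rho * cos (theta + z)) ^+ 2 + (rho * sin (theta + z)) ^+ 2 = rho ^+ 2.
  by rewrite !exprMn -mulrDr cos2Dsin2 mulr1.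
have sq' z : 1 - (rho * cos (theta + z)) ^+ 2 - (rho * sin (theta + z)) ^+ 2 = 1 - rho ^+ 2.
  by rewrite -(sq z); ring.
have radC z : rad a b (C z) = rho.
  by rewrite /rad sphere_param_a// sphere_param_b// sq sqrtr_sqr gtr0_norm.
split; last by rewrite dotvC sphere_param_x// sq'.
- move=> z; split=> //.
  + by apply: sphere_param_sphere => //; rewrite sq ltW.
  + by rewrite sphere_param_x// sq' sqrtr_gt0 subr_gt0.
  + by rewrite /polar radC sphere_param_a// sphere_param_b.
have dz : is_derive (0 : R) 1 (fun z => theta + z) 1.
  apply: is_derive_eq (is_derive_add (is_derive_cst theta (0 : R) 1) (is_derive_id (0 : R) 1)) _.
  by rewrite add0r.
have dcos : is_derive (0 : R) 1 (fun z => cos (theta + z)) (- sin theta).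
  have := @is_derive1_comp R cos (fun z => theta + z) 0 _ _ (is_derive_cos _) dz.
  by rewrite addr0 mulr1.
have dsin : is_derive (0 : R) 1 (fun z => sin (theta + z)) (cos theta).
  have := @is_derive1_comp R sin (fun z => theta + z) 0 _ _ (is_derive_sin _) dz.
  by rewrite addr0 mulr1.
apply/is_derive_mxP => i j.
have h := is_derive_add (is_derive_add
  (is_derive_mul dcos (is_derive_cst (rho * a i j) (0 : R) 1))
  (is_derive_mul dsin (is_derive_cst (rho * b i j) (0 : R) 1)))
  (is_derive_cst (Num.sqrt (1 - rho ^+ 2) * x i j) (0 : R) 1).
rewrite (_ : (fun _ => _) = (fun z => cos (theta + z) * (rho * a i j)
  + sin (theta + z) * (rho * b i j) + Num.sqrt (1 - rho ^+ 2) * x i j)).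
  by apply: is_derive_eq h _; rewrite !mxE addr0 /=; ring.
by apply/funext => z; rewrite /C /sphere_param !mxE sq'; ring.
Qed.

Section Star.
Variables (v : vertex G) (star : 'I_3 -> dart G) (a b : 'rV[R]_3).
Variables (del rmax : R) (T : 'I_3 -> R -> R) (th : 'I_3 -> R).
Hypothesis star_head : forall al, head al = v -> exists i, star i = al.
Hypothesis fr : frame (pos v) a b.
Hypothesis del0 : 0 < del <= 4^-1.
Hypothesis angles : forall i, exists kap,
  dart_angle (star i) (pos v) a b (th i) kap del rmax (T i).
Hypothesis T_lt : forall r, 0 < r < rmax ->
  [/\ T 0 r < T 1 r, T 1 r < T 2 r & T 2 r < T 0 r + 2 * pi].

Let T_cont i r : 0 < r < rmax -> {for r, continuous (T i)}.
Proof. by have [kap A] := angles i => /(da_cont A) []. Qed.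

Lemma star_graph_near : exists2 eps, 0 < eps <= rmax &
  forall y, sphere y -> 0 < dotv y (pos v) -> rad a b y < eps -> graph_set G y ->
    y = pos v \/ exists i tau, 0 < tau < del /\ y = dart_arc (star i) tau.
Proof.
have d0 := del0; have rmax0 : 0 < rmax by have [kap A] := angles 0; exact: da_rmax A.
(* End pieces of length [del] are cut off at each end that lies at [v], at both ends for a loop. *)
pose S e : set R := `[if source e == v then del else 0,
                      if target e == v then 1 - del else 1]%classic.
pose K := (@pos R G) @` [set w | w != v] `|` \bigcup_(e in setT) (arc e @` S e).
have S01 e t : S e t -> 0 <= t <= 1.
  rewrite /S /= in_itv /=; case: (source e == v); case: (target e == v); lra.
have Kc : closed K.
  by apply: graph_part_closed => // e; exact: segment_compact.
have Kx : ~ K (pos v).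
  case=> [[w /= wv /pos_inj wE]|[e _ [t St te]]]; first by rewrite wE eqxx in wv.
  have t01 := S01 e t St.
  have [t0|t0] := eqVneq t 0.
    move: te St; rewrite t0 arc0 => /pos_inj sv.
    by rewrite /S /= in_itv /= sv eqxx; lra.
  have [t1|t1] := eqVneq t 1.
    move: te St; rewrite t1 arc1 => /pos_inj sv.
    by rewrite /S /= in_itv /= sv eqxx; lra.
  by apply: (@arc_vertex R G e t v _ te); lra.
have graphK y : graph_set G y -> ~ K y ->
    y = pos v \/ exists i tau, 0 < tau < del /\ y = dart_arc (star i) tau.
  case=> [[w _ wy]|[e _ [t]]] => [nK|].
    have [wv|wv] := eqVneq w v; first by left; rewrite -wy wv.
    by case: nK; left; exists w.
  rewrite /= in_itv /= => t01 ty nK.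
  have nS : ~ S e t by move=> St; apply: nK; right; exists e => //; exists t.
  have [sv|sv] := eqVneq (source e) v; last first.
    have [tv|tv] := eqVneq (target e) v; last first.
      by case: nS; rewrite /S (negbTE sv) (negbTE tv) /= in_itv.
    have td : 1 - del < t.
      rewrite ltNge; apply/negP => td; apply: nS.
      by rewrite /S (negbTE sv) tv eqxx /= in_itv /=; lra.
    have [t1|t1] := eqVneq t 1; first by left; rewrite -ty t1 arc1 tv.
    have [i iE] := star_head (al := (e, true)) tv.
    right; exists i, (1 - t); split; first by lra.
    by rewrite iE /dart_arc /dart_time /= subKr ty.
  have [td|td] := ltP t del.
    have [t0|t0] := eqVneq t 0; first by left; rewrite -ty t0 arc0 sv.
    have [i iE] := star_head (al := (e, false)) sv.
    right; exists i, t; split; first by lra.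
    by rewrite iE /dart_arc /dart_time /= ty.
  have [tv|tv] := eqVneq (target e) v; last first.
    by case: nS; rewrite /S sv eqxx (negbTE tv) /= in_itv /=; lra.
  have td' : 1 - del < t.
    rewrite ltNge; apply/negP => td'; apply: nS.
    by rewrite /S sv tv !eqxx /= in_itv /=; lra.
  have [t1|t1] := eqVneq t 1; first by left; rewrite -ty t1 arc1 tv.
  have [i iE] := star_head (al := (e, true)) tv.
  right; exists i, (1 - t); split; first by lra.
  by rewrite iE /dart_arc /dart_time /= subKr ty.
have [rho rho0 rhoP] : exists2 rho : R, 0 < rho &
    forall X Y, `|X| < rho -> `|Y| < rho -> (~` K) (sphere_param (pos v) a b X Y).
  have cp : {for (0, 0), continuous
      (fun z : R * R => sphere_param (pos v) a b z.1 z.2)}.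
    by apply: sphere_param_continuous; [exact: cvg_fst|exact: cvg_snd].
  have Ox : nbhs (sphere_param (pos v) a b 0 0) (~` K).
    by rewrite sphere_param0; exact: nbhs_not_closed.
  have /nbhs_ballP[q /= q0 qP] := cp _ Ox.
  exists q => // X1 Y1 hX hY; apply: (qP (X1, Y1)).
  by split; rewrite /ball /= sub0r normrN.
exists (Num.min rho rmax); first by rewrite lt_min rho0 rmax0 ge_min lexx orbT.
move=> y sy yx; rewrite lt_min => /andP[yr _] gy; apply: graphK => //.
rewrite -(sphere_paramK fr sy yx).
have nr (z w : R) : Num.sqrt (z ^+ 2 + w ^+ 2) < rho -> `|z| < rho /\ `|w| < rho.
  move=> zw; split; apply: le_lt_trans zw; rewrite -sqrtr_sqr ler_wsqrtr//.
    by rewrite lerDl sqr_ge0.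
  by rewrite lerDr sqr_ge0.
by have [h1 h2] := nr _ _ yr; exact: rhoP.
Qed.

(** The full turn occurs only for the sector that precedes half-edge 0. *)
Lemma sector_before i r : exists2 s, s = T i r \/ s = T i r + 2 * pi
  & sector_end T (i - 1) r = s.
Proof.
move: i; apply: ord3P; rewrite /sector_end.
- rewrite (_ : 0 - 1 = 2 :> 'I_3); last exact: val_inj.
  by exists (T 0 r + 2 * pi); [right|].
- rewrite subrr /= add0r; by exists (T 1 r); [left|].
- rewrite (_ : 2 - 1 = 1 :> 'I_3); last exact: val_inj.
  rewrite (_ : 1 + 1 = 2 :> 'I_3); last exact: val_inj.
  by exists (T 2 r); [left|].
Qed.

Lemma sector_nonempty i r : 0 < r < rmax -> T i r < sector_end T i r.
Proof.
by move=> /T_lt[h0 h1 h2]; move: i; apply: ord3P; rewrite /sector_end /= ?add0r.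
Qed.

(** The jump is known for the circle of latitude through the crossing point. Any other curve
    crossing the edge there changes sides as well, by [ts_cross], in the same sense or the opposite
    one according to the signs of the two determinants; [two_sided_const] then carries the sector
    numbers over from the circle. *)
Lemma star_vertex_sectors : exists W, vertex_sectors v star W (sector a b T).
Proof.
have d0 := del0; have [xx aa bb xa xb ab d1] := fr.
have [eps /andP[eps0 epsr] near_graph] := star_graph_near.
have [||||eps' [eps'0 eps'1 eps'2 _ _]] := @exists_lt4 R eps 2^-1 1 1; try lra.
pose W := [set y | 0 < dotv y (pos v) /\ rad a b y < eps'].
have radr y : rad a b y < eps' -> 0 < rad a b y -> 0 < rad a b y < rmax.
  by move=> y1 y2; apply/andP; split=> //; lra.
have time01 i tau : 0 < tau < del -> 0 < dart_time (star i) tau < 1.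
  by rewrite /dart_time; case: (star i).2; lra.
have rad0 y : sphere y -> 0 < dotv y (pos v) -> y <> pos v -> 0 < rad a b y.
  move=> sy yx ny; rewrite lt_neqAle sqrtr_ge0 andbT eq_sym; apply/eqP => y0.
  have : dotv y a ^+ 2 + dotv y b ^+ 2 <= 0 by rewrite -sqrtr_eq0 -/(rad a b y) y0.
  move=> yab; apply: ny; rewrite -(sphere_paramK fr sy yx).
  have [-> ->] : dotv y a = 0 /\ dotv y b = 0 by split; nra.
  exact: sphere_param0.
have graphW y : W y -> sphere y -> graph_set G y ->
    y = pos v \/ exists i tau, 0 < tau < del /\ y = dart_arc (star i) tau.
  by move=> [y1 y2] sy; apply: near_graph => //; lra.
have Wopen : open W.
  rewrite openE => y [y1 y2]; rewrite /interior.
  have n1 : \forall z \near y, 0 < dotv z (pos v).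
    exact: (cvgr_gt _ (@continuous_dotv _ (pos v) y)).
  have n2 : \forall z \near y, rad a b z < eps'.
    exact: (cvgr_lt _ (@rad_continuous _ a b y)).
  by apply: filterS2 n1 n2 => z; split.
have nbW y : W y -> nbhs y W by move=> Wy; apply: open_nbhs_nbhs.
have kc y : W y -> sphere y -> ~ graph_set G y ->
    nbhs y [set z | sphere z -> sector a b T z = sector a b T y].
  move=> [y1 y2] sy ngy.
  have r0 : 0 < rad a b y.
    by apply: rad0 => // yv; apply: ngy; left; exists v.
  have rr := radr y y2 r0.
  have [[i iy]|[i pT]] := in_sector_exists T_lt rr; last first.
    have [kap A] := angles i; have [tau td [c1 c2 c3]] := da_time A rr.
    case: ngy; right; exists (star i).1 => //; exists (dart_time (star i) tau).
      by rewrite /= in_itv /=; have := time01 i tau td; lra.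
    have sA : sphere (dart_arc (star i) tau).
      by apply: arc_sphere; have := time01 i tau td; lra.
    rewrite -/(dart_arc (star i) tau) -(sphere_paramK fr sA c1) -(sphere_paramK fr sy y1).
    by rewrite c2 c3 -pT.1 -pT.2.
  have nr : \forall z \near y, 0 < rad a b z.
    exact: (cvgr_gt _ (@rad_continuous _ a b y)).
  have nr' : \forall z \near y, rad a b z < eps'.
    exact: (cvgr_lt _ (@rad_continuous _ a b y)).
  have ns := in_sector_near T_cont rr iy.
  apply: filterS3 nr nr' ns => z z1 z2 iz _.
  by rewrite (sectorP T_lt rr iy) (sectorP T_lt (radr z z2 z1) iz).
exists W; split=> //.
- by split; [rewrite xx|rewrite /rad xa xb expr0n addr0 sqrtr0].
- move=> y Wy [w _ wy]; have sy : sphere y by rewrite -wy; exact: pos_sphere.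
  have gy : graph_set G y by left; exists w.
  have [//|[i [tau [td yE]]]] := graphW y Wy sy gy.
  by case: (@arc_vertex R G (star i).1 _ w (time01 i tau td)); rewrite -/(dart_arc _ _) -yE.
- move=> c t e u d sc Wc cr; have [u01 cu cd dN] := cr.
  have sct : sphere (c t) := nbhs_singleton sc.
  have gct : graph_set G (c t).
    by right; exists e => //; exists u; [rewrite /= in_itv /=; lra|rewrite cu].
  have [cv|[i [tau [td cE]]]] := graphW _ Wc sct gct.
    by case: (@arc_vertex R G e u v u01); rewrite -cu.
  have [eE uE] := arc_inj u01 (time01 i tau td) (etrans (esym cu) cE).
  exists i; first by rewrite eE.
  have Wcu : nbhs (arc e u) W by rewrite -cu; exact: nbW.
  have [W1 [zeta [ts W1u WW]]] := edge_chart u01 Wcu.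
  have [kap A] := angles i; have [r0 pT] := da_arc A td.
  rewrite -cE in r0 pT; have [y1 y2] := Wc; have rr := radr _ y2 r0.
  set r1 := rad a b (c t) in r0 pT y2 rr.
  have r1' : 0 < r1 < 1 by rewrite r0 /=; lra.
  have [CP dC xC] := circle_curve (T i r1) fr r1'.
  set C := (fun z => _) in CP dC xC; set d' := _ - _ in dC.
  have C0 : C 0 = c t.
    by rewrite /C addr0 -pT.1 -pT.2 sphere_paramK.
  have td1 : 0 <= tau <= 1 by lra.
  have vE : dart_velocity (star i) u = - dart_out (star i) tau.
    by rewrite /dart_out opprK uE.
  have ta : dotv (c t) (dart_out (star i) tau) = 0.
    rewrite cE; apply: sphere_tangent (dart_arc_derive (star i) td1).
    apply/nbhs_realP; exists (Num.min tau (1 - tau)); first by rewrite lt_min; lra.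
    move=> z ztau; apply: arc_sphere; rewrite dart_time01.
    by move: ztau; case: (leP tau) => ?; lra.
  have tv : dotv (c t) (dart_velocity (star i) u) = 0.
    by rewrite vE dotvC dotvNl dotvC ta oppr0.
  have td0 : dotv (c t) d' = 0.
    have sC : \forall z \near (0 : R), dotv (C z) (C z) = 1.
      by apply: filterE => z; have [] := CP z.
    by rewrite -C0; exact: sphere_tangent sC dC.
  have dd : dotv (c t) d = 0 by exact: sphere_tangent sc cd.
  (* Up to a positive factor this is the radial component of the outgoing velocity, positive by
     [da_out]. *)
  have P0 : 0 < det3 (c t) d' (dart_velocity (star i) u).
    have key := tangent_det3 (pos v) sct td0 tv.
    suff : 0 < det3 (pos v) d' (dart_velocity (star i) u).
      by rewrite key pmulr_rgt0// dotvC.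
    have [d'a d'b] : dotv d' a = - (r1 * sin (T i r1)) /\ dotv d' b = r1 * cos (T i r1).
      by rewrite /d' !dotvBl !dotvZl aa bb (dotvC b) ab; split; ring.
    have := da_out A td; rewrite -cE pT.1 pT.2 -/r1 (frame_det3 _ _ fr) d'a d'b vE !dotvNl.
    by congr (_ < _); ring.
  (* [sg] is 1 or -1 according to whether the dart follows the parametrization of its edge or
     reverses it. *)
  have [sg [sgE sg2]] : exists sg : R, dart_velocity (star i) u = sg *: derive1 (arc e) u
      /\ sg * sg = 1.
    rewrite /dart_velocity -eE; case: (star i).2.
      by exists 1; rewrite scale1r mulr1.
    by exists (-1); rewrite scaleN1r mulrNN mulr1.
  have detE w : det3 (c t) w (dart_velocity (star i) u)
      = sg * det3 (c t) w (derive1 (arc e) u).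
    by rewrite sgE !det3E !mxE; ring.
  rewrite detE in P0.
  set D0 := det3 (c t) d' _ in P0; set D := det3 (c t) d _ in dN *.
  have crC : crosses C 0 e u d'.
    split=> //; first by rewrite C0.
    by rewrite C0 -/D0; apply: contraTneq P0 => ->; rewrite mulr0 ltxx.
  have sC : \forall z \near (0 : R), sphere (C z).
    by apply: filterE => z; have [] := CP z.
  have WC : W1 (C 0) by rewrite C0 cu.
  have Wct : W1 (c t) by rewrite cu.
  have [q q0 qC] := ts_cross ts sC WC crC.
  have [q' q'0 qc] := ts_cross ts sc Wct cr.
  have /nbhs_realP[q2 q20 sq2] := sc.
  rewrite C0 -/D0 in qC; rewrite -/D in qc.
  have kside y z : W1 y -> W1 z -> sphere y -> sphere z -> 0 < zeta y * zeta z ->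
      sector a b T y = sector a b T z.
    exact: (two_sided_const kc ts WW).
  have rC z : rad a b (C z) = r1 by have [] := CP z.
  (* A time on the circle shortly before the half-edge, closer to it than the opening of sector
     [i - 1]. *)
  have [zm [zm0 zmk]] : exists zm, - q < zm < 0 /\ sector a b T (C zm) = i - 1.
    have [s sE lE] := sector_before i r1.
    have lt := sector_nonempty (i - 1) rr; rewrite lE in lt.
    have gap : 0 < s - T (i - 1) r1 by rewrite subr_gt0.
    have [m [m0 mq mg _ _]] := exists_lt4 q0 gap gap gap.
    exists (- m); split; first by lra.
    apply: (sectorP T_lt); rewrite ?rC//.
    exists (s - m); first by rewrite rC lE; lra.
    have [_ _ _ pC] := CP (- m).
    case: sE => ->; first exact: pC.
    by rewrite addrAC; exact: polar_shift.
  have [zp [zp0 zpk]] : exists zp, 0 < zp < q /\ sector a b T (C zp) = i.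
    have lt := sector_nonempty i rr.
    have gap : 0 < sector_end T i r1 - T i r1 by rewrite subr_gt0.
    have [m [m0 mq mg _ _]] := exists_lt4 q0 gap gap gap.
    exists m; split; first by lra.
    apply: (sectorP T_lt); rewrite ?rC//.
    exists (T i r1 + m); first by rewrite rC; lra.
    by have [_ _ _ pC] := CP m.
  have [Wm zetam] := (qC zm).1 ltac:(lra).
  have [Wp zetap] := (qC zp).2 ltac:(lra).
  have [smp _ _ _] := CP zm; have [spp _ _ _] := CP zp.
  have [m [m0 mq mq2 _ _]] := exists_lt4 q'0 q20 q20 q20.
  have pos x y : 0 < D * D0 -> 0 < D * x * (D0 * y) -> 0 < x * y.
    by move=> h; rewrite mulrACA pmulr_rgt0.
  have neg x y : D * D0 < 0 -> D * x * (D0 * y) < 0 -> 0 < x * y.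
    by move=> h; rewrite mulrACA nmulr_rlt0.
  have DD : D * D0 = sg * D * (sg * D0) by rewrite mulrACA sg2 mul1r.
  have sg0 : sg != 0 by apply/eqP => sg0; move: sg2; rewrite sg0 mul0r => /eqP; rewrite eq_sym oner_eq0.
  have left z : t - m < z < t -> sphere (c z) /\ (W1 (c z) /\ 0 < D * zeta (c z)).
    by move=> hz; split; [apply: sq2|apply: (qc z).1]; lra.
  have right z : t < z < t + m -> sphere (c z) /\ (W1 (c z) /\ D * zeta (c z) < 0).
    by move=> hz; split; [apply: sq2|apply: (qc z).2]; lra.
  exists m => // z /=; rewrite detE -/D.
  have [P|P] := ltP 0 (sg * D).
    have DD0 : 0 < D * D0 by rewrite DD mulr_gt0.
    split=> [/left|/right] [sz [Wz zz]].
    - by rewrite -zmk; apply: kside => //; apply: pos => //; rewrite mulr_gt0.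
    - by rewrite -zpk; apply: kside => //; apply: pos => //; rewrite nmulr_rgt0.
  have P' : sg * D < 0 by rewrite lt_neqAle P mulf_neq0.
  have DD0 : D * D0 < 0 by rewrite DD nmulr_rlt0.
  split=> [/left|/right] [sz [Wz zz]].
  - by rewrite -zpk; apply: kside => //; apply: neg => //; rewrite pmulr_rlt0.
  - by rewrite -zmk; apply: kside => //; apply: neg => //; rewrite nmulr_rlt0.
Qed.

End Star.
End VertexSectors.

Section VertexChart.
Variables (R : realType) (G : plane_graph R).

(** The counterclockwise list exhausts the half-edges at [v]: its directions are distinct, so the
    three darts are distinct, and there are only three. *)
Lemma vertex_chart (v : vertex G) : trivalent G -> exists star W k,
  vertex_sectors v star W k /\ ccw_star v (star 0) (star 1) (star 2).
Proof.
move=> triG; have [card3 [a1 [a2 [a3 cc]]]] := triG v.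
have [h1 h2 h3 [a [b [r1 [r2 [r3 [t1 [t2 [t3]]]]]]]]] := cc.
case=> -[xa xb ab aa bb] fpos [r10 r20 r30] [t12 t23 t31] [q1 q2 q3].
have xx : dotv (pos v) (pos v) = 1 := pos_sphere v.
have fr := frame_of_orthonormal xx aa bb xa xb ab fpos.
pose star (i : 'I_3) := nth a1 [:: a1; a2; a3] i.
pose th (i : 'I_3) := nth t1 [:: t1; t2; t3] i.
pose rr (i : 'I_3) := nth r1 [:: r1; r2; r3] i.
have star_head i : head (star i) = v by move: i; apply: ord3P.
have rr0 i : 0 < rr i by move: i; apply: ord3P.
have outE i : out_direction (star i) = rr i *: (cos (th i) *: a + sin (th i) *: b).
  by move: i; apply: ord3P.
have th_lt : [/\ th 0 < th 1, th 1 < th 2 & th 2 < th 0 + 2 * pi] by split.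
have dir_inj (r r' t t' : R) (u : 'rV[R]_3) : 0 < r -> 0 < r' -> t < t' < t + 2 * pi ->
    u = r *: (cos t *: a + sin t *: b) -> u <> r' *: (cos t' *: a + sin t' *: b).
  move=> r0 r'0 tt -> e.
  have ca (s q : R) : dotv (s *: (cos q *: a + sin q *: b)) a = s * cos q.
    by rewrite dotvZl dotvDl !dotvZl aa (dotvC b) ab; ring.
  have cb (s q : R) : dotv (s *: (cos q *: a + sin q *: b)) b = s * sin q.
    by rewrite dotvZl dotvDl !dotvZl bb ab; ring.
  have ea : r * cos t = r' * cos t' by rewrite -!ca e.
  have eb : r * sin t = r' * sin t' by rewrite -!cb e.
  have sq : r ^+ 2 = r' ^+ 2.
    rewrite -[LHS]mulr1 -[RHS]mulr1 -{1}(cos2Dsin2 t) -(cos2Dsin2 t') !mulrDr.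
    by rewrite -!exprMn ea eb.
  have rE : r = r'.
    by apply/eqP; rewrite -(@eqrXn2 _ 2) ?ltW// sq.
  have rn : r' != 0 by rewrite gt_eqF.
  suff : t = t' by lra.
  have e1 : cos t = cos t' by apply: (mulfI rn); rewrite -ea rE.
  have e2 : sin t = sin t' by apply: (mulfI rn); rewrite -eb rE.
  by apply: angle_inj => //; rewrite ltr_norml; lra.
have star_inj : injective star.
  have n12 : a1 <> a2.
    by move=> e; apply: (dir_inj r1 r2 t1 t2 (out_direction a1)) => //; [lra|rewrite {1}e].
  have n13 : a1 <> a3.
    by move=> e; apply: (dir_inj r1 r3 t1 t3 (out_direction a1)) => //; [lra|rewrite {1}e].
  have n23 : a2 <> a3.
    by move=> e; apply: (dir_inj r2 r3 t2 t3 (out_direction a2)) => //; [lra|rewrite {1}e].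
  move=> i j; move: i j; apply: ord3P; apply: ord3P => // e;
    by [case: (n12 e)|case: (n12 (esym e))|case: (n13 e)|case: (n13 (esym e))
       |case: (n23 e)|case: (n23 (esym e))].
have star_all al : head al = v -> exists i, star i = al.
  pose S : {set dart G} := (star @: [set: 'I_3])%SET.
  move=> hal; have : al \in S.
    suff -> : S = [set al | head al == v]%SET by rewrite inE hal.
    apply/eqP; rewrite eqEcard card3 card_imset// cardsT card_ord andbT.
    by apply/fintype.subsetP => x /imsetP[i _ ->]; rewrite inE star_head.
  by move=> /imsetP[i _ ->]; exists i.
have [del [rmax [T [del0 ang Tlt]]]] := star_angles star_head fr rr0 outE th_lt.
have [W vs] := star_vertex_sectors star_all fr del0 ang Tlt.
by exists star, W, (sector a b T).
Qed.

End VertexChart.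

(** * Potentials *)

Section Letters.
Variables (R : realType) (G : plane_graph R).
Local Open Scope group_scope.

Definition word_value (w : word (dart G)) : Pi G := quot_proj (@relators R G) (free_word w).

Definition letter_value (l : dart G * bool) : Pi G := word_value [:: l].

Lemma word_value_nil : word_value [::] = 1.
Proof. by []. Qed.

Lemma word_value_cat u w : word_value (u ++ w) = word_value u * word_value w.
Proof.
rewrite /word_value /free_word -(free_mulE u w).
by rewrite /quot_proj -quot_mulE.
Qed.

Definition lam (al : dart G) : Pi G := letter_value (al, true).

Lemma letter_value_inv al : letter_value (al, false) = (lam al)^-1.
Proof.
by rewrite /lam /letter_value /word_value /quot_proj -[RHS]/(quot_inv _) quot_invE
  -[(_)^-1]/(free_inv _) free_invE.
Qed.

Lemma relator_value v a1 a2 a3 : ccw_star v a1 a2 a3 ->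
  lam a1 * (lam (opp_dart a2))^-1 * lam a3 * (lam (opp_dart a1))^-1 * lam a2
    * (lam (opp_dart a3))^-1 = 1.
Proof.
move=> cc.
have -> : lam a1 * (lam (opp_dart a2))^-1 * lam a3 * (lam (opp_dart a1))^-1 * lam a2
    * (lam (opp_dart a3))^-1 = quot_proj (@relators R G) (relator a1 a2 a3).
  have M (x y : free_group (dart G)) : quot_proj (@relators R G) (x * y)
      = (quot_proj (@relators R G) x * quot_proj (@relators R G) y : Pi G).
    by rewrite /quot_proj -quot_mulE.
  have V (x : free_group (dart G)) : quot_proj (@relators R G) (x^-1)
      = ((quot_proj (@relators R G) x)^-1 : Pi G).
    by rewrite /quot_proj -[RHS]/(quot_inv _) quot_invE.
  by rewrite /relator !M !V.
apply/esym; apply/quot_groupP; rewrite invg1 mul1g => N [_ +]; apply.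
by exists v, a1, a2, a3.
Qed.

End Letters.

Section Potentials.
Variables (R : realType) (G : plane_graph R).
Variables (L : topologicalType) (p : L -> 'rV[R]_3) (sheet : L -> bool).
Hypothesis coverp : branched_double_cover G p.
Hypothesis labp : sheet_labelling G p sheet.

Definition off_graph : set L := [set y | ~ graph_set G (p y)].

Lemma cover_sphere y : sphere (p y). Proof. by case: coverp. Qed.

Lemma cover_path (c : R -> L) (A : set R) : {within A, continuous c} ->
  {within A, continuous (p \o c)}.
Proof.
move=> cc; apply: (@within_continuous_comp _ _ _ A setT c p cc) => //.
by apply: continuous_subspaceT; exact: cover_cont coverp.
Qed.

Lemma segment_connected (a b : R) : connected (`[a, b]%classic : set R).
Proof. exact/connected_intervalP/interval_is_interval. Qed.

(** The projected path is connected and avoids the graph, so it remains in one face; the path then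
    remains in one component of the preimage of this face, on which the label is constant. *)
Lemma sheet_off (c : R -> L) (a b : R) : a <= b -> {within `[a, b], continuous c} ->
  (forall t, a <= t <= b -> off_graph (c t)) -> sheet (c a) = sheet (c b).
Proof.
move=> ab cc off.
have aI : `[a, b]%classic a by rewrite /= in_itv /= lexx.
have bI : `[a, b]%classic b by rewrite /= in_itv /= lexx ab.
have offI t : `[a, b]%classic t -> (sphere `\` graph_set G) (p (c t)).
  by rewrite /= in_itv /= => tab; split; [exact: cover_sphere|exact: off].
pose f := connected_component (sphere `\` graph_set G) (p (c a)).
have ff : face G f by exists (p (c a)) => //; exact: offI.
have fc t : `[a, b]%classic t -> f (p (c t)).
  move=> tI; exists ((p \o c) @` `[a, b]%classic); last by exists t.
  split; first by exists a.
    by move=> _ [u uI <-]; exact: offI.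
  apply: connected_continuous_connected; first exact: segment_connected.
  exact: cover_path.
have := sheet_component labp ff (fc a aI) => E.
have : connected_component (p @^-1` f) (c a) (c b).
  exists (c @` `[a, b]%classic); last by exists b.
  split; first by exists a.
    by move=> _ [u uI <-]; exact: fc.
  by apply: connected_continuous_connected => //; exact: segment_connected.
by rewrite E => -[_ ->].
Qed.

Record single_crossing (c : R -> L) (a b t : R) (l : dart G * bool) : Prop := {
  sc_time : a < t < b;
  sc_cont : {within `[a, b], continuous c};
  sc_off : forall u, a <= u <= b -> u != t -> off_graph (c u);
  sc_letter : crossing_letter p sheet c t l }.

Lemma within_sub (X : topologicalType) (c : R -> X) (a b a' b' : R) : a <= a' -> b' <= b ->
  {within `[a, b], continuous c} -> {within `[a', b'], continuous c}.
Proof.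
move=> aa bb; apply: continuous_subspaceW => t /=; rewrite !in_itv /= => /andP[t1 t2].
by rewrite (le_trans aa t1) (le_trans t2 bb).
Qed.

Lemma single_crossing_sheet c a b t l : single_crossing c a b t l ->
  sheet (c a) = l.2 /\ sheet (c b) = ~~ l.2.
Proof.
move=> [/andP[at_ tb] cc off [s [d [cr fr /near_leftP[e1 e10 e1P] /near_rightP[e2 e20 e2P]]]]].
have ta0 : 0 < t - a by rewrite subr_gt0.
have tb0 : 0 < b - t by rewrite subr_gt0.
have [m [m0 ma mb m1 m2]] := exists_lt4 ta0 tb0 e10 e20.
split.
- rewrite (@sheet_off c a (t - m)); [by apply: e1P; lra|lra| |].
    by apply: within_sub cc; lra.
  by move=> u uI; apply: off; [lra|apply/eqP; lra].
- rewrite -(@sheet_off c (t + m) b); [by apply: e2P; lra|lra| |].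
    by apply: within_sub cc; lra.
  by move=> u uI; apply: off; [lra|apply/eqP; lra].
Qed.

(* A local primitive of the reading of letters along paths. *)
Record potential (U : set L) (phi : L -> Pi G) : Prop := {
  pot_off : forall (c : R -> L) (a b : R), a <= b -> {within `[a, b], continuous c} ->
    (forall t, a <= t <= b -> U (c t) /\ off_graph (c t)) -> phi (c a) = phi (c b);
  pot_cross : forall c a b t l, single_crossing c a b t l ->
    (forall u, a <= u <= b -> U (c u)) -> phi (c b) = (phi (c a) * letter_value l)%g }.

(** A local potential is a table [Phi] of values indexed by piece and sheet. A positive crossing of
    [al] from [k1] to [k2] reads [lam al] when it leaves sheet +, and the inverse of
    [lam (opp_dart al)] when it leaves sheet -, since the frame condition is then imposed on the
    opposite direction. Crossings from [k2] to [k1] read the inverse letters, so two equations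
    suffice. *)
Lemma sector_potential (K : Type) (W : set 'rV[R]_3) (k : 'rV[R]_3 -> K)
    (Phi : K -> bool -> Pi G) :
  (forall y, W y -> sphere y -> ~ graph_set G y -> nbhs y [set z | sphere z -> k z = k y]) ->
  (forall (c : R -> 'rV[R]_3) (t : R) e u d, (\forall z \near t, sphere (c z)) ->
    W (c t) -> crosses (G := G) c t e u d ->
    exists al k1 k2, [/\ al.1 = e, Phi k2 false = (Phi k1 true * lam al)%g,
      Phi k2 true = (Phi k1 false * (lam (opp_dart al))^-1)%g
    & exists2 r, 0 < r & forall z,
      let pos_cross := 0 < det3 (c t) d (dart_velocity al u) in
      (t - r < z < t -> k (c z) = if pos_cross then k1 else k2) /\
      (t < z < t + r -> k (c z) = if pos_cross then k2 else k1)]) ->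
  potential (p @^-1` W) (fun y => Phi (k (p y)) (sheet y)).
Proof.
move=> kc kj.
have koff (c : R -> L) (a b : R) : a <= b -> {within `[a, b], continuous c} ->
    (forall t, a <= t <= b -> W (p (c t)) /\ off_graph (c t)) -> k (p (c a)) = k (p (c b)).
  move=> ab cc Wc; apply: (@locally_constant_path R _ _ k
    [set y | [/\ W y, sphere y & ~ graph_set G y]] (p \o c) a b ab).
  - exact: cover_path.
  - by move=> t tab; have [h1 h2] := Wc t tab; split=> //; exact: cover_sphere.
  - move=> y [Wy sy gy]; apply: filterS (kc y Wy sy gy) => z kz [_ sz _]; exact: kz.
split=> [c a b ab cc Wc|c a b t l sc Uc].
  rewrite (koff c a b ab cc Wc) (@sheet_off c a b)// => t tab.
  by have [] := Wc t tab.
have [-> ->] := single_crossing_sheet sc.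
case: sc => /andP[at_ tb] cc off [s [d [cr fr _ _]]].
have sp : \forall z \near t, sphere ((p \o c) z).
  by apply: filterE => z; exact: cover_sphere.
have [|al [k1 [k2 [alE R1 R2 [r r0 rP]]]]] := kj _ t _ _ _ sp _ cr.
  by apply: Uc; lra.
have ta0 : 0 < t - a by rewrite subr_gt0.
have tb0 : 0 < b - t by rewrite subr_gt0.
have [m [m0 ma mb m1 m2]] := exists_lt4 ta0 tb0 r0 r0.
rewrite (koff c a (t - m)); [|lra| |]; first last.
- by move=> u uI; split; [apply: Uc|apply: off; [|apply/eqP]]; lra.
- by apply: within_sub cc; lra.
rewrite -(koff c (t + m) b); [|lra| |]; first last.
- by move=> u uI; split; [apply: Uc|apply: off; [|apply/eqP]]; lra.
- by apply: within_sub cc; lra.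
have [kl _] := rP (t - m); have [_ kr] := rP (t + m).
rewrite /= in kl kr; rewrite kl; last by lra.
rewrite kr; last by lra.
move: fr cr alE; rewrite /pos_frame /dart_velocity; case: l => [[e o] bt] /= fr cr alE.
move: fr R1 R2 {kl kr rP}; case: al alE => e' o' /= -> fr R1 R2.
have lt0 (x : R) : 0 < - x -> (0 < x) = false by move=> h; apply/negbTE; lra.
have velN : (if ~~ o' then derive1 (arc e) s else - derive1 (arc e) s)
    = - (if o' then derive1 (arc e) s else - derive1 (arc e) s).
  by case: (o'); rewrite ?opprK.
(* Four cases: the sheet that is left, and whether the orientation in the letter is that of [al]. *)
move: fr; case: bt; have [->|oE] := eqVneq o o'.
- by move=> ->; rewrite R1.
- have -> : o = ~~ o' by case: o o' oE {velN R1 R2} => -[].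
  rewrite velN det3Nr => /lt0 ->; rewrite -[(e, ~~ o')]/(opp_dart (e, o')).
  by rewrite R2 -mulgA mulVg mulg1.
- rewrite det3N => /lt0 ->; rewrite letter_value_inv R1.
  by rewrite -mulgA mulgV mulg1.
- have -> : o = ~~ o' by case: o o' oE {velN R1 R2} => -[].
  rewrite velN det3N det3Nr opprK => ->; rewrite -[(e, ~~ o')]/(opp_dart (e, o')).
  by rewrite letter_value_inv R2.
Qed.

End Potentials.

Section LocalPotential.
Variables (R : realType) (G : plane_graph R).
Variables (L : topologicalType) (p : L -> 'rV[R]_3) (sheet : L -> bool).
Hypothesis triG : trivalent G.
Hypothesis coverp : branched_double_cover G p.
Hypothesis labp : sheet_labelling G p sheet.

Lemma preimage_open (W : set 'rV[R]_3) : open W -> open (p @^-1` W).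
Proof. by move: W; apply/continuousP; exact: cover_cont coverp. Qed.

Lemma graph_set_edge x : graph_set G x -> ~ vertex_set G x ->
  exists (e : edge G) s, 0 < s < 1 /\ x = arc e s.
Proof.
case=> [//|[e _ [s]]]; rewrite /= in_itv /= => s01 sx nv.
exists e, s; split=> //.
have s0 : s != 0.
  by apply/eqP => s0; apply: nv; exists (source e) => //; rewrite -arc0 -s0.
have s1 : s != 1.
  by apply/eqP => s1; apply: nv; exists (target e) => //; rewrite -arc1 -s1.
by rewrite !lt_neqAle eq_sym s0 s1.
Qed.

(** Off the graph a constant will do. Over an edge the two left pieces get the value 1, and the
    piece across the edge gets the letter of the crossing. *)
Lemma local_potential y : exists U phi, [/\ open U, U y & potential (G := G) p sheet U phi].
Proof.
have [gy|gy] := pselect (graph_set G (p y)); last first.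
  exists (p @^-1` (~` graph_set G)), (fun=> 1%g); split=> //.
    by apply: preimage_open; exact/closed_openC/graph_set_closed.
  apply: (@sector_potential _ _ _ _ _ coverp labp unit (~` graph_set G) (fun=> tt)
    (fun _ _ => 1%g)).
    by move=> z _ _ _; apply: filterE.
  move=> c t e u d _ /= Wc [u01 cu _ _]; case: Wc; right; exists e => //.
  by exists u => //; rewrite /= in_itv /=; lra.
have [vy|vy] := pselect (vertex_set G (p y)).
  case: vy => v _ vy; have [star [W [k [vs cc]]]] := vertex_chart v triG.
  (* Turning twice around the vertex crosses the three half-edges on both sheets,
     in the order of the relator; the values on the six pieces are forced one after
     the other, and the last jump is consistent because of the relator. *)
  pose x i := lam (star i); pose z i := lam (opp_dart (star i)).
  pose x0 := x 0; pose x1 := x 1; pose x2 := x 2.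
  pose z0 := z 0; pose z1 := z 1.
  pose Phi (i : 'I_3) (bt : bool) : Pi G := (if bt
    then nth 1 [:: x0 * z1^-1 * x2 * z0^-1; x0 * z1^-1; 1] i
    else nth 1 [:: x0; x0 * z1^-1 * x2 * z0^-1 * x1; x0 * z1^-1 * x2] i)%g.
  exists (p @^-1` W), (fun y => Phi (k (p y)) (sheet y)); split.
  - by apply: preimage_open; exact: vs_open vs.
  - by rewrite /preimage /= -vy; exact: vs_pos vs.
  apply: (@sector_potential _ _ _ _ _ coverp labp _ W k Phi); first exact: vs_const vs.
  move=> c t e u d sc Wc cr; have [i iE jump] := vs_jump vs sc Wc cr.
  exists (star i), (i - 1), i; split=> //.
  - by move: i {iE jump}; apply: ord3P; rewrite /Phi /= ?mul1g.
  (* The relator enters only for half-edge 2, crossed from sector 1 on sheet - to sector 2 on sheet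
     +: this sixth jump returns to the initial value 1. *)
  - by move: i {iE jump}; apply: ord3P; rewrite /Phi //= (relator_value cc).
have [e [s [s01 ys]]] := graph_set_edge gy vy.
have nT : nbhs (arc e s) (setT : set 'rV[R]_3) by exact: filterT.
have [W [zeta [ts Ws _]]] := edge_chart s01 nT.
pose al : dart G := (e, true).
pose Phi (pos bt : bool) : Pi G :=
  (if pos then 1 else if bt then (lam (opp_dart al))^-1 else lam al)%g.
exists (p @^-1` W), (fun y => Phi (0 < zeta (p y)) (sheet y)); split.
- by apply: preimage_open; exact: ts_open ts.
- by rewrite /preimage /= ys.
apply: (@sector_potential _ _ _ _ _ coverp labp _ W (fun y => 0 < zeta y) Phi).
  move=> z Wz sz gz; have cz := ts_continuous ts Wz.
  have z0 : zeta z != 0 by apply/eqP => /(ts_graph ts Wz sz).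
  have [zp|zn] := ltP 0 (zeta z).
    by apply: filterS (cvgr_gt _ cz _ zp) => w wp _.
  have zn' : zeta z < 0 by rewrite lt_neqAle z0.
  by apply: filterS (cvgr_lt _ cz _ zn') => w wn _; apply/negbTE; rewrite -leNgt ltW.
move=> c t e' u d sc Wc cr; have eE := ts_edge ts Wc cr; subst e'.
have [r r0 rP] := ts_cross ts sc Wc cr.
exists al, true, false; split; rewrite /Phi ?mul1g//.
exists r => // z /=; rewrite /dart_velocity /=.
move: (det3 _ _ _) rP => D rP; split=> hz.
- have [_] := (rP z).1 hz; have [D0|D0] := ltP 0 D.
    by rewrite pmulr_rgt0.
  by move=> h; apply/negbTE; rewrite -leNgt; nra.
- have [_] := (rP z).2 hz; have [D0|D0] := ltP 0 D.
    by rewrite pmulr_rlt0// => h; apply/negbTE; rewrite -leNgt ltW.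
  move=> h; have Dn : D < 0.
    by rewrite lt_neqAle D0 andbT; apply: contraTneq h => ->; rewrite mul0r ltxx.
  by rewrite nmulr_rlt0 in h.
Qed.

End LocalPotential.

(** * Generic paths *)

Section GenericPaths.
Variables (R : realType) (G : plane_graph R).
Variables (L : topologicalType) (p : L -> 'rV[R]_3) (sheet : L -> bool).
Hypothesis coverp : branched_double_cover G p.
Hypothesis labp : sheet_labelling G p sheet.
Local Notation off := (off_graph G p).

Lemma crosses_near (c c' : R -> 'rV[R]_3) (t : R) e s d :
  (\forall u \near t, c u = c' u) -> crosses (G := G) c t e s d -> crosses c' t e s d.
Proof.
move=> cc [s01 cs cd dN]; have ct := nbhs_singleton cc.
by split=> //; rewrite -?ct//; exact: near_eq_is_derive cd.
Qed.

Lemma crosses_affine (c : R -> 'rV[R]_3) (k l t : R) e s d : k != 0 ->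
  crosses (G := G) c (k * t + l) e s d ->
  crosses (fun u => c (k * u + l)) t e s (k *: d).
Proof.
move=> k0 [s01 cs cd dN]; split=> //; first exact: is_derive_affine_comp.
by rewrite det3Zl mulf_neq0.
Qed.

(** Genericity relative to a subinterval, so that paths can be cut and glued; on [0, 1] it is
    convertible with [generic]. *)
Definition generic_on (c : R -> L) (a b : R) : Prop :=
  (forall t, a <= t <= b -> ~ vertex_set G (p (c t))) /\
  (forall t, a <= t <= b -> graph_set G (p (c t)) ->
     a < t < b /\ exists e s d, crosses (G := G) (p \o c) t e s d).

Lemma near_itv (a b t : R) : a < t < b -> \forall u \near t, a <= u <= b.
Proof.
move=> /andP[at_ tb]; apply/nbhs_realP; exists (Num.min (t - a) (b - t)).
  by rewrite lt_min !subr_gt0 at_.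
by move=> u; case: (leP (t - a)) => ?; lra.
Qed.

Lemma generic_ext (c c' : R -> L) (a b : R) : (forall t, a <= t <= b -> c t = c' t) ->
  generic_on c a b -> generic_on c' a b.
Proof.
move=> cc [gv gc]; split=> t tab; first by rewrite -cc//; exact: gv.
rewrite -cc// => /gc[]// tab' [e [s [d cr]]]; split=> //; exists e, s, d.
by apply: crosses_near cr; apply: filterS (near_itv tab') => u uab /=; rewrite cc.
Qed.

Lemma generic_glue (c : R -> L) (a m b : R) : a <= m -> m <= b ->
  generic_on c a m -> generic_on c m b -> generic_on c a b.
Proof.
move=> am mb [gv1 gc1] [gv2 gc2]; split=> t /andP[at_ tb].
  have [tm|mt] := leP t m; first by apply: gv1; rewrite at_.
  by apply: gv2; rewrite (ltW mt).
move=> gt; have [tm|mt] := leP t m.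
  have [|//|/andP[h1 h2] h] := gc1 t; first by rewrite at_.
  by split=> //; rewrite h1 (lt_le_trans h2).
have [|//|/andP[h1 h2] h] := gc2 t; first by rewrite (ltW mt).
by split=> //; rewrite h2 (le_lt_trans am).
Qed.

Lemma generic_affine (c : R -> L) (k l a b : R) : k != 0 -> a <= b ->
  generic_on c (Num.min (k * a + l) (k * b + l)) (Num.max (k * a + l) (k * b + l)) ->
  generic_on (fun t => c (k * t + l)) a b.
Proof.
move=> k0 ab [gv gc].
have I t : a <= t <= b ->
    Num.min (k * a + l) (k * b + l) <= k * t + l <= Num.max (k * a + l) (k * b + l).
  by move=> tab; rewrite ge_min le_max; case: (ltP 0 k) => ?; apply/andP; split; apply/orP; nra.
split=> t tab; first by apply: gv; exact: I.
move=> gt; have [h [e [s [d cr]]]] := gc _ (I t tab) gt.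
split; last by exists e, s, (k *: d); exact: crosses_affine cr.
have ta : t != a.
  by apply: contraTneq h => ->; rewrite gt_min lt_max !ltxx /=; case: ltgtP.
have tb : t != b.
  by apply: contraTneq h => ->; rewrite gt_min lt_max !ltxx !orbF; case: ltgtP.
by have /andP[h1 h2] := tab; rewrite !lt_neqAle h1 h2 tb eq_sym ta.
Qed.

Lemma off_open : open (off : set L).
Proof. exact: preimage_open coverp _ (closed_openC (@graph_set_closed R G)). Qed.

Lemma path_near (c : R -> L) (a b t : R) (U : set L) : {within `[a, b], continuous c} ->
  a <= t <= b -> open U -> U (c t) -> \forall u \near t, a <= u <= b -> U (c u).
Proof.
move=> /within_continuousP cc tab oU Ut.
have tI : `[a, b]%classic t by rewrite /= in_itv.
have nU : nbhs (c t) U by apply: open_nbhs_nbhs.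
by have := cc t tI U nU; apply: filterS => u /= hu uab; apply: hu; rewrite in_itv.
Qed.

(** By [ts_cross] the function [zeta], which vanishes exactly on the graph, is nonzero along the
    curve just before and just after the crossing. *)
Lemma crossing_isolated (c : R -> L) (t : R) e s d : crosses (G := G) (p \o c) t e s d ->
  exists2 r, 0 < r & forall u, t - r < u < t + r -> u != t -> off (c u).
Proof.
move=> cr; have [s01 cs cd dN] := cr.
have nT : nbhs (arc e s) (setT : set 'rV[R]_3) by exact: filterT.
have [W [zeta [ts Ws _]]] := edge_chart s01 nT.
have sp : \forall z \near t, sphere ((p \o c) z).
  by apply: filterE => z; exact: cover_sphere coverp _.
have Wc : W ((p \o c) t) by rewrite cs.
have [r r0 rP] := ts_cross ts sp Wc cr.
exists r => // u ut un gu.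
have : W (p (c u)) /\ zeta (p (c u)) != 0.
  have [h1 h2] := rP u; case: (ltgtP u t) un => // h _.
    have [Wu zu] := h1 ltac:(lra); split=> //.
    by apply: contraTneq zu => /= ->; rewrite mulr0 ltxx.
  have [Wu zu] := h2 ltac:(lra); split=> //.
  by apply: contraTneq zu => /= ->; rewrite mulr0 ltxx.
by case=> Wu /eqP; apply; apply/(ts_graph ts Wu (cover_sphere coverp _)).
Qed.

Lemma crossing_graph (c : R -> 'rV[R]_3) (t : R) e s d :
  crosses (G := G) c t e s d -> graph_set G (c t).
Proof.
move=> [s01 -> _ _]; right; exists e => //; exists s => //.
by rewrite /= in_itv /=; lra.
Qed.

(** The sheet that is left is that of [c a], and [sheet_crossing] gives the flip; the orientation in
    the letter is then dictated by the sign of a nonzero determinant. *)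
Lemma crossing_letter_exists (c : R -> L) (a b t : R) e s d : a < t < b ->
  {within `[a, b], continuous c} -> crosses (G := G) (p \o c) t e s d ->
  (forall u, a <= u <= b -> u != t -> off (c u)) ->
  exists l, single_crossing (G := G) p sheet c a b t l.
Proof.
move=> tab cc cr oc; have /andP[at_ tb] := tab; have [s01 cs cd dN] := cr.
have ta0 : 0 < t - a by rewrite subr_gt0.
have tb0 : 0 < b - t by rewrite subr_gt0.
have left_const u u' : a <= u -> u <= u' -> u' < t -> sheet (c u) = sheet (c u').
  move=> au uu ut; apply: (sheet_off coverp labp uu).
    by apply: within_sub cc; lra.
  by move=> z zI; apply: oc; [|apply/eqP]; lra.
have right_const u u' : t < u -> u <= u' -> u' <= b -> sheet (c u) = sheet (c u').
  move=> au uu ut; apply: (sheet_off coverp labp uu).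
    by apply: within_sub cc; lra.
  by move=> z zI; apply: oc; [|apply/eqP]; lra.
have flip : sheet (c b) = ~~ sheet (c a).
  have ba0 : 0 < b - a by lra.
  have ban : b - a != 0 by rewrite gt_eqF.
  (* [sheet_crossing] is stated on [0, 1], so [a, b] is rescaled. *)
  pose f (u : R) := (b - a) * u + a.
  have f0 : f 0 = a by rewrite /f mulr0 add0r.
  have f1 : f 1 = b by rewrite /f mulr1 subrK.
  have fI u : 0 <= u <= 1 -> a <= f u <= b by move=> u01; rewrite /f; nra.
  pose t' := (t - a) / (b - a).
  have ft : f t' = t by rewrite /f /t' mulrC divfK// subrK.
  have cf : {within `[0, 1], continuous (c \o f)}.
    apply: within_continuous_comp cc; last by move=> u /=; rewrite !in_itv /=; exact: fI.
    apply: continuous_subspaceT => u.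
    exact: is_derive_continuous (is_derive_affine (b - a) a u).
  have t'01 : 0 < t' < 1 by rewrite divr_gt0// ltr_pdivrMr//; lra.
  have crf : crosses (G := G) (p \o (c \o f)) t' e s ((b - a) *: d).
    by apply: (crosses_affine (c := p \o c)); rewrite // -/(f t') ft.
  have := sheet_crossing labp cf t'01 crf; rewrite /= f0 f1; apply=> u u01 ut'.
  apply: oc; first exact: fI.
  apply: contraNneq ut' => fu; apply/eqP/(mulfI ban)/(addIr a).
  by rewrite -/(f u) -/(f t') fu ft.
pose bt := sheet (c a).
pose q := det3 (p (c t)) (if bt then d else - d) (derive1 (arc e) s).
have q0 : q != 0.
  by rewrite /q; case: (bt); rewrite ?det3N ?oppr_eq0.
exists ((e, 0 < q), bt); split=> //; exists s, d; split=> //.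
- rewrite /pos_frame /dart_velocity /=; have [h|h] := ltP 0 q; first exact: h.
  by rewrite det3Nr oppr_gt0 -/q lt_neqAle q0.
- apply/near_leftP; exists (t - a) => // u ut.
  by rewrite -(left_const a u)//; lra.
- apply/near_rightP; exists (b - t) => // u ut.
  by rewrite -/bt -flip; apply: right_const; lra.
Qed.

(** The derivative is unique, and so are the edge and the parameter on it, by [arc_inj]. The sheet
    is read off just before [t], and the orientation follows from the sign of the determinant. *)
Lemma letter_unique (c : R -> L) (t : R) l l' :
  crossing_letter (G := G) p sheet c t l -> crossing_letter (G := G) p sheet c t l' -> l = l'.
Proof.
case: l => [[e o] bt]; case: l' => [[e' o'] bt'].
move=> [s [d [/= [s01 cs [_ cd] dN] fr /near_leftP[r r0 rP] _]]].
move=> [s' [d' [/= [s'01 cs' [_ cd'] _] fr' /near_leftP[r' r'0 r'P] _]]].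
have [m [m0 mr mr' _ _]] := exists_lt4 r0 r'0 r0 r0.
have btE : bt = bt'.
  rewrite -(rP (t - m)); last by rewrite ltrD2l ltrN2 mr gtrBl.
  by apply: r'P; rewrite ltrD2l ltrN2 mr' gtrBl.
have dE : d = d' by rewrite -cd cd'.
have [eE sE] := arc_inj s01 s'01 (etrans (esym cs) cs').
rewrite -dE in fr'; subst bt' e' s'; congr (_, _, _).
move: fr fr'; rewrite /pos_frame /dart_velocity /=; case: o; case: o' => //.
  by rewrite det3Nr oppr_gt0 => h1 h2; have := lt_trans h1 h2; rewrite ltxx.
by rewrite det3Nr oppr_gt0 => h1 h2; have := lt_trans h1 h2; rewrite ltxx.
Qed.

(* Half-open intervals, so that lists for adjacent intervals concatenate. *)
Record crossing_list (c : R -> L) (a b : R) (k : seq (R * (dart G * bool))) : Prop := {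
  cl_sorted : sorted <%R [seq x.1 | x <- k];
  cl_times : forall t, t \in [seq x.1 | x <- k] <-> a <= t < b /\ graph_set G (p (c t));
  cl_letters : forall x, x \in k -> crossing_letter (G := G) p sheet c x.1 x.2 }.

Lemma crossing_list_unique c a b k k' :
  crossing_list c a b k -> crossing_list c a b k' -> k = k'.
Proof.
move=> [s1 t1 l1] [s2 t2 l2].
have tE : [seq x.1 | x <- k] = [seq x.1 | x <- k'].
  apply: (irr_sorted_eq lt_trans ltxx s1 s2) => t.
  by apply/idP/idP => [/t1 /t2|/t2 /t1].
elim: k k' tE l1 l2 {s1 t1 s2 t2} => [|[t l] k IH] [|[t' l'] k'] //= [tt' tE] l1 l2.
rewrite -tt'; congr (_ :: _).
  congr (_, _); apply: (@letter_unique c t).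
    by have := l1 (t, l); rewrite inE eqxx; apply.
  by have := l2 (t', l'); rewrite inE eqxx /= -tt'; apply.
by apply: IH => // x xk; [apply: l1|apply: l2]; rewrite inE xk orbT.
Qed.

Lemma crossing_list_cat c a m b k1 k2 : a <= m -> m <= b ->
  crossing_list c a m k1 -> crossing_list c m b k2 -> crossing_list c a b (k1 ++ k2).
Proof.
move=> am mb [s1 t1 l1] [s2 t2 l2]; split.
- rewrite map_cat sorted_pairwise; last exact: lt_trans.
  rewrite pairwise_cat -!sorted_pairwise; try exact: lt_trans.
  rewrite s1 s2 !andbT; apply/allrelP => x y /t1[x1 _] /t2[y1 _]; lra.
- move=> t; rewrite map_cat mem_cat; split.
    by move=> /orP[/t1|/t2] [tt gt]; split=> //; lra.
  move=> [tt gt]; apply/orP; have [tm|tm] := ltP t m.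
    by left; apply/t1; split=> //; lra.
  by right; apply/t2; split=> //; lra.
- by move=> x; rewrite mem_cat => /orP[/l1|/l2].
Qed.

Lemma crossing_list_nil c a b : (forall t, a <= t < b -> off (c t)) -> crossing_list c a b [::].
Proof. by move=> oc; split=> // t; split=> // -[/oc]. Qed.

Lemma crossing_list_single c a b t l : single_crossing (G := G) p sheet c a b t l ->
  crossing_list c a b [:: (t, l)].
Proof.
move=> [tab cc oc lt]; split=> //.
- move=> u; rewrite /= inE; split=> [/eqP ->|[uab gu]].
    split; first by lra.
    by have [s [d [cr _ _ _]]] := lt; exact: crossing_graph cr.
  by apply/negPn/negP => ut; apply: (oc u) => //; lra.
- by move=> x; rewrite inE => /eqP ->.
Qed.

Lemma crossing_list_exists c a b : a <= b -> {within `[a, b], continuous c} ->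
  generic_on c a b -> exists k, crossing_list c a b k.
Proof.
move=> ab cc [gv gc].
apply: (@cousin R (fun x y => exists k, crossing_list c x y k) a b ab).
  move=> x y z _ xy yz _ [k1 h1] [k2 h2]; exists (k1 ++ k2).
  exact: crossing_list_cat h1 h2.
move=> t tab; have [gt|ot] := pselect (graph_set G (p (c t))); last first.
  exists [set u | a <= u <= b -> off (c u)]; first exact: path_near cc tab off_open ot.
  move=> x y ax xt ty yb nb; exists [::]; apply: crossing_list_nil => u uxy.
  by apply: nb; lra.
have [tab' [e [s [d cr]]]] := gc t tab gt.
have [r r0 rP] := crossing_isolated cr.
have ta0 : 0 < t - a by lra.
have tb0 : 0 < b - t by lra.
have [m [m0 mr ma mb _]] := exists_lt4 r0 ta0 tb0 r0.
have [l sl] : exists l, single_crossing (G := G) p sheet c (t - m) (t + m) t l.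
  apply: crossing_letter_exists cr _; first by lra.
    by apply: within_sub cc; lra.
  by move=> u um ut; apply: rP => //; lra.
exists [set u | t - m < u < t + m].
  by apply/nbhs_realP; exists m.
move=> x y ax xt ty yb nb.
have mx := nb x; have my := nb y.
have oxy u : x <= u <= y -> u != t -> off (c u).
  by move=> uxy ut; apply: rP => //; have := nb u uxy => /=; lra.
(* A crossing at the right end, when [y = t], is left to the next interval. *)
have [yt|ty'] := leP y t.
  exists [::]; apply: crossing_list_nil => u uxy; apply: oxy; first by lra.
  by apply/eqP; lra.
exists [:: (t, l)]; split=> //.
- move=> u; rewrite /= inE; split=> [/eqP -> //|[uxy gu]].
    by split=> //; lra.
  by apply/negPn/negP => ut; apply: (oxy u) => //; lra.
- by move=> z; rewrite inE => /eqP ->; case: sl.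
Qed.

(** Unlike [cousin], this induction cuts only at points off the graph, the only ones where a
    potential has a meaning. It runs over the finite list of crossings, each isolated in a small
    interval around it. *)
Lemma generic_ind (c : R -> L) (a b : R) (P : R -> R -> Prop) : a <= b ->
  {within `[a, b], continuous c} -> generic_on c a b ->
  (forall x y, a <= x -> x <= y -> y <= b -> (forall t, x <= t <= y -> off (c t)) -> P x y) ->
  (forall x y t l, a <= x -> y <= b -> single_crossing (G := G) p sheet c x y t l -> P x y) ->
  (forall x y z, a <= x -> x <= y -> y <= z -> z <= b -> off (c y) ->
     P x y -> P y z -> P x z) -> P a b.
Proof.
move=> ab cc gab Poff Pcross Ptr.
have offb : off (c b).
  by move=> gb; have [|] := gab.2 b _ gb; [rewrite ab lexx|lra].
have [k] := crossing_list_exists ab cc gab.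
have offa : off (c a).
  by move=> ga; have [|] := gab.2 a _ ga; [rewrite ab lexx|lra].
suff H k' x : a <= x -> x <= b -> off (c x) -> crossing_list c x b k' -> P x b.
  by apply: H.
elim: k' x => [|[t l] k' IH] x ax xb offx [sk tk lk].
  apply: Poff => // t /andP[xt tb] gt; have [tb'|bt] := ltP t b.
    by have := (tk t).2 _; rewrite in_nil => h; apply: notF; apply: h; split=> //; rewrite xt.
  by apply: offb; rewrite (_ : b = t)//; lra.
have [xt gt] : x <= t < b /\ graph_set G (p (c t)) by apply/tk; rewrite inE eqxx.
have xt' : x != t by apply/eqP => e; apply: offx; rewrite e.
have tab : a <= t <= b by lra.
have [tab' [e [s [d cr]]]] := gab.2 t tab gt.
have [r r0 rP] := crossing_isolated cr.
have tx0 : 0 < t - x by lra.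
have tb0 : 0 < b - t by lra.
have [m [m0 mr mx mb _]] := exists_lt4 r0 tx0 tb0 r0.
have offm u : t - m <= u <= t + m -> u != t -> off (c u).
  by move=> um ut; apply: rP => //; lra.
have [l' sl] : exists l', single_crossing (G := G) p sheet c (t - m) (t + m) t l'.
  apply: crossing_letter_exists cr offm; first by lra.
  by apply: within_sub cc; lra.
have kt u : u \in [seq x0.1 | x0 <- k'] -> t < u.
  move=> uk; move: sk; rewrite /= (path_sortedE lt_trans) => /andP[/allP h _].
  exact: h.
have xm : x <= t - m by lra.
have mb' : t + m <= b by lra.
have tm : t - m <= t + m by lra.
have offl : off (c (t - m)) by apply: offm; [|apply/eqP]; lra.
have offr : off (c (t + m)) by apply: offm; [|apply/eqP]; lra.
apply: (Ptr x (t - m) b ax xm (le_trans tm mb') (lexx b) offl).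
  apply: Poff => //; first exact: le_trans tm (le_trans mb' (lexx b)).
  move=> u ux gu; have : u \in [seq x0.1 | x0 <- (t, l) :: k'] by apply/tk; split=> //; lra.
  by rewrite inE => /orP[/eqP|/kt] /=; lra.
have axm : a <= t - m := le_trans ax xm.
apply: (Ptr (t - m) (t + m) b axm tm mb' (lexx b) offr); first exact: Pcross axm mb' sl.
apply: IH => //; first exact: le_trans axm tm.
split.
- by move: sk => /= /path_sorted.
- move=> u; split.
    move=> uk; have [ub gu] : x <= u < b /\ graph_set G (p (c u)).
      by apply/tk; rewrite inE uk orbT.
    split=> //; have tu := kt u uk; have : t + m <= u; last by lra.
    rewrite leNgt; apply/negP => um; apply: (offm u) => //; first by lra.
    by apply/eqP; lra.
  move=> [ub gu]; have : u \in [seq x0.1 | x0 <- (t, l) :: k'] by apply/tk; split=> //; lra.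
  by rewrite inE => /orP[/eqP /= ut|//]; lra.
- by move=> z zk; apply: lk; rewrite inE zk orbT.
Qed.

End GenericPaths.

(** * Reparametrization, reversal and concatenation of generic paths *)

Section PathOperations.
Variables (R : realType) (G : plane_graph R).
Variables (L : topologicalType) (p : L -> 'rV[R]_3).

Lemma glue_continuous (T : topologicalType) (c d : R -> T) (a m b : R) : a <= m -> m <= b ->
  {within `[a, m], continuous c} -> {within `[m, b], continuous d} -> c m = d m ->
  {within `[a, b], continuous (fun t => if t <= m then c t else d t)}.
Proof.
move=> am mb cc cd cdm.
have -> : `[a, b]%classic = `[a, m]%classic `|` `[m, b]%classic.
  apply/seteqP; split=> t /=; rewrite !in_itv /=.
    by move=> tab; have [tm|tm] := leP t m; [left|right]; lra.
  by case=> ?; lra.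
apply: withinU_continuous; [exact: interval_closed|exact: interval_closed| |].
- apply: within_continuous_ext cc => t; rewrite /= in_itv /= => /andP[_ ->] //.
- apply: within_continuous_ext cd => t; rewrite /= in_itv /= => /andP[mt _].
  by case: ifP => // tm; have -> : t = m by apply/eqP; rewrite eq_le tm.
Qed.

Definition path_on (U : set L) (c : R -> L) (a b : R) : Prop :=
  [/\ {within `[a, b], continuous c}, forall t, a <= t <= b -> U (c t)
    & generic_on G p c a b].

Lemma path_on_affine U c k l a b : k != 0 -> a <= b ->
  path_on U c (Num.min (k * a + l) (k * b + l)) (Num.max (k * a + l) (k * b + l)) ->
  path_on U (fun t => c (k * t + l)) a b.
Proof.
move=> k0 ab [cc cU cg].
have I t : a <= t <= b ->
    Num.min (k * a + l) (k * b + l) <= k * t + l <= Num.max (k * a + l) (k * b + l).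
  by move=> tab; rewrite ge_min le_max; case: (ltP 0 k) => ?; apply/andP; split; apply/orP; nra.
split.
- apply: within_continuous_comp cc; last by move=> t /=; rewrite !in_itv /=; exact: I.
  by apply: continuous_subspaceT => u; exact: is_derive_continuous (is_derive_affine k l u).
- by move=> t tab; apply: cU; exact: I.
- exact: generic_affine.
Qed.

Definition gpath (U : set L) (x y : L) : Prop :=
  exists c, [/\ path_on U c 0 1, c 0 = x & c 1 = y].

Lemma itv_to_unit (a b : R) : a < b -> exists k l, [/\ 0 < k, k * a + l = 0 & k * b + l = 1].
Proof.
move=> ab; have ba : b - a != 0 by rewrite subr_eq0 gt_eqF.
by exists (b - a)^-1, (- a / (b - a)); split; [rewrite invr_gt0 subr_gt0|field|field].
Qed.

Lemma gpath_itv U x y (a b : R) : gpath U x y -> a < b ->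
  exists c, [/\ path_on U c a b, c a = x & c b = y].
Proof.
move=> [c [cp c0 c1]] ab; have [k [l [k0 ka kb]]] := itv_to_unit ab.
exists (fun t => c (k * t + l)); split; rewrite ?ka ?kb//.
apply: path_on_affine; rewrite ?gt_eqF ?ltW// ka kb.
by rewrite (min_idPl ler01) (max_idPr ler01).
Qed.

Lemma gpath_sym U x y : gpath U x y -> gpath U y x.
Proof.
move=> [c [cp <- <-]].
have e0 : -1 * 0 + 1 = 1 :> R by ring.
have e1 : -1 * 1 + 1 = 0 :> R by ring.
exists (fun t => c (-1 * t + 1)); split; rewrite ?e0 ?e1//.
apply: path_on_affine; rewrite ?oppr_eq0 ?oner_eq0// e0 e1.
by rewrite (min_idPr ler01) (max_idPl ler01).
Qed.

Lemma path_on_glue U c d (a m b : R) : a <= m -> m <= b -> c m = d m ->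
  path_on U c a m -> path_on U d m b ->
  path_on U (fun t => if t <= m then c t else d t) a b.
Proof.
move=> am mb cdm [cc cU cg] [dc dU dg].
have ec t : a <= t <= m -> c t = if t <= m then c t else d t.
  by move=> /andP[_ ->].
have ed t : m <= t <= b -> d t = if t <= m then c t else d t.
  move=> /andP[mt _]; case: ifP => // tm.
  by have -> : t = m by apply/eqP; rewrite eq_le tm.
split; first exact: glue_continuous.
- move=> t tab; case: leP => tm; first by apply: cU; lra.
  by apply: dU; lra.
- by apply: (generic_glue am mb); [apply: generic_ext cg|apply: generic_ext dg].
Qed.

Lemma gpath_trans U x y z : gpath U x y -> gpath U y z -> gpath U x z.
Proof.
move=> xy yz; have h1 : (0 : R) < 2^-1 by lra.
have h2 : (2^-1 : R) < 1 by lra.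
have [c [cp c0 c1]] := gpath_itv xy h1; have [d [dp d0 d1]] := gpath_itv yz h2.
exists (fun t => if t <= 2^-1 then c t else d t); split.
- by apply: path_on_glue => //; rewrite ?ltW// c1.
- by rewrite ltW.
- by rewrite leNgt h2.
Qed.

Lemma generic_off c a b : (forall t, a <= t <= b -> off_graph G p (c t)) -> generic_on G p c a b.
Proof.
move=> oc; split=> t tab; last by move=> gt; case: (oc t tab).
by move=> vt; apply: (oc t tab); left.
Qed.

Lemma gpath_off (U : set L) (c : R -> L) : {within `[0, 1], continuous c} ->
  (forall t, 0 <= t <= 1 -> U (c t) /\ off_graph G p (c t)) -> gpath U (c 0) (c 1).
Proof.
move=> cc cU; exists c; split=> //; split=> //; first by move=> t /cU[].
by apply: generic_off => t /cU[].
Qed.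

End PathOperations.

(** * Local sections and disc charts of the cover *)

Section Charts.
Variables (R : realType) (G : plane_graph R).
Variables (L : topologicalType) (p : L -> 'rV[R]_3).
Hypothesis coverp : branched_double_cover G p.
Local Notation off := (off_graph G p).

Record local_section (y : L) (V : set L) (W : set 'rV[R]_3) (g : 'rV[R]_3 -> L) : Prop := {
  ls_openV : open V;
  ls_V : V y;
  ls_openW : open W;
  ls_cont : {within W `&` sphere, continuous g};
  ls_g : forall x, W x -> sphere x -> V (g x) /\ p (g x) = x;
  ls_p : forall z, V z -> W (p z) /\ g (p z) = z }.

Lemma regular_section y (O : set L) : ~ vertex_set G (p y) -> nbhs y O ->
  exists V W g, local_section y V W g /\ V `<=` O.
Proof.
move=> vy Oy.
have [W0 [U1 [U2 [oW Wy [oU1 oU2 _ U12] h1 h2]]]] := cover_even coverp (cover_sphere coverp y) vy.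
have aux (U : set L) : open U -> U y -> homeomorphism_on U (W0 `&` sphere) p ->
    exists V W g, local_section y V W g /\ V `<=` O.
  move=> oU Uy [g [_ cg pU gW]].
  have cgP := (within_continuousP _ _).1 cg.
  (* [W0] is cut down to the points around which the inverse [g] takes its values in [O]; asking
     this on a neighbourhood makes the condition open. *)
  pose W := W0 `&` [set x | nbhs x [set x' | (W0 `&` sphere) x' -> O (g x')]].
  have oWW : open W.
    apply: openI => //; rewrite openE => x; rewrite /interior /= => nx.
    exact: nbhs_interior nx.
  have Wpy : W (p y).
    split=> //; apply: cgP; first by split=> //; exact: cover_sphere coverp y.
    by have [_ ->] := pU y Uy.
  exists (U `&` p @^-1` W), W, g; split; first split=> //.
  - by apply: openI => //; exact: preimage_open coverp _ oWW.
  - by apply: continuous_subspaceW cg => x [[]].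
  - by move=> x Wx sx; have [Ug pg] := gW x (conj Wx.1 sx); rewrite /preimage /= pg.
  - by move=> z [Uz Wz]; split=> //; have [_ ->] := pU z Uz.
  - move=> z [Uz [Wz nz]]; have [WS gE] := pU z Uz.
    by have := nbhs_singleton nz WS; rewrite gE.
have : (U1 `|` U2) y by rewrite U12.
by case=> Uy; [exact: aux h1|exact: aux h2].
Qed.

Lemma local_section_shrink y V W g (W' : set 'rV[R]_3) : local_section y V W g ->
  open W' -> W' (p y) -> local_section y (V `&` p @^-1` W') (W `&` W') g.
Proof.
move=> [oV Vy oW cg gP pP] oW' Wy; split.
- by apply: openI => //; exact: preimage_open coverp _ oW'.
- by split.
- exact: openI.
- by apply: continuous_subspaceW cg => x [[]].
- by move=> x [Wx W'x] sx; have [Vg pg] := gP x Wx sx; rewrite /preimage /= pg.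
- by move=> z [Vz W'z]; have [Wz gz] := pP z Vz.
Qed.

Lemma sqr_lt1 (r : R) : 0 < r -> r < 1 -> r ^+ 2 < 1.
Proof. by move=> r0 r1; rewrite expr2; nra. Qed.

Lemma sqr_sum_lt (z w s : R) : 0 < s -> z ^+ 2 + w ^+ 2 < s ^+ 2 -> `|z| < s /\ `|w| < s.
Proof.
move=> s0 h; have s0' := ltW s0.
by split; rewrite -(ger0_norm s0') -ltr_sqr ?nnegrE// !real_normK ?num_real//;
  have := sqr_ge0 z; have := sqr_ge0 w; lra.
Qed.

Definition rdisc (r : R) : set (R * R) := [set z | z.1 ^+ 2 + z.2 ^+ 2 < r ^+ 2].

Lemma rdisc_open r : open (rdisc r).
Proof.
rewrite (_ : rdisc r = (fun z : R * R => z.1 * z.1 + z.2 * z.2) @^-1` [set x | x < r ^+ 2]).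
  apply: open_comp; last exact: open_lt.
  move=> z _; have c1 := @Defs.continuous_fst R R z; have c2 := @Defs.continuous_snd R R z.
  exact: (cvgD (cvgM c1 c1) (cvgM c2 c2)).
by apply/seteqP; split=> z; rewrite /rdisc /= !expr2.
Qed.

Lemma rdisc_segment r (u v : R * R) (t : R) : rdisc r u -> rdisc r v -> 0 <= t <= 1 ->
  rdisc r ((1 - t) * u.1 + t * v.1, (1 - t) * u.2 + t * v.2).
Proof.
rewrite /rdisc /= => hu hv t01.
apply: le_lt_trans (_ : (u.1 ^+ 2 + u.2 ^+ 2) + t * ((v.1 ^+ 2 + v.2 ^+ 2) - (u.1 ^+ 2 + u.2 ^+ 2)) < _).
  rewrite -subr_ge0 (_ : _ - _ = t * (1 - t) * ((u.1 - v.1) ^+ 2 + (u.2 - v.2) ^+ 2)).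
    by rewrite mulr_ge0 ?addr_ge0 ?sqr_ge0// mulr_ge0; lra.
  by ring.
exact: segment_lt.
Qed.

(** A round disc is convex: its segments provide short paths on the cover and homotopies between
    paths with the same ends, at branch points as elsewhere. *)
Definition disc_chart (U : set L) (psi : L -> R * R) (y : L) : Prop :=
  [/\ open U, U y, psi y = (0, 0) & exists2 r, 0 < r & homeomorphism_on U (rdisc r) psi].

Lemma regular_disc_chart y (O : set L) : ~ vertex_set G (p y) -> nbhs y O ->
  exists U psi, disc_chart U psi y /\ U `<=` O.
Proof.
move=> vy Oy; have [V [W [g [ls VO]]]] := regular_section vy Oy.
have sy := cover_sphere coverp y.
have [a [b fr]] := exists_frame sy; have [xx aa bb xa xb ab d1] := fr.
have Wpy : W (p y) by have [] := ls_p ls (ls_V ls).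
have [q q0 qP] : exists2 q : R, 0 < q &
    forall X Y, `|X| < q -> `|Y| < q -> W (sphere_param (p y) a b X Y).
  have cp : {for (0, 0), continuous
      (fun z : R * R => sphere_param (p y) a b z.1 z.2)}.
    by apply: sphere_param_continuous; [exact: cvg_fst|exact: cvg_snd].
  have Wn : nbhs (sphere_param (p y) a b 0 0) W.
    by rewrite sphere_param0; apply: open_nbhs_nbhs; split=> //; exact: ls_openW ls.
  have /nbhs_ballP[q /= q0 qP] := cp _ Wn.
  exists q => // X1 Y1 hX hY; apply: (qP (X1, Y1)).
  by split; rewrite /ball /= sub0r normrN.
have [r [r0 rq r1 _ _]] := exists_lt4 q0 (@ltr01 R) (@ltr01 R) (@ltr01 R).
have r2 := sqr_lt1 r0 r1.
pose W' := [set x | 0 < dotv x (p y) /\ rad a b x < r].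
have oW' : open W'.
  rewrite openE => x [x1 x2]; rewrite /interior.
  have n1 : \forall z \near x, 0 < dotv z (p y).
    exact: (cvgr_gt _ (@continuous_dotv _ (p y) x)).
  have n2 : \forall z \near x, rad a b z < r.
    exact: (cvgr_lt _ (@rad_continuous _ a b x)).
  by apply: filterS2 n1 n2 => z; split.
have W'y : W' (p y) by split; [rewrite xx|rewrite /rad xa xb expr0n addr0 sqrtr0].
have ls' := local_section_shrink ls oW' W'y.
pose psi z := (dotv (p z) a, dotv (p z) b).
exists (V `&` p @^-1` W'), psi; split; last by move=> z [Vz _]; exact: VO.
split; [exact: ls_openV ls'|exact: ls_V ls'|by rewrite /psi xa xb|].
exists r => //; exists (fun z => g (sphere_param (p y) a b z.1 z.2)).
have in1 z : rdisc r z -> z.1 ^+ 2 + z.2 ^+ 2 < 1 by rewrite /rdisc /=; lra.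
have Wz z : rdisc r z -> (W `&` W') (sphere_param (p y) a b z.1 z.2) /\
    sphere (sphere_param (p y) a b z.1 z.2).
  move=> dz; have [z1 z2] := sqr_sum_lt r0 dz; have z3 := in1 z dz.
  split; last by apply: sphere_param_sphere => //; exact: ltW.
  split; first by apply: qP; lra.
  split; first by rewrite sphere_param_x// sqrtr_gt0; lra.
  by rewrite /rad sphere_param_a// sphere_param_b// -(gtr0_norm r0) -sqrtr_sqr
    ltr_sqrt// exprn_gt0.
split.
- have cpsi : continuous psi.
    have c w : continuous (fun z => dotv (p z) w).
      move=> z; apply: (@continuous_comp _ _ _ p (fun x => dotv x w)).
        exact: cover_cont coverp z.
      exact: continuous_dotv.
    by apply: continuous_pair; exact: c.
  exact: continuous_subspaceT.
- apply: (@within_continuous_comp _ _ _ _ (W `&` sphere)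
    (fun z : R * R => sphere_param (p y) a b z.1 z.2) g); last exact: ls_cont ls.
    apply: continuous_subspaceT => z.
    by apply: sphere_param_continuous; [exact: cvg_fst|exact: cvg_snd].
  by move=> z /Wz[[]].
- move=> z [Vz [z1 z2]]; split.
    move: z2; rewrite /rad /rdisc /psi /= => z2.
    by rewrite -(sqr_sqrtr (addr_ge0 (sqr_ge0 _) (sqr_ge0 _))) ltr_pXn2r// nnegrE ?sqrtr_ge0 ?ltW.
  rewrite /psi /= sphere_paramK//; last exact: cover_sphere coverp z.
  by have [] := ls_p ls Vz.
- move=> z dz; have [Wz1 Sz] := Wz z dz; have [Vg pg] := ls_g ls' Wz1 Sz.
  split=> //; rewrite /psi pg sphere_param_a// sphere_param_b//; by case: (z).
Qed.

(** In the chart of [branched2] the projection is the squaring map, which vanishes at the origin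
    only: so [y] is the centre, and the only point of the chart above its vertex. The other vertices
    form a finite set, avoided by taking [r] small. *)
Lemma vertex_disc_chart y (O : set L) : vertex_set G (p y) -> nbhs y O ->
  exists U psi, [/\ disc_chart U psi y, U `<=` O
    & forall z, U z -> z <> y -> ~ vertex_set G (p z)].
Proof.
move=> vy Oy; have [v _ vE] := vy.
have [W [phi [psi [[oW Wy] phi0 _ [g [cpsi cg psiW gW]] sq]]]] := cover_branch coverp vy.
pose K := (@pos R G) @` [set w | w != v].
have cK : closed K.
  apply: compact_closed; first exact: norm_hausdorff.
  by apply: finite_compact; apply: finite_image; exact: finite_finset.
have Ky : ~ K (p y) by case=> w /= wv wE; move/eqP: wv; apply; apply: (@pos_inj R G); rewrite wE.
have psi0 z : W (p z) -> p z = p y -> psi z = (0, 0).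
  move=> Wz zy; have := sq z Wz; rewrite zy phi0 /csqr.
  case: (psi z) => u w /= [/esym h1 /esym h2].
  (* The modulus of a complex square is the square of the modulus. *)
  have : (u ^+ 2 + w ^+ 2) ^+ 2 = 0.
    transitivity ((u ^+ 2 - w ^+ 2) ^+ 2 + (2 * u * w) ^+ 2); first by ring.
    by rewrite h1 h2 expr0n /= addr0.
  move=> /eqP; rewrite sqrf_eq0 => /eqP h.
  by have [-> ->] : u = 0 /\ w = 0 by split; nra.
have y0 := psi0 y Wy erefl.
have gy : g (0, 0) = y by rewrite -y0; have [_ ->] := psiW y Wy.
have d00 : disc ((0, 0) : R * R) by rewrite /disc /= expr0n addr0.
have nO : nbhs (g (0, 0)) (O `&` p @^-1` (~` K)).
  rewrite gy; apply: filterI => //; apply: open_nbhs_nbhs; split=> //.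
  exact: preimage_open coverp _ (closed_openC cK).
have /nbhs_ballP[q /= q0 qP] := (within_continuousP _ _).1 cg _ d00 _ nO.
have [r [r0 rq r1 _ _]] := exists_lt4 q0 (@ltr01 R) (@ltr01 R) (@ltr01 R).
have r2 := sqr_lt1 r0 r1.
have dd z : rdisc r z -> disc z := fun h => lt_trans h r2.
have gO z : rdisc r z -> (O `&` p @^-1` (~` K)) (g z).
  move=> dz; have [z1 z2] := sqr_sum_lt r0 dz; apply: qP; last exact: dd.
  by split; rewrite /ball /= sub0r normrN; [apply: lt_trans z1 rq|apply: lt_trans z2 rq].
pose U := p @^-1` W `&` psi @^-1` (rdisc r).
have odisc : open (rdisc r) by exact: rdisc_open.
have UO z : U z -> (O `&` p @^-1` (~` K)) z.
  by move=> [Wz dz]; have [_ <-] := psiW z Wz; exact: gO.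
exists U, psi; split.
- split=> //.
  + rewrite openE => z [Wz dz]; rewrite /interior.
    have nW : nbhs z (p @^-1` W).
      by apply: open_nbhs_nbhs; split=> //; exact: preimage_open coverp _ oW.
    have nd : nbhs (psi z) (rdisc r) by apply: open_nbhs_nbhs.
    have := (within_continuousP _ _).1 cpsi z Wz _ nd.
    by move=> nz; apply: filterS2 nW nz => w Ww /(_ Ww); split.
  + by split=> //; rewrite /preimage /= y0 /rdisc /= expr0n /= addr0 exprn_gt0.
  exists r => //; exists g; split.
  + by apply: continuous_subspaceW cpsi => z [].
  + by apply: continuous_subspaceW cg => z /dd.
  + by move=> z [Wz dz]; have [_ gz] := psiW z Wz.
  + move=> z dz; have [Wg pg] := gW z (dd z dz); split=> //.
    by split=> //; rewrite /preimage /= pg.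
- by move=> z /UO[].
- move=> z Uz zy [w _ wz]; have [_ nKz] := UO z Uz.
  have wv : w = v.
    by apply/eqP/negPn/negP => wv; apply: nKz; exists w.
  apply: zy; have [Wz _] := Uz.
  have zE : psi z = (0, 0) by apply: psi0 => //; rewrite -wz wv vE.
  by have [_ <-] := psiW z Wz; rewrite zE.
Qed.

End Charts.

(** * Local connectedness by generic paths *)

Section Joining.
Variables (R : realType) (G : plane_graph R).
Variables (L : topologicalType) (p : L -> 'rV[R]_3).
Hypothesis coverp : branched_double_cover G p.
Local Notation off := (off_graph G p).
Local Notation gpath := (gpath G p).

(** The joining paths may leave [V] but not [O], so that they can be chains through several
    charts. *)
Definition generically_connected (V O : set L) : Prop :=
  [/\ open V, V `<=` O, exists z, V z /\ off z
    & forall z z', V z -> V z' -> off z -> off z' -> gpath O z z'].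

Lemma segment_coord (x y : R) : continuous (fun t : R => (1 - t) * x + t * y).
Proof.
have -> : (fun t => (1 - t) * x + t * y) = (fun t => (y - x) * t + x).
  by apply/funext => z; ring.
by move=> t; apply: (@is_derive_continuous _ R); exact: is_derive_affine.
Qed.

Lemma segment_path (T : topologicalType) (r : R) (g : R * R -> T) u v :
  {within rdisc r, continuous g} -> rdisc r u -> rdisc r v ->
  {within `[0, 1], continuous
     (fun t : R => g ((1 - t) * u.1 + t * v.1, (1 - t) * u.2 + t * v.2))}.
Proof.
move=> cg du dv; apply: (@within_continuous_comp _ _ _ _ (rdisc r)
  (fun t : R => ((1 - t) * u.1 + t * v.1, (1 - t) * u.2 + t * v.2)) g); last exact: cg.
- apply: continuous_subspaceT; apply: continuous_pair; exact: segment_coord.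
- by move=> t; rewrite /= in_itv /= => t01; exact: (@rdisc_segment R r u v t du dv t01).
Qed.

Lemma face_join y (O : set L) : off y -> nbhs y O ->
  exists2 V, V y & generically_connected V O.
Proof.
move=> oy Oy.
have vy : ~ vertex_set G (p y) by move=> vy; apply: oy; left.
have nO : nbhs y (O `&` off).
  by apply: filterI => //; apply: open_nbhs_nbhs; split=> //; exact: off_open coverp.
have [U [psi [[oU Uy psiy [r r0 [g [cpsi cg Upsi gU]]]] UO]]] := regular_disc_chart coverp vy nO.
exists U => //; split=> //.
- by move=> z /UO[].
- by exists y.
move=> z z' Uz Uz' _ _; have [dz gz] := Upsi z Uz; have [dz' gz'] := Upsi z' Uz'.
pose c (t : R) := g ((1 - t) * (psi z).1 + t * (psi z').1, (1 - t) * (psi z).2 + t * (psi z').2).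
have c0 : c 0 = z by rewrite /c subr0 !mul1r !mul0r !addr0 -surjective_pairing.
have c1 : c 1 = z' by rewrite /c subrr !mul1r !mul0r !add0r -surjective_pairing.
rewrite -c0 -c1; apply: gpath_off; first exact: segment_path.
move=> t t01; have [Ug _] := gU _ (rdisc_segment dz dz' t01).
exact: UO.
Qed.

(** Two points on one side are joined off the graph by [ts_join]; a single path across the edge,
    traversed either way, links the two sides. The paths are lifted by the local section [g]. *)
Lemma edge_join y (O : set L) : ~ vertex_set G (p y) -> graph_set G (p y) -> nbhs y O ->
  exists2 V, V y & generically_connected V O.
Proof.
move=> vy gy Oy; have [e [s [s01 ys]]] := graph_set_edge gy vy.
have [V [W [g [ls VO]]]] := regular_section coverp vy Oy.
have Wn : nbhs (arc e s) W.
  rewrite -ys; apply: open_nbhs_nbhs; split; first exact: ls_openW ls.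
  by have [] := ls_p ls (ls_V ls).
have [W1 [zeta [ts W1s WW]]] := edge_chart s01 Wn.
have sp z : sphere (p z) := cover_sphere coverp z.
pose V1 := V `&` p @^-1` W1.
have lift (c : R -> 'rV[R]_3) : (forall t, 0 <= t <= 1 ->
      [/\ {for t, continuous c}, W1 (c t) & sphere (c t)]) ->
    {within `[0, 1], continuous (g \o c)} /\
    forall t, 0 <= t <= 1 -> [/\ V (g (c t)), p (g (c t)) = c t & O (g (c t))].
  move=> cP; split.
    apply: within_continuous_comp (ls_cont ls).
      by apply: within_pointwise => t /cP[].
    by move=> t; rewrite /= in_itv /= => /cP[_ h1 h2]; split=> //; exact: WW.
  move=> t /cP[_ h1 h2]; have [Vg pg] := ls_g ls (WW _ h1 h2) h2.
  by split=> //; exact: VO.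
have same z z' : V1 z -> V1 z' -> 0 < zeta (p z) * zeta (p z') -> gpath O z z'.
  move=> [Vz Wz] [Vz' Wz'] zz; have [c [c0 c1 cP]] := ts_join ts Wz Wz' (sp z) (sp z') zz.
  have [|cc gP] := lift c; first by move=> t /cP[].
  have e0 : z = (g \o c) 0 by rewrite /= c0; have [_ ->] := ls_p ls Vz.
  have e1 : z' = (g \o c) 1 by rewrite /= c1; have [_ ->] := ls_p ls Vz'.
  rewrite e0 e1; apply: gpath_off cc _ => t t01.
  have [_ W1c sc ct0] := cP t t01; have [_ pg Og] := gP t t01.
  split=> //; rewrite /off_graph /= pg => /(ts_graph ts W1c sc) zc.
  by move: ct0; rewrite zc mulr0 ltxx.
have [c [c0 c1 cP [t [u [d [t01 cr cn]]]]]] := ts_across ts.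
have [cc gP] := lift c cP.
have V1c z : 0 <= z <= 1 -> V1 (g (c z)).
  move=> z01; have [Vg pg _] := gP z z01; split=> //.
  by rewrite /preimage /= pg; have [] := cP z z01.
have across : gpath O (g (c 0)) (g (c 1)).
  exists (g \o c); split=> //; split=> //.
    by move=> z /gP[].
  split=> z z01 /=; have [_ pg _] := gP z z01; have [_ W1z sz] := cP z z01; rewrite pg.
    exact: ts_vertex ts _ W1z sz.
  move=> /(ts_graph ts W1z sz) z0.
  have zt : z = t by apply/eqP/negPn/negP => /(cn z z01); rewrite z0 eqxx.
  rewrite zt; split=> //; exists e, u, d; apply: crosses_near cr.
  by apply: filterS (near_itv t01) => w w01 /=; have [_ -> _] := gP w w01.
have I0 : 0 <= (0 : R) <= 1 by lra.
have I1 : 0 <= (1 : R) <= 1 by lra.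
have [_ p0 _] := gP 0 I0; have [_ p1 _] := gP 1 I1.
exists V1; first by split; [exact: ls_V ls|rewrite /preimage /= ys].
split.
- by apply: openI; [exact: ls_openV ls|exact: preimage_open coverp _ (ts_open ts)].
- by move=> z [Vz _]; exact: VO.
- exists (g (c 0)); split; first exact: V1c.
  have [_ W10 s0] := cP 0 I0; rewrite /off_graph /= p0 => /(ts_graph ts W10 s0) z0.
  by move: c0; rewrite z0 ltxx.
move=> z z' V1z V1z' oz oz'.
have nz w : V1 w -> off w -> zeta (p w) != 0.
  by move=> [Vw Ww] ow; apply/eqP => /(ts_graph ts Ww (sp w)).
have [z0|z0] := ltP 0 (zeta (p z)); have [z'0|z'0] := ltP 0 (zeta (p z')).
- by apply: same => //; rewrite mulr_gt0.
- have {}z'0 : zeta (p z') < 0 by rewrite lt_neqAle nz.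
  apply: gpath_trans (gpath_trans across _).
    by apply: same => //; [exact: V1c|rewrite p0 mulr_gt0].
  by apply: same => //; [exact: V1c|rewrite p1 nmulr_rgt0].
- have {}z0 : zeta (p z) < 0 by rewrite lt_neqAle nz.
  apply: gpath_trans (gpath_trans (gpath_sym across) _).
    by apply: same => //; [exact: V1c|rewrite p1 nmulr_rgt0].
  by apply: same => //; [exact: V1c|rewrite p0 mulr_gt0].
- have {}z0 : zeta (p z) < 0 by rewrite lt_neqAle nz.
  have {}z'0 : zeta (p z') < 0 by rewrite lt_neqAle nz.
  by apply: same => //; rewrite nmulr_rgt0.
Qed.

Lemma regular_join y (O : set L) : ~ vertex_set G (p y) -> nbhs y O ->
  exists2 V, V y & generically_connected V O.
Proof.
move=> vy Oy; have [gy|gy] := pselect (graph_set G (p y)); first exact: edge_join.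
exact: face_join.
Qed.

(** A segment between two linearly independent vectors avoids the origin. Dependent vectors are
    linked through the quarter turn of [u], independent of both and of the same length as [u]. *)
Lemma punctured_disc_const (K : Type) (r : R) (k : R * R -> K) u v : 0 < r ->
  (forall w, rdisc r w -> w <> (0, 0) ->
     nbhs w [set w' | rdisc r w' /\ w' <> (0, 0) -> k w' = k w]) ->
  rdisc r u -> rdisc r v -> u <> (0, 0) -> v <> (0, 0) -> k u = k v.
Proof.
move=> r0 kc.
have seg a b : rdisc r a -> rdisc r b -> a.1 * b.2 - a.2 * b.1 != 0 -> k a = k b.
  move=> da db ab.
  pose c (t : R) := ((1 - t) * a.1 + t * b.1, (1 - t) * a.2 + t * b.2).
  have c0 : c 0 = a by rewrite /c subr0 !mul1r !mul0r !addr0 -surjective_pairing.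
  have c1 : c 1 = b by rewrite /c subrr !mul1r !mul0r !add0r -surjective_pairing.
  rewrite -c0 -c1; apply: (@locally_constant_path R _ _ k
    [set w | rdisc r w /\ w <> (0, 0)] c 0 1 ler01).
  - apply: (@segment_path _ r id a b) => //; apply: continuous_subspaceT => w; exact: cvg_id.
  - move=> t t01; split; first exact: (@rdisc_segment R r a b t da db t01).
    move=> [e1 e2]; move: ab; apply/negP/negPn/eqP.
    have [t0|t0] := eqVneq t 0.
      by move: e1 e2; rewrite t0 subr0 !mul1r !mul0r !addr0 => -> ->; ring.
    apply: (mulfI t0).
    transitivity (a.1 * ((1 - t) * a.2 + t * b.2) - a.2 * ((1 - t) * a.1 + t * b.1)).
      by ring.
    by rewrite e1 e2; ring.
  - by move=> w [dw w0]; exact: kc.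
move=> du dv u0 v0.
have [uv|uv] := eqVneq (u.1 * v.2 - u.2 * v.1) 0; last exact: seg.
have sq (w : R * R) : w <> (0, 0) -> 0 < w.1 ^+ 2 + w.2 ^+ 2.
  case: w => x y w0 /=; rewrite lt_neqAle addr_ge0 ?sqr_ge0// andbT eq_sym.
  apply/eqP => h; apply: w0; have [-> ->] : x = 0 /\ y = 0; last by [].
  by split; nra.
pose m : R * R := (- u.2, u.1).
have dm : rdisc r m by move: du; rewrite /rdisc /= sqrrN addrC.
transitivity (k m); apply: seg => //.
  by rewrite /= mulrN opprK -!expr2 gt_eqF// sq.
rewrite /= mulNr -opprD oppr_eq0; apply/eqP => h.
have h1 : (u.1 ^+ 2 + u.2 ^+ 2) * (v.1 ^+ 2 + v.2 ^+ 2) = 0.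
  transitivity ((u.1 * v.2 - u.2 * v.1) ^+ 2 + (u.2 * v.2 + u.1 * v.1) ^+ 2); first by ring.
  by rewrite uv h expr0n /= addr0.
by have := mulr_gt0 (sq u u0) (sq v v0); rewrite h1 ltxx.
Qed.

(** The disc minus its centre consists of regular points, near each of which [regular_join] applies.
    The property [S], that everything off the graph and close enough can be reached from [z], is
    therefore locally constant on the punctured disc, hence constant; it holds at [z], so also at
    [z']. *)
Lemma vertex_join y (O : set L) : vertex_set G (p y) -> nbhs y O ->
  exists2 V, V y & generically_connected V O.
Proof.
move=> vy Oy.
have [U [psi [[oU Uy psiy [r r0 [g [cpsi cg Upsi gU]]]] UO Ureg]]] := vertex_disc_chart coverp vy Oy.
have gnz w : rdisc r w -> w <> (0, 0) -> U (g w) /\ g w <> y.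
  move=> dw w0; have [Ug pg] := gU w dw; split=> // gy; apply: w0.
  by rewrite -pg gy psiy.
have nO z : U z -> nbhs z O.
  by move=> Uz; apply: (filterS UO); apply: open_nbhs_nbhs.
have offy z : off z -> z <> y by move=> oz zy; apply: oz; rewrite zy; left.
exists U => //; split=> //.
  have d2 : rdisc r (r / 2, 0).
    by rewrite /rdisc /= expr0n addr0; nra.
  have n2 : (r / 2, 0) <> (0, 0) :> R * R by case=> /eqP; rewrite gt_eqF//; lra.
  have [Ug gy] := gnz _ d2 n2.
  have nU : nbhs (g (r / 2, 0)) U by apply: open_nbhs_nbhs.
  have [V Vg [oV VU [z [Vz oz]] _]] := regular_join (Ureg _ Ug gy) nU.
  by exists z; split=> //; exact: VU.
move=> z z' Uz Uz' oz oz'.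
pose S w : Prop := \forall x \near g w, off x -> gpath O z x.
have Sc w : rdisc r w -> w <> (0, 0) ->
    nbhs w [set w' | rdisc r w' /\ w' <> (0, 0) -> S w' = S w].
  move=> dw w0; have [Ug gy] := gnz w dw w0.
  have [V Vg [oV VO _ jV]] := regular_join (Ureg _ Ug gy) (nO _ Ug).
  have nV : nbhs (g w) V by apply: open_nbhs_nbhs.
  (* A point of [V] off the graph and close to [g w1] is reachable from [z], and serves as a relay
     to the points close to [g w2]. *)
  have key w1 w2 : rdisc r w1 -> w1 <> (0, 0) -> V (g w1) -> V (g w2) -> S w1 -> S w2.
    move=> d1 n1 V1 V2 S1; have [U1 y1] := gnz w1 d1 n1.
    have nV1 : nbhs (g w1) (V `&` [set x | off x -> gpath O z x]).
      by apply: filterI => //; apply: open_nbhs_nbhs.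
    have [V' V'g [oV' V'V [x [V'x ox]] _]] := regular_join (Ureg _ U1 y1) nV1.
    have [Vx zx] := V'V x V'x.
    have nV2 : nbhs (g w2) V by apply: open_nbhs_nbhs.
    rewrite /S; near=> x' => ox'; apply: gpath_trans (zx ox) _; apply: jV => //.
    by near: x'.
  have := (within_continuousP _ _).1 cg w dw V nV.
  apply: filterS => w' Vw' [dw' n'].
  apply/propext; split; [exact: (key _ _ dw' n' (Vw' dw') Vg)|exact: (key _ _ dw w0 Vg (Vw' dw'))].
have psin x : U x -> off x -> rdisc r (psi x) /\ psi x <> (0, 0).
  move=> Ux ox; have [dx gx] := Upsi x Ux; split=> // x0.
  by apply: (offy x ox); rewrite -gx x0 -psiy; have [_ ->] := Upsi y Uy.
have [dz nz] := psin z Uz oz; have [dz' nz'] := psin z' Uz' oz'.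
have Sz : S (psi z).
  have [_ gz] := Upsi z Uz; rewrite /S gz.
  have [V Vz [oV VO _ jV]] := face_join oz (nO z Uz).
  have nV : nbhs z V by apply: open_nbhs_nbhs.
  by near=> x => ox; apply: jV => //; near: x.
have := punctured_disc_const r0 Sc dz dz' nz nz'.
have [_ gz'] := Upsi z' Uz'.
move=> SE; move: Sz; rewrite SE /S gz' => /nbhs_singleton; exact.
Unshelve. all: by end_near.
Qed.

Lemma join y (O : set L) : nbhs y O -> exists2 V, V y & generically_connected V O.
Proof.
move=> Oy; have [vy|vy] := pselect (vertex_set G (p y)); first exact: vertex_join.
exact: regular_join.
Qed.

Lemma off_dense (y : L) (O : set L) : nbhs y O -> exists z, O z /\ off z.
Proof.
by move=> /join[V Vy [_ VO [z [Vz oz]] _]]; exists z; split=> //; exact: VO.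
Qed.

Lemma disc_chart_exists (y : L) (O : set L) : nbhs y O ->
  exists U (psi : L -> R * R), disc_chart U psi y /\ U `<=` O.
Proof.
move=> Oy; have [vy|vy] := pselect (vertex_set G (p y)); last by apply: (@regular_disc_chart R G L p coverp y O vy Oy).
by have [U [psi [h1 h2 _]]] := vertex_disc_chart coverp vy Oy; exists U, psi.
Qed.

End Joining.

(** * Continuation of potentials *)

Section Lifts.
Variables (R : realType) (G : plane_graph R).
Variables (L : topologicalType) (p : L -> 'rV[R]_3) (sheet : L -> bool).
Hypothesis triG : trivalent G.
Hypothesis coverp : branched_double_cover G p.
Hypothesis labp : sheet_labelling G p sheet.
Local Notation off := (off_graph G p).
Local Notation gpath := (gpath G p).
Local Notation potential := (potential (G := G) p sheet).
Implicit Types (phi psi : L -> Pi G) (sg : R -> L -> Pi G) (c : R -> L) (a b t : R).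

Lemma potential_sub (U V : set L) phi : V `<=` U -> potential U phi -> potential V phi.
Proof.
move=> VU [po pc]; split=> [c a b ab cc cV|c a b t l sc cV].
  by apply: po => // t /cV[/VU].
by apply: (pc c a b t l sc) => u /cV /VU.
Qed.

Lemma potential_mulg (U : set L) phi (k : Pi G) : potential U phi ->
  potential U (fun z => k * phi z)%g.
Proof.
move=> [po pc]; split=> [c a b ab cc cV|c a b t l sc cV].
  by rewrite (po c a b).
by rewrite (pc c a b t l sc)// mulgA.
Qed.

(** At a crossing both potentials are multiplied on the right by the same letter, which cancels in
    the quotient. *)
Lemma potential_ratio (U : set L) phi psi y z : potential U phi -> potential U psi ->
  gpath U y z -> (phi y * (psi y)^-1 = phi z * (psi z)^-1)%g.
Proof.
move=> [po pc] [po' pc'] [c [[cc cU cg] <- <-]].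
apply: (generic_ind coverp labp (P := fun x x' =>
  phi (c x) * (psi (c x))^-1 = phi (c x') * (psi (c x'))^-1)%g ler01 cc cg).
- move=> x x' x0 xx' x'1 oc.
  have cc' : {within `[x, x'], continuous c} by apply: within_sub cc.
  have cU' t : x <= t <= x' -> U (c t) /\ off (c t).
    by move=> tx; split; [apply: cU; lra|exact: oc].
  by rewrite (po c x x')// (po' c x x').
- move=> x x' t l x0 x'1 sc.
  have cU' u : x <= u <= x' -> U (c u) by move=> ux; apply: cU; lra.
  by rewrite (pc c x x' t l sc cU') (pc' c x x' t l sc cU') invgM mulgA mulgK.
- by move=> x x' z' _ _ _ _ _ ->.
Qed.

(** Values on the graph are ignored, since a potential says nothing there; by [off_dense] the
    condition is never vacuous. *)
Definition germ_eq (y : L) phi psi : Prop := \forall z \near y, off z -> phi z = psi z.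

Definition local_at (y : L) phi : Prop := exists U, [/\ open U, U y & potential U phi].

Lemma germ_eq_sym y phi psi : germ_eq y phi psi -> germ_eq y psi phi.
Proof. by apply: filterS => z h /h. Qed.

Lemma germ_eq_trans y phi psi chi : germ_eq y phi psi -> germ_eq y psi chi -> germ_eq y phi chi.
Proof. by apply: filterS2 => z h1 h2 oz; rewrite h1 ?h2. Qed.

Lemma local_at_mulg y phi k : local_at y phi -> local_at y (fun z => k * phi z)%g.
Proof. by move=> [U [oU Uy pU]]; exists U; split=> //; exact: potential_mulg. Qed.

Lemma potential_ratio_near y phi psi : local_at y phi -> local_at y psi ->
  exists V, [/\ open V, V y, exists z, V z /\ off z
    & forall z w, V z -> V w -> off z -> off w ->
      (phi z * (psi z)^-1 = phi w * (psi w)^-1)%g].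
Proof.
move=> [U [oU Uy pU]] [U' [oU' U'y pU']].
have nO : nbhs y (U `&` U') by apply: open_nbhs_nbhs; split=> //; exact: openI.
have [V Vy [oV _ offV jV]] := join coverp nO.
have pO := potential_sub (@subIsetl _ U U') pU.
have pO' := potential_sub (@subIsetr _ U U') pU'.
by exists V; split=> // z w Vz Vw oz ow; exact: potential_ratio (jV z w Vz Vw oz ow).
Qed.

(** The quotient is the same at all points of [V] off the graph; if it is 1 at one of them close to
    [x], it is 1 at all. *)
Lemma germ_eq_spread y phi psi : local_at y phi -> local_at y psi ->
  exists V, [/\ open V, V y & forall x x', V x -> V x' ->
    germ_eq x phi psi -> germ_eq x' phi psi].
Proof.
move=> lphi lpsi; have [V [oV Vy _ ratio]] := potential_ratio_near lphi lpsi.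
exists V; split=> // x x' Vx Vx' xx.
have nV z : V z -> nbhs z V by move=> Vz; apply: open_nbhs_nbhs.
have [z [[Vz zz] oz]] := off_dense coverp (filterI (nV x Vx) xx).
apply: filterS (nV x' Vx') => w Vw ow.
have := ratio z w Vz Vw oz ow; rewrite (zz oz) mulgV => h.
by rewrite -[LHS](mulgVK (psi w)) -h mul1g.
Qed.

Lemma germ_eq_mulg y phi psi : local_at y phi -> local_at y psi ->
  exists k, germ_eq y phi (fun z => k * psi z)%g.
Proof.
move=> lphi lpsi; have [V [oV Vy [z [Vz oz]] ratio]] := potential_ratio_near lphi lpsi.
exists (phi z * (psi z)^-1)%g; have nV : nbhs y V by apply: open_nbhs_nbhs.
by apply: filterS nV => w Vw ow; rewrite (ratio z w Vz Vw oz ow) mulgVK.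
Qed.

(* [sg t] is, near [c t], the continuation along [c] of a local potential. *)
Definition lift c a b sg : Prop := forall t, a <= t <= b ->
  exists2 phi, local_at (c t) phi &
    \forall u \near t, a <= u <= b -> germ_eq (c u) (sg u) phi.

Lemma lift_sub c a b a' b' sg : a <= a' -> b' <= b -> lift c a b sg -> lift c a' b' sg.
Proof.
move=> aa bb ls t tab; have [|phi lp nt] := ls t; first lra.
by exists phi => //; move: nt; apply: filterS => u h uab; apply: h; lra.
Qed.

Lemma lift_cst c a b (U : set L) phi : open U -> potential U phi ->
  (forall t, a <= t <= b -> U (c t)) -> lift c a b (fun=> phi).
Proof.
move=> oU pU cU t tab; exists phi; first by exists U; split=> //; exact: cU.
by apply: (@filterE _ (nbhs t)) => u _; exact: (@filterE _ (nbhs (c u))).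
Qed.

Lemma lift_ext c c' a b sg : (forall t, a <= t <= b -> c t = c' t) ->
  lift c a b sg -> lift c' a b sg.
Proof.
move=> cc ls t tab; rewrite -cc//; have [phi lp nt] := ls t tab.
by exists phi => //; move: nt; apply: filterS => u h uab; rewrite -cc//; exact: h.
Qed.

Lemma lift_affine c (k l a b : R) sg : 0 < k -> lift c (k * a + l) (k * b + l) sg ->
  lift (fun t => c (k * t + l)) a b (fun t => sg (k * t + l)).
Proof.
move=> k0 ls t tab; have [|phi lp nt] := ls (k * t + l); first by nra.
exists phi => //.
have cont : {for t, continuous (fun t : R => k * t + l)}.
  exact: is_derive_continuous (is_derive_affine k l t).
have nt' : \forall u \near t, k * a + l <= k * u + l <= k * b + l ->
  germ_eq (c (k * u + l)) (sg (k * u + l)) phi by exact: (cont _ nt).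
by near=> u => uab; have : k * a + l <= k * u + l <= k * b + l by [nra]; near: u.
Unshelve. all: by end_near.
Qed.

Lemma lift_local c a b t sg : lift c a b sg -> a <= t <= b ->
  exists2 phi, local_at (c t) phi & germ_eq (c t) (sg t) phi.
Proof.
by move=> ls tab; have [phi lp /nbhs_singleton h] := ls t tab; exists phi => //; exact: h.
Qed.

Lemma lift_unique c a b sg sg' : a <= b -> {within `[a, b], continuous c} ->
  lift c a b sg -> lift c a b sg' -> germ_eq (c a) (sg a) (sg' a) ->
  germ_eq (c b) (sg b) (sg' b).
Proof.
move=> ab cc ls ls'.
apply: (@cousin R (fun x y => germ_eq (c x) (sg x) (sg' x) -> germ_eq (c y) (sg y) (sg' y)) a b ab).
  by move=> x y z _ _ _ _ h1 h2 /h1.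
move=> t tab; have [phi lp nt] := ls t tab; have [phi' lp' nt'] := ls' t tab.
have [V [oV Vt Vs]] := germ_eq_spread lp lp'.
have nV := path_near cc tab oV Vt.
exists [set u | [/\ a <= u <= b -> V (c u), a <= u <= b -> germ_eq (c u) (sg u) phi
    & a <= u <= b -> germ_eq (c u) (sg' u) phi']].
  by near=> u; split; near: u.
move=> x y ax xt ty yb nb.
have [Vx gx gx'] := nb x ltac:(lra); have [Vy gy gy'] := nb y ltac:(lra).
have xI : a <= x <= b by lra.
have yI : a <= y <= b by lra.
move=> gxx; apply: germ_eq_trans (gy yI) _; apply: germ_eq_trans (germ_eq_sym (gy' yI)).
apply: (Vs (c x) (c y) (Vx xI) (Vy yI)).
apply: germ_eq_trans (germ_eq_sym (gx xI)) _; exact: germ_eq_trans (gx' xI).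
Unshelve. all: by end_near. Qed.

Lemma lift_glue c (a m b : R) sg sg' : a <= m -> m <= b -> {within `[a, b], continuous c} ->
  lift c a m sg -> lift c m b sg' -> germ_eq (c m) (sg m) (sg' m) ->
  lift c a b (fun t => if t <= m then sg t else sg' t).
Proof.
move=> am mb cc ls ls' mm t tab.
have [tm|mt|tm] := ltgtP t m.
- have [|phi lp nt] := ls t; first lra.
  exists phi => //; near=> u => uab.
  have um : u < m by near: u; exact: lt_nbhsl.
  by rewrite (ltW um); (have : a <= u <= m by lra); near: u.
- have [|phi lp nt] := ls' t; first lra.
  exists phi => //; near=> u => uab.
  have um : m < u by near: u; exact: lt_nbhsr.
  by rewrite leNgt um /=; (have : m <= u <= b by lra); near: u.
subst t; have [|phi lp nt] := ls m; first lra.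
have [|phi' lp' nt'] := ls' m; first lra.
exists phi => //.
have [V [oV Vm Vs]] := germ_eq_spread lp' lp.
have nV := path_near cc tab oV Vm.
(* At the junction the local potentials of the two lifts have the same germ, so that of the first
   lift serves on both sides. *)
have h : germ_eq (c m) phi' phi.
  have h1 := nbhs_singleton nt ltac:(lra); have h2 := nbhs_singleton nt' ltac:(lra).
  apply: germ_eq_trans (germ_eq_sym h2) _; exact: germ_eq_trans (germ_eq_sym mm) h1.
near=> u => uab; have [um|mu] := leP u m.
  by (have : a <= u <= m by lra); near: u.
apply: (@germ_eq_trans _ _ phi'); first by (have : m <= u <= b by lra); near: u.
have Vu : V (c u) by move: uab; near: u.
exact: (Vs _ _ Vm Vu).
Unshelve. all: by end_near. Qed.

Lemma lift_exists c a b phi : a <= b -> {within `[a, b], continuous c} ->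
  local_at (c a) phi -> exists2 sg, lift c a b sg & germ_eq (c a) (sg a) phi.
Proof.
move=> ab cc.
(* The initial potential is quantified inside the relation, as transitivity restarts at the middle
   point with the potential reached there. *)
pose P x y := {within `[x, y], continuous c} -> forall phi, local_at (c x) phi ->
  exists2 sg, lift c x y sg & germ_eq (c x) (sg x) phi.
suff : P a b by move=> h; exact: h.
apply: (@cousin R P a b ab) => {phi}.
  move=> x y z ax xy yz zb Pxy Pyz cxz phi lx.
  have cxy : {within `[x, y], continuous c} by exact: within_sub cxz.
  have cyz : {within `[y, z], continuous c} by exact: within_sub cxz.
  have [sg ls gx] := Pxy cxy phi lx.
  have [|psi lpsi gpsi] := lift_local ls (t := y); first by rewrite xy lexx.
  have [sg' ls' gy] := Pyz cyz psi lpsi.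
  exists (fun t => if t <= y then sg t else sg' t); last by rewrite xy.
  apply: lift_glue => //; exact: germ_eq_trans gpsi (germ_eq_sym gy).
move=> t tab; have [U [psi [oU Ut pU]]] := local_potential triG coverp labp (c t).
exists [set u | a <= u <= b -> U (c u)]; first exact: path_near cc tab oU Ut.
move=> x y ax xt ty yb nb cxy phi lx.
have cU u : x <= u <= y -> U (c u) by move=> ux; apply: nb => //; lra.
have lpsi : local_at (c x) psi by exists U; split=> //; apply: cU; lra.
have [k gk] := germ_eq_mulg lx lpsi.
exists (fun=> (fun z => k * psi z)%g); last exact: germ_eq_sym.
by apply: (lift_cst (U := U)) => //; exact: potential_mulg.
Qed.

Lemma lift_off c a b sg : a <= b -> {within `[a, b], continuous c} -> lift c a b sg ->
  (forall t, a <= t <= b -> off (c t)) -> sg a (c a) = sg b (c b).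
Proof.
move=> ab cc ls oc.
apply: (@cousin R (fun x y => sg x (c x) = sg y (c y)) a b ab).
  by move=> x y z _ _ _ _ -> ->.
move=> t tab; have [phi [U [oU Ut [po _]]] nt] := ls t tab.
exists [set u | a <= u <= b -> U (c u) /\ germ_eq (c u) (sg u) phi].
  have nU := path_near cc tab oU Ut.
  by near=> u => uab; split; move: uab; near: u.
move=> x y ax xt ty yb nb.
have vE u : x <= u <= y -> sg u (c u) = phi (c u).
  move=> uxy; have uab : a <= u <= b by lra.
  by have [_ /nbhs_singleton] := nb u uxy uab; apply; exact: oc.
have hx : x <= x <= y by lra.
have hy : x <= y <= y by lra.
rewrite (vE x hx) (vE y hy).
apply: po; [lra|by apply: within_sub cc|].
by move=> u uxy; have [|h _] := nb u uxy; [lra|split=> //; apply: oc; lra].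
Unshelve. all: by end_near. Qed.

(** Near a crossing the lift agrees with a single potential, so it is multiplied by the letter;
    between crossings [lift_off] applies. *)
Lemma lift_generic c a b sg : a <= b -> {within `[a, b], continuous c} -> generic_on G p c a b ->
  lift c a b sg -> exists2 k, crossing_list (G := G) p sheet c a b k &
    sg b (c b) = (sg a (c a) * word_value [seq x.2 | x <- k])%g.
Proof.
move=> ab cc cg ls.
apply: (generic_ind coverp labp (P := fun x y => exists2 k,
  crossing_list (G := G) p sheet c x y k &
  sg y (c y) = (sg x (c x) * word_value [seq x.2 | x <- k])%g) ab cc cg).
- move=> x y ax xy yb oc; exists [::].
    by apply: crossing_list_nil => t txy; apply: oc; lra.
  rewrite word_value_nil mulg1; apply/esym.
  by apply: (lift_off xy _ _ oc); [exact: within_sub cc|exact: lift_sub ls].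
- move=> x y t l ax yb sc; exists [:: (t, l)]; first exact: crossing_list_single.
  have [txy cxy oc cl] := sc.
  have tab : a <= t <= b by lra.
  have [phi [U [oU Ut [_ pc]]] nt] := ls t tab.
  have nU := path_near cc tab oU Ut.
  have [r r0 rP] : exists2 r : R, 0 < r & forall u, t - r < u < t + r ->
      a <= u <= b -> U (c u) /\ germ_eq (c u) (sg u) phi.
    by apply/nbhs_realP; near=> u => uab; split; move: uab; near: u.
  have tx0 : 0 < t - x by lra.
  have ty0 : 0 < y - t by lra.
  have [m [m0 mr mx my _]] := exists_lt4 r0 tx0 ty0 r0.
  have vE u : t - m <= u <= t + m -> u != t -> sg u (c u) = phi (c u).
    move=> ut nut; have ur : t - r < u < t + r by lra.
    have uab : a <= u <= b by lra.
    by have [_ /nbhs_singleton] := rP u ur uab; apply; apply: oc => //; lra.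
  have sc' : single_crossing (G := G) p sheet c (t - m) (t + m) t l.
    split=> //; first lra.
      by apply: within_sub cxy; lra.
    by move=> u ut; apply: (oc u); lra.

  have e1 : sg x (c x) = phi (c (t - m)).
    rewrite -vE; [|lra|lra]; apply: (@lift_off c); [lra| | |].
    + by apply: within_sub cc; lra.
    + by apply: lift_sub ls; lra.
    + by move=> u ux; apply: (oc u); lra.
  have e2 : sg y (c y) = phi (c (t + m)).
    rewrite -vE; [|lra|lra]; apply/esym; apply: (@lift_off c); [lra| | |].
    + by apply: within_sub cc; lra.
    + by apply: lift_sub ls; lra.
    + by move=> u ux; apply: (oc u); lra.
  rewrite e1 e2; apply: (pc c _ _ t l sc') => u ut.
  have ur : t - r < u < t + r by lra.
  have uab : a <= u <= b by lra.
  by have [] := rP u ur uab.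
- move=> x y z ax xy yz zb oy [k1 cl1 e1] [k2 cl2 e2]; exists (k1 ++ k2).
    exact: crossing_list_cat cl1 cl2.
  by rewrite e2 e1 map_cat word_value_cat mulgA.
Unshelve. all: by end_near. Qed.

Lemma homotopy_slice (H : R * R -> L) (s : R) :
  {within (`[0, 1] `*` `[0, 1]), continuous H} -> 0 <= s <= 1 ->
  {within `[0, 1], continuous (fun t => H (s, t))}.
Proof.
move=> cH Is; apply: within_continuous_comp cH.
  apply: continuous_subspaceT; apply: continuous_pair; first exact: cst_continuous.
  by move=> x.
by move=> t tI; split=> //=; rewrite in_itv.
Qed.

(** The slice [s0] is covered by boxes, each mapped by [H] into the domain of one potential, and
    continuation through a box does not depend on the nearby slice. The final [psi] is fixed before
    the slice [s], which makes the end germ locally constant in [s]. *)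
Lemma lift_homotopy_local (H : R * R -> L) phi (s0 : R) :
  {within (`[0, 1] `*` `[0, 1]), continuous H} -> 0 <= s0 <= 1 -> local_at (H (s0, 0)) phi ->
  exists psi, \forall s \near s0, 0 <= s <= 1 -> forall sg,
    lift (fun t => H (s, t)) 0 1 sg -> germ_eq (H (s, 0)) (sg 0) phi ->
    germ_eq (H (s, 1)) (sg 1) psi.
Proof.
move=> cH s01 l0.
have cHs := homotopy_slice cH.
pose P x y := forall phi, local_at (H (s0, x)) phi -> exists2 psi, local_at (H (s0, y)) psi &
  \forall s \near s0, 0 <= s <= 1 -> forall sg, lift (fun t => H (s, t)) 0 1 sg ->
    germ_eq (H (s, x)) (sg x) phi -> germ_eq (H (s, y)) (sg y) psi.
suff : P 0 1 by move=> /(_ phi l0)[psi _ h]; exists psi.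
apply: (@cousin R P 0 1 ler01) => {phi l0}.
  move=> x y z _ _ _ _ Pxy Pyz phi /Pxy[psi /Pyz[chi lchi n2] n1]; exists chi => //.
  near=> s => Is sg ls gx.
  have h1 : germ_eq (H (s, y)) (sg y) psi by move: Is sg ls gx; near: s.
  by move: Is sg ls h1 {gx}; near: s.
move=> t t01; have [U [chi [oU Ut pU]]] := local_potential triG coverp labp (H (s0, t)).
have nU : nbhs (H (s0, t)) U by apply: open_nbhs_nbhs.
have stI : (`[0, 1] `*` `[0, 1])%classic (s0, t) by split; rewrite /= in_itv.
have [[A B] /= [nA nB] AB] := (within_continuousP _ _).1 cH (s0, t) stI U nU.
exists B => // x y x0 xt ty y1 Bxy phi lphi.
have AU s u : A s -> 0 <= s <= 1 -> x <= u <= y -> U (H (s, u)).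
  move=> As Is ux; apply: (AB (s, u)); first by split=> //=; exact: Bxy.
  by split; rewrite /= in_itv //=; lra.
have As0 := nbhs_singleton nA.
have lchi : local_at (H (s0, x)) chi by exists U; split=> //; apply: AU => //; lra.
have [k gk] := germ_eq_mulg lphi lchi.
exists (fun z => k * chi z)%g.
  by apply: local_at_mulg; exists U; split=> //; apply: AU => //; lra.
(* An equality of germs at one point persists at all nearby points, in particular on neighbouring
   slices. *)
have nx : \forall s \near s0, 0 <= s <= 1 -> germ_eq (H (s, x)) phi (fun z => k * chi z)%g.
  have xI : (`[0, 1] `*` `[0, 1])%classic (s0, x) by split; rewrite /= in_itv //=; lra.
  move: gk; rewrite /germ_eq => /nbhs_interior ng.
  have [[A' B'] /= [nA' nB'] AB'] := (within_continuousP _ _).1 cH (s0, x) xI _ ng.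
  apply: filterS nA' => s A's Is; apply: (AB' (s, x)).
    by split=> //=; exact: nbhs_singleton nB'.
  by split; rewrite /= in_itv //=; lra.
near=> s => Is sg ls gx.
have As : A s by near: s.
have cst : lift (fun t => H (s, t)) x y (fun=> (fun z => k * chi z)%g).
  by apply: (lift_cst (U := U)) => //; [exact: potential_mulg|move=> u; exact: AU].
apply: (@lift_unique (fun t => H (s, t)) x y sg (fun=> (fun z => k * chi z)%g)) => //.
- lra.
- by apply: within_sub (cHs s Is).
- exact: lift_sub ls.
apply: germ_eq_trans gx _; move: Is; near: s; exact: nx.
Unshelve. all: by end_near. Qed.

(** All slices end at [q], off the graph, so the locally constant end germ has a value there, and
    [cousin] in the direction of [s] makes this value constant. [lift_exists] supplies the lift on
    an intermediate slice. *)
Lemma lift_homotopy (q : L) phi (c1 c2 : loop R q) sg1 sg2 : off q -> local_at q phi ->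
  homotopic c1 c2 -> lift c1 0 1 sg1 -> lift c2 0 1 sg2 ->
  germ_eq q (sg1 0) phi -> germ_eq q (sg2 0) phi -> sg1 1 q = sg2 1 q.
Proof.
move=> oq lq [H [cH H0 H1 Hq]] ls1 ls2 g1 g2.
have Hq' s : 0 <= s <= 1 -> H (s, 0) = q /\ H (s, 1) = q.
  by move=> Is; apply: Hq; rewrite /= in_itv.
have cHs := homotopy_slice cH.
have {}ls1 : lift (fun t => H (0, t)) 0 1 sg1.
  by apply: lift_ext ls1 => t t01; rewrite H0//= in_itv.
have {}ls2 : lift (fun t => H (1, t)) 0 1 sg2.
  by apply: lift_ext ls2 => t t01; rewrite H1//= in_itv.
pose P s s' := forall sg sg', lift (fun t => H (s, t)) 0 1 sg ->
  lift (fun t => H (s', t)) 0 1 sg' -> germ_eq q (sg 0) phi -> germ_eq q (sg' 0) phi ->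
  sg 1 q = sg' 1 q.
suff : P 0 1 by apply.
apply: (@cousin R P 0 1 ler01).
  move=> x y z x0 xy yz z1 Pxy Pyz sg sg' ls ls' gs gs'.
  have Iy : 0 <= y <= 1 by lra.
  have [|sg'' ls'' gs''] := lift_exists (phi := phi) ler01 (cHs y Iy).
    by have [-> _] := Hq' y Iy.
  move: gs''; have [-> _] := Hq' y Iy => gs''.
  by rewrite (Pxy sg sg'')// (Pyz sg'' sg').
move=> s s01; have [|psi ns] := lift_homotopy_local cH s01 (phi := phi).
  by have [-> _] := Hq' s s01.
exists [set s' | 0 <= s' <= 1 -> forall sg, lift (fun t => H (s', t)) 0 1 sg ->
    germ_eq q (sg 0) phi -> sg 1 q = psi q].
  apply: filterS ns => s' h s'01 sg ls gs; have [e0 e1] := Hq' s' s'01.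
  by have := h s'01 sg ls; rewrite e0 e1 => /(_ gs) /nbhs_singleton; apply.
move=> x y x0 xs sy y1 nb sg sg' ls ls' gs gs'.
rewrite (nb x _ _ sg ls gs); [|lra|lra].
by rewrite (nb y _ _ sg' ls' gs'); [|lra|lra].
Qed.

End Lifts.

(** * Generic representatives *)

Section GenericRepresentatives.
Variables (R : realType) (G : plane_graph R).
Variables (L : topologicalType) (p : L -> 'rV[R]_3).
Hypothesis coverp : branched_double_cover G p.
Local Notation off := (off_graph G p).
Local Notation gpath := (gpath G p).
Local Notation I := (`[0, 1]%classic : set R).

Lemma strip_glue (T : topologicalType) (F H : R * R -> T) (a m b : R) : a <= m -> m <= b ->
  {within I `*` `[a, m], continuous F} -> {within I `*` `[m, b], continuous H} ->
  (forall s, I s -> F (s, m) = H (s, m)) ->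
  {within I `*` `[a, b], continuous (fun x : R * R => if x.2 <= m then F x else H x)}.
Proof.
move=> am mb cF cH FH.
have cl (x y : R) : closed (I `*` `[x, y]%classic).
  rewrite (_ : _ `*` _ = fst @^-1` I `&` snd @^-1` `[x, y]%classic) //.
  apply: closedI.
  - by move/continuous_closedP: (@continuous_fst R R); apply; exact: interval_closed.
  - by move/continuous_closedP: (@continuous_snd R R); apply; exact: interval_closed.
have -> : I `*` `[a, b]%classic = I `*` `[a, m]%classic `|` I `*` `[m, b]%classic.
  apply/seteqP; split=> -[s t] /=; rewrite !in_itv /=.
    by move=> [Is tab]; have [tm|tm] := leP t m; [left|right]; split=> //; lra.
  by case=> -[Is tab]; split=> //; lra.
apply: withinU_continuous; [exact: cl|exact: cl| |].
- apply: within_continuous_ext cF => -[s t] /= [_]; rewrite in_itv /= => /andP[_ ->] //.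
- apply: within_continuous_ext cH => -[s t] /= [Is]; rewrite in_itv /= => /andP[mt _].
  by case: ifP => // tm; have -> : t = m; [apply/eqP; rewrite eq_le tm|rewrite FH].
Qed.

Lemma straight_homotopy_continuous (U : set L) (psi : L -> R * R) (g : R * R -> L) (r : R)
    (c d : R -> L) (a b : R) :
  {within U, continuous psi} -> {within rdisc r, continuous g} ->
  (forall z, U z -> rdisc r (psi z)) ->
  {within `[a, b], continuous c} -> {within `[a, b], continuous d} ->
  (forall t, a <= t <= b -> U (c t)) -> (forall t, a <= t <= b -> U (d t)) ->
  {within I `*` `[a, b], continuous (fun x : R * R =>
     g ((1 - x.1) * (psi (c x.2)).1 + x.1 * (psi (d x.2)).1,
        (1 - x.1) * (psi (c x.2)).2 + x.1 * (psi (d x.2)).2))}.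
Proof.
move=> cpsi cg Ur cc cd cU dU.
pose K (w : R * ((R * R) * (R * R))) : R * R :=
  ((1 - w.1) * w.2.1.1 + w.1 * w.2.2.1, (1 - w.1) * w.2.1.2 + w.1 * w.2.2.2).
have cK : continuous K.
  have c1 : continuous (fun w : R * ((R * R) * (R * R)) => w.1) by exact: continuous_fst.
  have c2 : continuous (fun w : R * ((R * R) * (R * R)) => w.2) by exact: continuous_snd.
  have comp (X Y Z : topologicalType) (f : X -> Y) (h : Y -> Z) :
    continuous f -> continuous h -> continuous (fun x => h (f x)).
    by move=> cf ch x; apply: continuous_comp; [exact: cf|exact: ch].
  have c21 := comp _ _ _ _ _ c2 (@continuous_fst _ _).
  have c22 := comp _ _ _ _ _ c2 (@continuous_snd _ _).
  have c211 := comp _ _ _ _ _ c21 (@continuous_fst _ _).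
  have c212 := comp _ _ _ _ _ c21 (@continuous_snd _ _).
  have c221 := comp _ _ _ _ _ c22 (@continuous_fst _ _).
  have c222 := comp _ _ _ _ _ c22 (@continuous_snd _ _).
  have one : continuous (fun w : R * ((R * R) * (R * R)) => 1 - w.1).
    by move=> w; apply: cvgB; [exact: cvg_cst|exact: c1].
  apply: continuous_pair => w; apply: cvgD; apply: cvgM;
    first [exact: one|exact: c1|exact: c211|exact: c212|exact: c221|exact: c222].
have csnd (e : R -> L) : {within `[a, b], continuous e} -> (forall t, a <= t <= b -> U (e t)) ->
    {within I `*` `[a, b], continuous (fun x : R * R => psi (e x.2))}.
  move=> ce eU; apply: (@within_continuous_comp _ _ _ _ U (fun x : R * R => e x.2) psi) cpsi.
    apply: (@within_continuous_comp _ _ _ _ `[a, b]%classic snd e) ce.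
      by apply: continuous_subspaceT; exact: continuous_snd.
    by move=> x [].
  by move=> x [_]; rewrite /= in_itv => /eU.
apply: (@within_continuous_comp _ _ _ _ (rdisc r)
  (fun x : R * R => K (x.1, (psi (c x.2), psi (d x.2)))) g) cg.
  apply: (@within_continuous_comp _ _ _ _ setT
    (fun x : R * R => (x.1, (psi (c x.2), psi (d x.2)))) K) => //; last exact: continuous_subspaceT.
  apply: continuous_pair; last by apply: continuous_pair; exact: csnd.
  by apply: continuous_subspaceT; exact: continuous_fst.
move=> [s t] [/=]; rewrite !in_itv /= => Is It.
by apply: rdisc_segment => //; apply: Ur; [exact: cU|exact: dU].
Qed.

(** The straight homotopy in the disc chart fixes the ends of the piece, where [c] and [d] agree,
    and so extends by the constant homotopy to the rest of the loop. *)
Lemma loop_replace (q y : L) (c : loop R q) (U : set L) (psi : L -> R * R) (d : R -> L) (a b : R) :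
  disc_chart U psi y -> 0 <= a -> a <= b -> b <= 1 ->
  (forall t, a <= t <= b -> U (c t)) -> (forall t, a <= t <= b -> U (d t)) ->
  {within `[a, b], continuous d} -> d a = c a -> d b = c b ->
  exists e : loop R q, [/\ homotopic c e, forall t, a <= t <= b -> e t = d t
    & forall t, 0 <= t <= 1 -> t <= a \/ b <= t -> e t = c t].
Proof.
move=> [oU Uy psiy [r r0 [g [cpsi cg Upsi gU]]]] a0 ab b1 cU dU cd da db.
pose M (x : R * R) := g ((1 - x.1) * (psi (c x.2)).1 + x.1 * (psi (d x.2)).1,
  (1 - x.1) * (psi (c x.2)).2 + x.1 * (psi (d x.2)).2).
pose H (x : R * R) := if x.2 <= a then c x.2 else if x.2 <= b then M x else c x.2.
have gK z : U z -> g (psi z) = z by move=> /Upsi[].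
have Meq s t : a <= t <= b -> c t = d t -> M (s, t) = c t.
  move=> tab cdt; rewrite /M /= -cdt -!mulrDl subrK !mul1r -surjective_pairing gK//.
  exact: cU.
have M0 t : a <= t <= b -> M (0, t) = c t.
  by move=> tab; rewrite /M /= subr0 !mul1r !mul0r !addr0 -surjective_pairing gK//; exact: cU.
have M1 t : a <= t <= b -> M (1, t) = d t.
  by move=> tab; rewrite /M /= subrr !mul1r !mul0r !add0r -surjective_pairing gK//; exact: dU.
have aI : a <= a <= b by rewrite lexx ab.
have bI : a <= b <= b by rewrite lexx ab.
have csub (x z : R) : 0 <= x -> z <= 1 -> {within I `*` `[x, z], continuous (fun w : R * R => c w.2)}.
  move=> x0 z1; apply: (@within_continuous_comp _ _ _ (I `*` `[x, z]%classic) I snd c _ _ (@loop_cont _ _ _ c)).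
    by apply: continuous_subspaceT; exact: continuous_snd.
  by move=> [s t] [/= _]; rewrite !in_itv /= => tI; lra.
have cM : {within I `*` `[a, b], continuous M}.
  apply: (@straight_homotopy_continuous U psi g r c d a b) => //.
  - by move=> z /Upsi[].
  - exact: within_sub (@loop_cont _ _ _ c).
have cH : {within I `*` I, continuous H}.
  apply: strip_glue => //; [lra|apply: csub; lra| |].
    apply: strip_glue => //; first by apply: csub; lra.
    by move=> s Is; rewrite /= Meq.
  by move=> s Is; rewrite /= ab Meq.
have HM s t : a <= t <= b -> H (s, t) = M (s, t).
  move=> tab; have /andP[at_ tb] := tab; rewrite /H /= tb; case: ifP => // ta.
  by have -> : t = a; [apply/eqP; rewrite eq_le ta|rewrite Meq].
have Hc s t : 0 <= t <= 1 -> t <= a \/ b <= t -> H (s, t) = c t.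
  move=> t01 [ta|bt]; first by rewrite /H /= ta.
  rewrite /H /=; case: ifP => // _; case: ifP => // tb.
  by have -> : t = b; [apply/eqP; rewrite eq_le tb|rewrite Meq].
have c1 := homotopy_slice cH (s := 1).
have H0 s : H (s, 0) = q by rewrite Hc ?loop0//; [lra|left].
have H1 s : H (s, 1) = q by rewrite Hc ?loop1//; [lra|right].
have {}c1 : {within `[0, 1], continuous (fun t => H (1, t))} by apply: c1; lra.
exists (Loop c1 (H0 1) (H1 1)); split.
- exists H; split=> //= t; rewrite in_itv /= => t01.
  have [ta|at_] := leP t a; first by apply: Hc => //; left.
  have [bt|tb] := leP b t; first by apply: Hc => //; right.
  by rewrite HM ?M0//; lra.
- by move=> t tab /=; rewrite HM ?M1.
- by move=> t t01 h /=; exact: Hc.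
Qed.

(** A segment of a disc chart ending at its centre. It may meet the graph arbitrarily, which is
    harmless in a tail that is replaced later. *)
Lemma escape_path (y : L) (O : set L) (a b : R) : nbhs y O -> a < b ->
  exists z d, [/\ O z /\ off z, {within `[a, b], continuous d}, d a = z, d b = y
    & forall t, a <= t <= b -> O (d t)].
Proof.
move=> Oy ab; have [U [psi [[oU Uy psiy [r r0 [g [cpsi cg Upsi gU]]]] UO]]] :=
  disc_chart_exists coverp Oy.
have nU : nbhs y U by apply: open_nbhs_nbhs.
have [z [Uz oz]] := off_dense coverp nU.
have [dz gz] := Upsi z Uz; have [dy gy] := Upsi y Uy.
pose f (t : R) := g ((1 - t) * (psi z).1 + t * (psi y).1, (1 - t) * (psi z).2 + t * (psi y).2).
have [k [l [k0 ka kb]]] := itv_to_unit ab.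
have J t : a <= t <= b -> 0 <= k * t + l <= 1 by move=> tab; rewrite -ka -kb; nra.
exists z, (fun t => f (k * t + l)); split.
- by split=> //; exact: UO.
- apply: (@within_continuous_comp _ _ _ _ I (fun t => k * t + l) f).
  + apply: continuous_subspaceT => t; exact: is_derive_continuous (is_derive_affine _ _ _).
  + by move=> t; rewrite /= !in_itv /=; exact: J.
  + exact: segment_path.
- by rewrite ka /f subr0 !mul1r !mul0r !addr0 -surjective_pairing.
- by rewrite kb /f subrr !mul1r !mul0r !add0r -surjective_pairing.
- move=> t tab; apply: UO.
  by have [Ug _] := gU _ (rdisc_segment dz dy (J t tab)).
Qed.

(** Generic pieces must end off the graph, while [c x] may lie on it, hence the tail. One step
    replaces the tail and the next piece of [c], both in one chart, by a generic path to a point [z]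
    off the graph, followed by a new tail inside the prescribed neighbourhood. At time 1 the end
    point [q] is off the graph, and the tail is replaced altogether. *)
Lemma generic_representative (q : L) (c : loop R q) : off q ->
  exists2 d : loop R q, generic G p d & homotopic c d.
Proof.
move=> oq.
(* [A x]: up to homotopy, [c] is generic on [0, x] except for an arbitrarily short tail. *)
pose A x := forall W, nbhs (c x) W -> exists (d : loop R q) m, [/\ homotopic c d, 0 <= m <= x,
  forall t, x <= t <= 1 -> d t = c t, generic_on G p d 0 m & forall t, m <= t <= x -> W (d t)].
have A0 : A 0.
  move=> W nW; exists c, 0; split=> //; first exact: homotopic_refl.
  - by rewrite lexx.
  - apply: generic_off => t t0; have -> : t = 0 by lra.
    by rewrite loop0.
  - by move=> t t0; (have -> : t = 0 by lra); exact: nbhs_singleton nW.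
have offm (d : R -> L) m : 0 <= m -> generic_on G p d 0 m -> off (d m).
  by move=> m0 [_ gc] gm; have [|] := gc m _ gm; [rewrite lexx m0|rewrite ltxx andbF].
have A1 : A 1.
  apply: (@cousin R (fun x y => A x -> A y) 0 1 ler01) => //.
    by move=> x y z _ _ _ _ h1 h2 /h1.
  move=> t t01; have nT : nbhs (c t) (setT : set L) by exact: filterT.
  have [U [psi [ch _]]] := disc_chart_exists coverp nT.
  have [oU Ut _ _] := ch.
  have nU : nbhs (c t) U by apply: open_nbhs_nbhs.
  have [V Vt [oV VU _ jV]] := join coverp nU.
  exists [set u | 0 <= u <= 1 -> V (c u)]; first exact: path_near (@loop_cont _ _ _ c) t01 oV Vt.
  move=> x y x0 xt ty y1 nb Ax.
  have [yx|xy] := leP y x.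
    by have -> : y = x by lra.
  move=> W nW.
  have cV u : x <= u <= y -> V (c u) by move=> uxy; apply: nb => //; lra.
  have [|d [m [cd mx dc gd dV]]] := Ax V.
    by apply: open_nbhs_nbhs; split=> //; apply: cV; lra.
  have dV' u : m <= u <= y -> V (d u).
    move=> uI; have [ux|xu] := leP u x; first by apply: dV; lra.
    by rewrite dc; [apply: cV|]; lra.
  have m0 : 0 <= m by lra.
  have my : m < y by lra.
  have om := offm d m m0 gd.
  (* The new generic part occupies [m, n] and the new tail [n, y]. *)
  pose n := (m + y) / 2.
  have mn : m < n by rewrite /n; lra.
  have ny : n < y by rewrite /n; lra.
  have nVW : nbhs (c y) (V `&` W).
    by apply: filterI => //; apply: open_nbhs_nbhs; split=> //; apply: cV; lra.
  have [z [d2 [[[Vz Wz] oz] cd2 d2n d2y d2O]]] := escape_path nVW ny.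
  have Vm : V (d m) by apply: dV'; lra.
  have [d1 [[cd1 d1U gd1] d1m d1n]] := gpath_itv (jV _ _ Vm Vz om oz) mn.
  pose d3 (u : R) := if u <= n then d1 u else d2 u.
  have [e [de eI eO]] : exists e : loop R q, [/\ homotopic d e,
      forall t, m <= t <= y -> e t = d3 t & forall t, 0 <= t <= 1 -> t <= m \/ y <= t -> e t = d t].
    apply: (loop_replace ch); rewrite ?(ltW my)//.
    - by move=> u uI; apply: VU; exact: dV'.
    - move=> u uI; rewrite /d3; case: leP => un; first by apply: d1U; lra.
      by have [|Vd _] := d2O u; [lra|exact: VU].
    - by apply: glue_continuous; rewrite ?ltW// d1n.
    - by rewrite /d3 (ltW mn).
    - by rewrite /d3 leNgt ny /= d2y dc// y1 ltW.
  exists e, n; split.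
  - exact: homotopic_trans cd de.
  - by rewrite /n; lra.
  - by move=> u uI; rewrite eO ?dc//; [lra|lra|right; lra].
  - apply: (@generic_glue _ _ _ _ _ 0 m n m0 (ltW mn)).
      by apply: generic_ext gd => u um; rewrite eO//; [lra|left; lra].
    apply: generic_ext gd1 => u um; rewrite eI; last lra.
    by rewrite /d3; have /andP[_ ->] := um.
  - move=> u un; rewrite eI; last lra.
    rewrite /d3; case: leP => un'.
      have -> : u = n by lra.
      by rewrite d1n.
    by have [|_ Wd] := d2O u; [lra|].
have nT : nbhs q (setT : set L) by exact: filterT.
have [U [psi [ch _]]] := disc_chart_exists coverp nT.
have [oU Uq _ _] := ch.
have nU : nbhs q U by apply: open_nbhs_nbhs.
have [V Vq [oV VU _ jV]] := join coverp nU.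
have [|d [m [cd m01 _ gd dV]]] := A1 V; first by rewrite loop1; apply: open_nbhs_nbhs.
have [m0 m1] := andP m01.
have [e1|mn1] := eqVneq m 1; first by exists d => //; move: gd; rewrite e1.
have {}m1 : m < 1 by rewrite lt_neqAle mn1.
have om := offm d m m0 gd.
have Vm : V (d m) by apply: dV; rewrite lexx ltW.
have [d1 [[cd1 d1U gd1] d1m d1n]] := gpath_itv (jV _ _ Vm Vq om oq) m1.
have [e [de eI eO]] : exists e : loop R q, [/\ homotopic d e,
    forall t, m <= t <= 1 -> e t = d1 t & forall t, 0 <= t <= 1 -> t <= m \/ 1 <= t -> e t = d t].
  apply: (loop_replace ch) => //; first exact: ltW.
  - by move=> u uI; apply: VU; exact: dV.
  - by rewrite d1n loop1.
exists e; last exact: homotopic_trans cd de.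
apply: (@generic_glue _ _ _ _ _ 0 m 1 m0 (ltW m1)).
  by apply: generic_ext gd => u um; rewrite eO//; [lra|left; lra].
by apply: generic_ext gd1 => u um; rewrite eI.
Qed.

End GenericRepresentatives.

(** * Geometric elements of generic loops *)

Section GeometricElements.
Variables (R : realType) (G : plane_graph R).
Variables (L : topologicalType) (p : L -> 'rV[R]_3) (sheet : L -> bool).
Hypothesis triG : trivalent G.
Hypothesis coverp : branched_double_cover G p.
Hypothesis labp : sheet_labelling G p sheet.
Variable q : L.
Hypothesis offq : off_graph G p q.
Local Notation element := (geometric_element (G := G) p sheet).
Local Notation lift := (lift (G := G) p sheet).
Implicit Types c d e : loop R q.

(** The closed interval of [geometric_element] and the half-open one of [crossing_list] contain the
    same crossings, since the loop ends off the graph. *)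
Lemma geometric_element_list c g : element c g <->
  exists2 k, crossing_list (G := G) p sheet c 0 1 k & g = word_value [seq x.2 | x <- k].
Proof.
have times t : 0 <= t < 1 /\ graph_set G (p (c t)) <-> 0 <= t <= 1 /\ graph_set G (p (c t)).
  split=> -[t01 gt]; split=> //; first lra.
  have t1 : t != 1 by apply/eqP => t1; apply: offq; move: gt; rewrite t1 loop1.
  by have /andP[-> h] := t01; rewrite lt_neqAle t1.
split=> [[k [sk tk lk gk]]|[k [sk tk lk] gk]].
  by exists k => //; split=> // t; rewrite tk; symmetry; exact: times.
by exists k; split=> // t; rewrite tk; exact: times.
Qed.

Lemma geometric_element_unique c g g' : element c g -> element c g' -> g = g'.
Proof.
move=> /geometric_element_list[k ck ->] /geometric_element_list[k' ck' ->].
by rewrite (crossing_list_unique ck ck').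
Qed.

Lemma geometric_element_lift c sg : generic G p c -> lift c 0 1 sg ->
  element c ((sg 0%R q)^-1 * sg 1%R q)%g.
Proof.
move=> gc ls; have [k ck e] := lift_generic coverp labp ler01 (@loop_cont _ _ _ c) gc ls.
apply/geometric_element_list; exists k => //.
by move: e; rewrite loop0 loop1 => ->; rewrite mulKg.
Qed.

Lemma loop_lift_exists c phi : local_at (G := G) p sheet q phi ->
  exists2 sg : R -> L -> Pi G, lift c 0 1 sg & germ_eq (G := G) p q (sg 0) phi.
Proof.
move=> lphi; have := @lift_exists R G L p sheet triG coverp labp c 0 1 phi ler01.
by rewrite loop0; apply=> //; exact: loop_cont.
Qed.

Lemma geometric_element_exists c : generic G p c -> exists g, element c g.
Proof.
move=> gc; have [U [phi [oU Uq pU]]] := local_potential triG coverp labp q.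
have lphi : local_at (G := G) p sheet q phi by exists U.
by have [sg ls _] := loop_lift_exists c lphi; eexists; exact: geometric_element_lift ls.
Qed.

Lemma homotopic_geometric_element c d g h : generic G p c -> generic G p d ->
  homotopic c d -> element c g -> element d h -> g = h.
Proof.
move=> gc gd cd eg eh; have [U [phi [oU Uq pU]]] := local_potential triG coverp labp q.
have lphi : local_at (G := G) p sheet q phi by exists U.
have [sc lc c0] := loop_lift_exists c lphi; have [sd ld d0] := loop_lift_exists d lphi.
rewrite (geometric_element_unique eg (geometric_element_lift gc lc)).
rewrite (geometric_element_unique eh (geometric_element_lift gd ld)).
rewrite (lift_homotopy triG coverp labp offq lphi cd lc ld c0 d0).
by rewrite (nbhs_singleton c0 offq) (nbhs_singleton d0 offq).
Qed.

(** A lift along [loop_cat c d], restricted to its halves and rescaled, lifts [c] and [d].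
    [geometric_element_lift] accepts any initial germ, so the second half can start from the germ
    reached by the first, and the two quotients telescope. The homotopy transfers the end value to
    [e]. *)
Lemma geometric_element_cat c d e g h k : generic G p c -> generic G p d -> generic G p e ->
  homotopic e (loop_cat c d) -> element c g -> element d h -> element e k -> k = (g * h)%g.
Proof.
move=> gc gd ge ecd eg eh ek; have [U [phi [oU Uq pU]]] := local_potential triG coverp labp q.
have lphi : local_at (G := G) p sheet q phi by exists U.
have [sg ls s0] := loop_lift_exists (loop_cat c d) lphi.
have [se le e0] := loop_lift_exists e lphi.
have h0 : (0 : R) < 2^-1 by rewrite invr_gt0.
have lc : lift c 0 1 (fun t => sg (2^-1 * t + 0)).
  apply: (@lift_ext _ _ _ _ _ (fun t => loop_cat c d (2^-1 * t + 0))).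
    move=> t t01; rewrite /= /cat_fun ifT; last by lra.
    by congr (c _); field.
  by apply: lift_affine => //; apply: lift_sub ls; lra.
have ld : lift d 0 1 (fun t => sg (2^-1 * t + 2^-1)).
  apply: (@lift_ext _ _ _ _ _ (fun t => loop_cat c d (2^-1 * t + 2^-1))).
    move=> t t01; rewrite /= /cat_fun; case: ifP => th; last by congr (d _); field.
    have -> : t = 0 by lra.
    by rewrite loop0 mulr0 add0r divff// loop1.
  by apply: lift_affine => //; apply: lift_sub ls; lra.
rewrite (geometric_element_unique eg (geometric_element_lift gc lc)).
rewrite (geometric_element_unique eh (geometric_element_lift gd ld)).
rewrite (geometric_element_unique ek (geometric_element_lift ge le)).
rewrite (lift_homotopy triG coverp labp offq lphi ecd le ls e0 s0).
rewrite (nbhs_singleton e0 offq) -(nbhs_singleton s0 offq) !mulr0 !mulr1 !addr0 add0r.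
have -> : 2^-1 + 2^-1 = 1 :> R by field.
by rewrite -mulgA mulVKg.
Qed.

End GeometricElements.
Theorem theorem3p8 (R : realType) (G : plane_graph R) (triG : trivalent G)
    (L : topologicalType) (p : L -> 'rV[R]_3) (sheet : L -> bool)
    (coverp : branched_double_cover G p) (labp : sheet_labelling G p sheet)
    (f : set 'rV[R]_3) (facef : face G f) (q : L) (fq : f (p q)) :
  (forall c : loop R q, generic G p c ->
     exists! g : Pi G, geometric_element p sheet c g) /\
  (forall c1 c2 : loop R q, generic G p c1 -> generic G p c2 ->
     loop_class c1 = loop_class c2 ->
     forall g1 g2 : Pi G, geometric_element p sheet c1 g1 ->
       geometric_element p sheet c2 g2 -> g1 = g2) /\
  (forall x : pi1 R q, exists2 c : loop R q, generic G p c & loop_class c = x) /\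
  (exists Psi : {multiplicative pi1 R q -> Pi G},
     forall c : loop R q, generic G p c ->
       geometric_element p sheet c (Psi (loop_class c))).
Proof.
have offq : off_graph G p q.
  have [x sx fE] := facef; move: fq; rewrite fE.
  by move=> /connected_component_sub[].
have rep (x : pi1 R q) : exists2 c : loop R q, generic G p c & loop_class c = x.
  have [d gd cd] := generic_representative coverp (repr x) offq.
  by exists d => //; rewrite -[RHS]reprK; apply/esym/loop_classP.
split.
  move=> c gc; have [g eg] := geometric_element_exists triG coverp labp offq gc.
  by exists g; split=> // g'; exact: geometric_element_unique eg.
split.
  move=> c1 c2 gc1 gc2 /loop_classP c12 g1 g2.
  exact: homotopic_geometric_element.
split; first exact: rep.
(* [Psi] is defined through a chosen generic representative of each class; multiplicativity compares
   the choice for a product with the concatenation of the choices for its factors. *)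
pose r x := sval (cid2 (rep x)).
have gr x : generic G p (r x) by rewrite /r; case: cid2.
have rE x : loop_class (r x) = x by rewrite /r; case: cid2.
pose F x := sval (cid (geometric_element_exists triG coverp labp offq (gr x))).
have FE x : geometric_element p sheet (r x) (F x) by rewrite /F; case: cid.
have FM : {morph F : x y / (x * y)%g}.
  move=> x y; apply: (geometric_element_cat triG coverp labp offq (gr x) (gr y) (gr (x * y)%g)) => //.
  by apply/loop_classP; rewrite -pi1_mulE !rE.
pose Psi : {multiplicative pi1 R q -> Pi G} :=
  HB.pack F (isMultiplicative.Build _ _ F FM).
exists Psi => c gc; have [g eg] := geometric_element_exists triG coverp labp offq gc.
suff -> : Psi (loop_class c) = g by [].
apply: (homotopic_geometric_element triG coverp labp offq (gr (loop_class c)) gc) => //.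
by apply/loop_classP; rewrite rE.
Qed.
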